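(* Let $(a_n)_{n\geq0}$ be a sequence of complex numbers with infinitely many non-zero terms, and let $$f_n(z)=\sum_{k=0}^n a_kJ_k(kz)$$ be the sections of the Kapteyn series $\sum_{n=0}^\infty a_nJ_n(nz)$. Then for every index $n'$ with $a_{n'}\neq0$, every $\theta\in\mathbb{R}$, and every sufficiently small $\delta>0$ (depending on $\theta$), $$\lim_{r\to\infty}\frac{N_{f_{n'}}(r;\theta-\delta,\theta+\delta)}{r}=\begin{cases}\dfrac{n'}{\pi}&\text{if }\theta\in\pi\mathbb{Z},\\[2mm]0&\text{otherwise.}\end{cases}$$
   Context: $J_k$ denotes the Bessel function of the first kind of order $k$. For an entire function $f\not\equiv0$, $N_f(r;\alpha,\beta)$ denotes the number of zeros of $f$ (counted with multiplicity) in the finite sector $|z|<r$, $\alpha<\arg(z)<\beta$ (arguments taken modulo $2\pi$). *)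

(* Defs.v *)
From HB Require Import structures.
From mathcomp Require Import all_boot all_order all_algebra.
From mathcomp Require Import complex.
From mathcomp Require Import all_classical all_reals all_analysis.

Set Implicit Arguments.
Unset Strict Implicit.
Unset Printing Implicit Defensive.

Import Order.TTheory GRing.Theory Num.Theory.
Import numFieldNormedType.Exports.

Local Open Scope classical_set_scope.
Local Open Scope ring_scope.
Local Open Scope complex_scope.

(* [R[i]^o] is [R[i]] with the topology given by its modulus. *)
Definition besselJ (R : realType) (k : nat) (z : R[i]) : R[i]^o :=
  limn (series (fun m : nat =>
    (-1) ^+ m / (m`! * (m + k)`!)%N%:R * (z / 2%:R) ^+ (2 * m + k)%N : R[i]^o)).

Definition kapteyn_section (R : realType) (a : nat -> R[i]) (n : nat)
    (z : R[i]) : R[i]^o :=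
  \sum_(k < n.+1) a k * besselJ k (k%:R * z).

(* Order of vanishing of [f] at [z], the derivatives being complex ones:
   [+oo] if they all vanish at [z]. *)
Definition zero_order (R : realType) (f : R[i] -> R[i]^o) (z : R[i]) : \bar R :=
  ereal_sup [set (m%:R)%:E | m in
    [set m : nat | forall j : nat, (j < m)%N -> derive1n j f z = 0]].

(* The argument is only defined modulo 2 pi, and not at all at the origin. *)
Definition sector (R : realType) (r alpha beta : R) : set R[i] :=
  [set z | exists rho t : R, [/\ 0 < rho < r, alpha < t < beta &
    z = (rho * cos t) +i* (rho * sin t)]].

(* An unconditional sum of nonnegative terms, hence [+oo] if there are
   infinitely many zeros in the sector. *)
Definition zero_count (R : realType) (f : R[i] -> R[i]^o) (r alpha beta : R) :
    \bar R :=
  \esum_(z in sector r alpha beta `&` [set z | f z = 0]) zero_order f z.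

(* Main.v *)
(**
  For large y and 0 <= x <= c y the Bessel equation along a horizontal line
  shows that J_k (k z), k >= 1, z = x + i y, is asymptotic to
  k^(-1/2) i^k e^(-i k x) (-i z)^(-1/2) times a function of y growing like
  e^(k y), so the last term of the section f = f_n dominates there: f has no
  zero, and its argument turns like -n x.
  Zeros in a sector away from the real axis are therefore bounded.
  On vertical segments the variation of the argument is at most pi times one
  plus the number of sign changes of a real part, which Jensen's inequality and
  |f (x + i y)| <= B e^(K |y|), x >= 1, bound by O(height).
  The argument principle on [x0, x1] x [-H, H] with H = 2 r / c now gives
  n x1 / pi + O(H) zeros; all but boundedly many of them satisfy
  c |Im z| < Re z, and c is arbitrarily large.  The direction theta = m pi
  reduces to theta = 0, since f (- z) is a section with coefficients (-1)^k a_k.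
*)
Require Import Defs.
From HB Require Import structures.
From mathcomp Require Import all_boot all_order all_algebra.
From mathcomp Require Import complex.
From mathcomp Require Import all_classical all_reals all_analysis.
From mathcomp Require Import ring lra zify.

Set Implicit Arguments.
Unset Strict Implicit.
Unset Printing Implicit Defensive.

Import Order.TTheory GRing.Theory Num.Theory.
Import numFieldNormedType.Exports.

Local Open Scope classical_set_scope.
Local Open Scope ring_scope.
Local Open Scope complex_scope.

(** The vertical sides decide what must be proved. Jensen's inequality is applied at their top
    corners, where dominance bounds |f| from below. On the far side the global bound e^(n |z|) would
    give an error of order r, as large as the main term; a bound by the height alone is required,
    and an energy estimate for the Bessel equation supplies it, first along the real axis and then
    vertically. Moreover the factor [D] of the error [D * H] has to be fixed before [c]: it involves
    exponential rates only, while the constants that depend on [c] are additive and disappear after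
    division by r. The asymptotics come from the differential equation and not from integral
    representations. On the imaginary axis J_k is, up to a power of i, the modified function I_k,
    positive and increasing by its series. This provides initial data for each horizontal line, and
    on a stretch of length c y the term nu / z^2 perturbs a pure oscillation by O(c / y) only. The
    function theory rests on finite sums: means over roots of unity, divided differences, and sums
    of principal arguments over fine meshes. *)

Local Notation cabs := Normc.normc.

(** * Polynomials and entire functions *)

Section Modulus.
Variable R : realType.
Implicit Types (z w : R[i]) (x y : R).

Lemma normE z : `|z| = (cabs z)%:C.
Proof. by case: z. Qed.

Lemma cabs0 : cabs (0 : R[i]) = 0.
Proof. exact: Normc.normc0. Qed.

Lemma cabs1 : cabs (1 : R[i]) = 1.
Proof. exact: Normc.normc1. Qed.

Lemma cabsM z w : cabs (z * w) = cabs z * cabs w.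
Proof. exact: Normc.normcM. Qed.

Lemma cabsV z : cabs z^-1 = (cabs z)^-1.
Proof. exact: Normc.normcV. Qed.

Lemma cabsD z w : cabs (z + w) <= cabs z + cabs w.
Proof. exact: le_normcD. Qed.

Lemma cabsN z : cabs (- z) = cabs z.
Proof. exact: normcN. Qed.

Lemma cabsB z w : cabs (z - w) <= cabs z + cabs w.
Proof. by rewrite -(cabsN w) cabsD. Qed.

Lemma cabs_ge0 z : 0 <= cabs z.
Proof. by case: z => a b /=; rewrite sqrtr_ge0. Qed.

Lemma cabs_eq0 z : (cabs z == 0) = (z == 0).
Proof. by apply/eqP/eqP => [/Normc.eq0_normc//|->]; rewrite cabs0. Qed.

Lemma cabs_gt0 z : (0 < cabs z) = (z != 0).
Proof. by rewrite lt_neqAle cabs_ge0 andbT eq_sym cabs_eq0. Qed.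

Lemma cabsX z n : cabs (z ^+ n) = cabs z ^+ n.
Proof. by elim: n => [|n IH]; rewrite ?expr0 ?cabs1// !exprS cabsM IH. Qed.

Lemma cabs_distC z w : cabs (z - w) = cabs (w - z).
Proof. by rewrite -cabsN opprB. Qed.

Lemma cabs_lub z w : cabs z - cabs w <= cabs (z - w).
Proof. by rewrite lerBlDr -{1}(subrK w z) cabsD. Qed.

Lemma sqr_cabs z : cabs z ^+ 2 = complex.Re z ^+ 2 + complex.Im z ^+ 2.
Proof. by case: z => a b /=; rewrite sqr_sqrtr // addr_ge0 ?sqr_ge0. Qed.

Lemma cabs_real x : cabs x%:C = `|x|.
Proof. by rewrite /= expr0n addr0 sqrtr_sqr. Qed.

Lemma cabs_nat n : cabs (n%:R : R[i]) = n%:R.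
Proof. by rewrite -[n%:R](rmorph_nat (real_complex R)) cabs_real ger0_norm. Qed.

Lemma Re_le_cabs z : `|complex.Re z| <= cabs z.
Proof.
rewrite -(@ler_pXn2r _ 2) ?nnegrE ?cabs_ge0 ?normr_ge0// sqr_cabs.
by rewrite real_normK ?num_real// lerDl sqr_ge0.
Qed.

Lemma Im_le_cabs z : `|complex.Im z| <= cabs z.
Proof.
rewrite -(@ler_pXn2r _ 2) ?nnegrE ?cabs_ge0 ?normr_ge0// sqr_cabs.
by rewrite real_normK ?num_real// lerDr sqr_ge0.
Qed.

Lemma cabs_le_ReIm z : cabs z <= `|complex.Re z| + `|complex.Im z|.
Proof.
case: z => a b /=; rewrite -(@ler_pXn2r _ 2) ?nnegrE ?addr_ge0 ?sqrtr_ge0//.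
rewrite sqr_sqrtr ?addr_ge0 ?sqr_ge0// sqrrD !real_normK ?num_real//.
rewrite lerD2r lerDl mulrn_wge0// mulr_ge0//.
Qed.

Lemma cabsJ z : cabs (z^*) = cabs z.
Proof. by case: z => a b /=; rewrite sqrrN. Qed.

Lemma cabs_sum (I : Type) (r : seq I) (P : pred I) (F : I -> R[i]) :
  cabs (\sum_(i <- r | P i) F i) <= \sum_(i <- r | P i) cabs (F i).
Proof.
elim/big_rec2: _ => [|i y z _ h]; first by rewrite cabs0.
by apply: le_trans (cabsD _ _) _; rewrite lerD2l.
Qed.

Lemma cabs_prod (I : Type) (r : seq I) (P : pred I) (F : I -> R[i]) :
  cabs (\prod_(i <- r | P i) F i) = \prod_(i <- r | P i) cabs (F i).
Proof.
elim/big_rec2: _ => [|i y z _ h]; first by rewrite cabs1.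
by rewrite cabsM h.
Qed.

Definition expi (t : R) : R[i] := cos t +i* sin t.

Lemma expi0 : expi 0 = 1.
Proof. by rewrite /expi cos0 sin0. Qed.

Lemma expiD x y : expi (x + y) = expi x * expi y.
Proof. by rewrite /expi cosD sinD; simpc; congr (_ +i* _); rewrite addrC. Qed.

Lemma cabs_expi x : cabs (expi x) = 1.
Proof. by rewrite /= cos2Dsin2 sqrtr1. Qed.

Lemma expi_neq0 x : expi x != 0.
Proof. by rewrite -cabs_gt0 cabs_expi ltr01. Qed.

Lemma expiX x n : expi x ^+ n = expi (n%:R * x).
Proof.
elim: n => [|n IH]; first by rewrite expr0 mul0r expi0.
by rewrite exprS IH -expiD -natr1; congr expi; ring.
Qed.

Lemma expiN x : expi (- x) = (expi x)^-1.
Proof.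
apply: (mulfI (expi_neq0 x)).
by rewrite -expiD subrr expi0 divff// expi_neq0.
Qed.

Lemma expi_pi : expi pi = -1.
Proof. by rewrite /expi cospi sinpi; apply/eqP; rewrite eq_complex /= oppr0 !eqxx. Qed.

Lemma expi_2pi : expi (pi *+ 2) = 1.
Proof. by rewrite mulr2n expiD expi_pi mulrNN mulr1. Qed.

Lemma cos_eq1 x : `|x| < pi *+ 2 -> cos x = 1 -> x = 0.
Proof.
move=> xlt; rewrite -[x in cos x](mulfVK (_ : (2:R) != 0))// mulrC.
have -> : 2 * (x / 2) = (x / 2) *+ 2 by rewrite mulr_natl.
rewrite cos_mulr2n cos2sin2 => h.
have s0 : sin (x / 2) = 0.
  by apply/eqP; rewrite -sqrf_eq0; apply/eqP; lra.
apply/eqP; case: (ltrgtP x 0) => // hx.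
- have : 0 < sin (- (x / 2)).
    by apply: sin_gt0_pi; move: xlt; rewrite ltr0_norm//; lra.
  by rewrite sinN s0 oppr0 ltxx.
- have : 0 < sin (x / 2).
    by apply: sin_gt0_pi; move: xlt; rewrite gtr0_norm//; lra.
  by rewrite s0 ltxx.
Qed.

Lemma expi_eq1 x : `|x| < pi *+ 2 -> expi x = 1 -> x = 0.
Proof. by move=> h [] + _; exact: cos_eq1. Qed.

End Modulus.

(** * Maximum principle and divided differences for polynomials *)

Section MaxPoly.
Variable R : realType.
Local Notation C := R[i].
Implicit Types (p : {poly C}) (z c : C).

(* A primitive [n]-th root of unity is [expi (2 pi / n)]. *)
Lemma sum_unity_roots n k : (0 < k < n)%N ->
  \sum_(j < n) expi (pi *+ 2 / n%:R : R) ^+ (j * k) = 0.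
Proof.
move=> /andP[k0 kn]; set w := expi _.
have n0 : (n%:R : R) != 0 by rewrite pnatr_eq0; lia.
have wk : w ^+ k != 1.
  apply/negP => /eqP; rewrite expiX => /expi_eq1 h.
  have /h/eqP : `|k%:R * (pi *+ 2 / n%:R)| < pi *+ 2 :> R.
    have h2 : 0 < pi *+ 2 :> R by rewrite mulrn_wgt0// pi_gt0.
    rewrite ger0_norm ?mulr_ge0// ?invr_ge0 ?ler0n// ?(ltW h2)//.
    rewrite mulrA ltr_pdivrMr ?ltr0n; last by lia.
    by rewrite mulrC ltr_pM2l// ltr_nat.
  rewrite !mulf_eq0 invr_eq0 (negPf n0) pnatr_eq0 -mulr_natr mulf_eq0.
  by rewrite (gt_eqF (pi_gt0 R)) pnatr_eq0; lia.
apply: (mulfI (_ : w ^+ k - 1 != 0)); first by rewrite subr_eq0.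
rewrite mulr0; under eq_bigr do rewrite mulnC exprM.
rewrite -subrX1 -exprM mulnC exprM expiX.
by rewrite mulrCA mulfV// mulr1 expi_2pi expr1n subrr.
Qed.

(** Discrete mean value property: the average over the [n]-th roots of unity kills the powers 1 to
    [n - 1] around [c], and [size p <= n] leaves no others but the constant. *)
Lemma poly_mean p c (rho : R) n : (size p <= n)%N -> (0 < n)%N ->
  \sum_(j < n) p.[c + rho%:C * expi (pi *+ 2 / n%:R) ^+ j] = n%:R * p.[c].
Proof.
move=> pn n0; set w := expi _.
pose q := p \Po ('X + c%:P).
have qE z : q.[z] = p.[c + z] by rewrite horner_comp !hornerE addrC.
have qn : (size q <= n)%N.
  by rewrite /q size_comp_poly2 ?size_XaddC.
have -> : p.[c] = q.[0] by rewrite qE addr0.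
under eq_bigr do rewrite -qE (horner_coef_wide _ qn).
rewrite exchange_big /=; case: n n0 pn @w qn => // n _ _ w qn.
rewrite big_ord_recl /= [X in _ + X]big1 ?addr0.
  rewrite (eq_bigr (fun => q`_0)); last by move=> i _; rewrite expr0 mulr1.
  by rewrite sumr_const card_ord horner_coef0 mulr_natl.
move=> i _.
under eq_bigr => j _ do rewrite exprMn mulrA -exprM.
by rewrite -mulr_sumr sum_unity_roots ?mulr0//=; rewrite /bump /=; have := ltn_ord i; lia.
Qed.

Lemma poly_max p c (rho M : R) : 0 <= rho ->
  (forall z, cabs (z - c) = rho -> cabs p.[z] <= M) -> cabs p.[c] <= M.
Proof.
move=> rho0 h; set n := (size p).+1.
have n0 : 0 < n%:R :> R by rewrite ltr0n.
rewrite -(ler_pM2l n0) -{1}(cabs_nat R n) -cabsM.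
rewrite -(poly_mean c rho (_ : size p <= n)%N)//.
apply: le_trans (cabs_sum _ _ _) _.
apply: le_trans (ler_sum _ (_ : forall i, _ -> _ <= M)) _.
  move=> i _; apply: h; rewrite addrAC subrr add0r cabsM cabs_real ger0_norm//.
  by rewrite cabsX cabs_expi expr1n mulr1.
by rewrite sumr_const card_ord mulr_natl.
Qed.

Lemma poly_bounded p (rho : R) :
  exists M, forall z, cabs z <= rho -> cabs p.[z] <= M.
Proof.
exists (\sum_(i < size p) cabs p`_i * rho ^+ i) => z zr.
rewrite horner_coef; apply: le_trans (cabs_sum _ _ _) _.
apply: ler_sum => i _; rewrite cabsM cabsX ler_wpM2l ?cabs_ge0//.
by rewrite lerXn2r// nnegrE ?cabs_ge0// (le_trans (cabs_ge0 z)).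
Qed.

(* Near [a] the quotient is bounded by its values on the unit circle about [z]. *)
Lemma poly_quot_bound p q a (rho M : R) :
  (forall z, p.[z] - p.[a] = (z - a) * q.[z]) ->
  cabs a <= rho + 1 ->
  (forall z, cabs z <= rho + 1 -> cabs p.[z] <= M) ->
  forall z, cabs z <= rho -> cabs q.[z] <= 4 * M.
Proof.
move=> pq ar hM.
(* At distance at least 1/2 from [a] one divides directly: [2 * M] by 1/2. This is the origin of the
   factor 4. *)
have far z : cabs z <= rho + 1 -> 2^-1 <= cabs (z - a) -> cabs q.[z] <= 4 * M.
  move=> zr za; have za0 : 0 < cabs (z - a) by apply: lt_le_trans za; lra.
  have : cabs (p.[z] - p.[a]) <= 2 * M.
    apply: le_trans (cabsB _ _) _.
    by have := hM _ zr; have := hM _ ar; lra.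
  rewrite pq cabsM => h.
  have := cabs_ge0 q.[z]; nra.
move=> z zr; case: (lerP 2^-1 (cabs (z - a))) => za.
  by apply: far => //; lra.
apply: (@poly_max _ z 1) => // w wz; apply: far.
  have := cabsD (w - z) z; rewrite subrK; lra.
have := cabsD (w - a) (a - z); rewrite addrA subrK wz (cabs_distC a); lra.
Qed.

Lemma poly_quot p a : exists q, p - p.[a]%:P = ('X - a%:P) * q.
Proof.
exists ((p - p.[a]%:P) %/ ('X - a%:P)).
have /divpK h : 'X - a%:P %| p - p.[a]%:P.
  by rewrite dvdp_XsubCl /root !hornerE subrr.
by rewrite mulrC h.
Qed.

Lemma poly_quotE p q a z :
  p - p.[a]%:P = ('X - a%:P) * q -> p.[z] - p.[a] = (z - a) * q.[z].
Proof. by move=> h; have := congr1 (fun r => r.[z]) h; rewrite !hornerE. Qed.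

Lemma poly_quot_deriv p q a : p - p.[a]%:P = ('X - a%:P) * q -> q.[a] = (deriv p).[a].
Proof.
move=> h; have := congr1 (fun r => (deriv r).[a]) h.
by rewrite !poly.derivE subr0 !hornerE subrr mul0r addr0.
Qed.

(** The derivative at [z] is the value at [z] of the divided difference with node [z], so it
    inherits the bound of the quotient. *)
Lemma poly_deriv_bound p (rho M : R) :
  (forall z, cabs z <= rho + 1 -> cabs p.[z] <= M) ->
  forall z, cabs z <= rho -> cabs (deriv p).[z] <= 4 * M.
Proof.
move=> hM z zr; have [q h] := poly_quot p z.
rewrite -(poly_quot_deriv h); apply: (poly_quot_bound _ _ hM) (zr).
  by move=> w; exact: poly_quotE h.
by lra.
Qed.

(** The remainder is [h ^+ 2] times a second divided difference. Each of the two divisions costs a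
    factor 4 and one unit of radius; the third unit makes room for [z + h]. *)
Lemma poly_taylor2 p (rho M : R) :
  (forall z, cabs z <= rho + 3 -> cabs p.[z] <= M) ->
  forall z h, cabs z <= rho -> cabs h <= 1 ->
  cabs (p.[z + h] - p.[z] - h * (deriv p).[z]) <= 16 * M * cabs h ^+ 2.
Proof.
move=> hM z h zr h1.
have [q hq] := poly_quot p z; have [q2 hq2] := poly_quot q z.
have bq w : cabs w <= rho + 2 -> cabs q.[w] <= 4 * M.
  apply: (poly_quot_bound (rho := rho + 2)) => [u||u hu].
  - exact: poly_quotE hq.
  - by lra.
  - by apply: hM; lra.
have bq2 w : cabs w <= rho + 1 -> cabs q2.[w] <= 4 * (4 * M).
  apply: (poly_quot_bound (rho := rho + 1)) => [u||u hu].
  - exact: poly_quotE hq2.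
  - by lra.
  - by apply: bq; lra.
have -> : p.[z + h] - p.[z] - h * (deriv p).[z] = q2.[z + h] * h ^+ 2.
  rewrite (poly_quotE _ hq) -(poly_quot_deriv hq).
  by have := poly_quotE (z + h) hq2; rewrite addrAC subrr add0r => e; rewrite -mulrBr e; ring.
rewrite cabsM cabsX ler_wpM2r ?exprn_ge0 ?cabs_ge0//.
have -> : 16 * M = 4 * (4 * M) by ring.
by apply: bq2; have := cabsD z h; lra.
Qed.

End MaxPoly.

(** * Locally uniform limits of polynomials *)

Section Entire.
Variable R : realType.
Local Notation C := R[i].
Implicit Types (p : {poly C}) (z c a : C) (q : nat -> {poly C}) (f g : C -> C).

Definition lucvg q f := forall rho e : R, 0 < e -> exists N, forall n, (N <= n)%N ->
  forall z, cabs z <= rho -> cabs (f z - (q n).[z]) <= e.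

(* Locally uniform limits of polynomials: the maximum principle and divided
   differences are then inherited from polynomials, without Cauchy's theory. *)
Definition entire f := exists q, lucvg q f.

Lemma real_cauchy (u : nat -> R) :
  (forall e, 0 < e -> exists N, forall n m, (N <= n)%N -> (N <= m)%N ->
     `|u n - u m| <= e) ->
  exists l, forall e, 0 < e -> exists N, forall n, (N <= n)%N -> `|l - u n| <= e.
Proof.
move=> h.
have /cauchy_cvg cu : cauchy (u @ \oo).
  apply: cauchy_exP => e e0; have [N hN] := h _ (divr_gt0 e0 (ltr0n R 2)).
  exists (u N); exists N => // n /= Nn; rewrite /ball /=.
  by apply: le_lt_trans (hN _ _ (leqnn N) Nn) _; lra.
exists (limn u) => e e0.
have /cvgrPdist_le/(_ e e0) [N _ hN] : u @ \oo --> limn u by exact: cu.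
by exists N => n Nn; exact: hN.
Qed.

Lemma complex_cauchy (u : nat -> C) :
  (forall e : R, 0 < e -> exists N, forall n m, (N <= n)%N -> (N <= m)%N ->
     cabs (u n - u m) <= e) ->
  exists l, forall e : R, 0 < e -> exists N, forall n, (N <= n)%N ->
     cabs (l - u n) <= e.
Proof.
move=> h.
have [|l1 h1] := @real_cauchy (fun n => complex.Re (u n)).
  move=> e /h [N hN]; exists N => n m Nn Nm.
  apply: le_trans (hN n m Nn Nm); have := Re_le_cabs (u n - u m).
  by case: (u n) => ? ?; case: (u m).
have [|l2 h2] := @real_cauchy (fun n => complex.Im (u n)).
  move=> e /h [N hN]; exists N => n m Nn Nm.
  apply: le_trans (hN n m Nn Nm); have := Im_le_cabs (u n - u m).
  by case: (u n) => ? ?; case: (u m).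
exists (l1 +i* l2) => e e0; have e2 : 0 < e / 2 by lra.
have [N1 hN1] := h1 _ e2; have [N2 hN2] := h2 _ e2.
exists (maxn N1 N2) => n; rewrite geq_max => /andP[n1 n2].
apply: le_trans (cabs_le_ReIm _) _.
have := hN1 _ n1; have := hN2 _ n2; case: (u n) => ? ? /=; lra.
Qed.

Lemma le_eps (x y : R) : (forall e, 0 < e -> x <= y + e) -> x <= y.
Proof. by move=> h; apply/ler_addgt0Pr => e /h; rewrite addrC. Qed.

Lemma lucvg_cauchy q :
  (forall rho e : R, 0 < e -> exists N, forall n m, (N <= n)%N -> (N <= m)%N ->
    forall z, cabs z <= rho -> cabs ((q n).[z] - (q m).[z]) <= e) ->
  exists f, lucvg q f.
Proof.
move=> h.
have /choice [f hf] : forall z, exists l, forall e : R, 0 < e -> exists N,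
    forall n, (N <= n)%N -> cabs (l - (q n).[z]) <= e.
  move=> z; apply: complex_cauchy => e e0.
  by have [N hN] := h (cabs z) e e0; exists N => n m Nn Nm; exact: hN.
exists f => rho e e0; have [N hN] := h rho e e0.
exists N => n Nn z zr; apply: le_eps => d d0.
have [N' hN'] := hf z d d0.
have := hN' (maxn N N') (leq_maxr _ _).
have := hN _ n (leq_maxl N N') Nn z zr.
set x := (q (maxn _ _)).[z] => h1 h2.
have := cabsD (f z - x) (x - (q n).[z]); rewrite addrA subrK; lra.
Qed.

Lemma lucvg_cauchy_rev q f : lucvg q f ->
  forall rho e : R, 0 < e -> exists N, forall n m, (N <= n)%N -> (N <= m)%N ->
    forall z, cabs z <= rho -> cabs ((q n).[z] - (q m).[z]) <= e.
Proof.
move=> h rho e e0; have [|N hN] := h rho (e / 2); first by lra.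
exists N => n m Nn Nm z zr; have := hN _ Nn z zr; have := hN _ Nm z zr.
set x := (q n).[z]; set y := (q m).[z] => h1 h2.
have := cabsD (x - f z) (f z - y); rewrite addrA subrK (cabs_distC x (f z)); lra.
Qed.

Lemma lucvg_uniq q f g : lucvg q f -> lucvg q g -> f =1 g.
Proof.
move=> hf hg z; apply/eqP; rewrite -subr_eq0 -cabs_eq0 eq_le cabs_ge0 andbT.
apply: le_eps => e e0; have e2 : 0 < e / 2 by lra.
have [N1 hN1] := hf (cabs z) _ e2; have [N2 hN2] := hg (cabs z) _ e2.
have := hN1 _ (leq_maxl N1 N2) z (lexx _).
have := hN2 _ (leq_maxr N1 N2) z (lexx _).
set x := (q _).[z] => h1 h2.
have := cabsD (f z - x) (x - g z); rewrite addrA subrK (cabs_distC x (g z)); lra.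
Qed.

Lemma eq_lucvg q q' f g : (forall n z, (q n).[z] = (q' n).[z]) -> f =1 g ->
  lucvg q f -> lucvg q' g.
Proof.
move=> hq hf h rho e e0; have [N hN] := h rho e e0; exists N => n Nn z zr.
by rewrite -hf -hq; exact: hN.
Qed.

Lemma lucvg_bounded q f (rho : R) : lucvg q f -> exists2 M, 0 < M &
  exists N, forall z, cabs z <= rho -> cabs (f z) <= M /\
    forall n, (N <= n)%N -> cabs (q n).[z] <= M.
Proof.
move=> h; have [N hN] := h rho 1 ltr01.
have [M hM] := poly_bounded (q N) rho.
exists (`|M| + 2) => [|]; first by have := normr_ge0 M; lra.
exists N => z zr.
have h1 := hM z zr; have h2 := hN N (leqnn N) z zr; have hM' := ler_norm M.
have h3 : cabs (f z) <= `|M| + 1.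
  by have := cabsD (f z - (q N).[z]) (q N).[z]; rewrite subrK; lra.
split => [|n Nn]; first by lra.
have := hN n Nn z zr.
have := cabsB (f z) (f z - (q n).[z]); rewrite opprB addrC subrK; lra.
Qed.

Lemma lucvg_const (p : {poly C}) : lucvg (fun=> p) (horner p).
Proof. by move=> rho e e0; exists 0%N => n _ z _; rewrite subrr cabs0 ltW. Qed.

Lemma lucvgD q q' f g : lucvg q f -> lucvg q' g ->
  lucvg (fun n => q n + q' n) (fun z => f z + g z).
Proof.
move=> hf hg rho e e0; have e2 : 0 < e / 2 by lra.
have [N1 hN1] := hf rho _ e2; have [N2 hN2] := hg rho _ e2.
exists (maxn N1 N2) => n; rewrite geq_max => /andP[n1 n2] z zr.
have := hN1 _ n1 z zr; have := hN2 _ n2 z zr; rewrite hornerD.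
set x := (q n).[z]; set y := (q' n).[z] => h1 h2.
have -> : f z + g z - (x + y) = (f z - x) + (g z - y) by ring.
by have := cabsD (f z - x) (g z - y); lra.
Qed.

Lemma lucvgM q q' f g : lucvg q f -> lucvg q' g ->
  lucvg (fun n => q n * q' n) (fun z => f z * g z).
Proof.
move=> hf hg rho e e0.
have [M M0 [N hM]] := lucvg_bounded rho hf.
have [M' M'0 [N' hM']] := lucvg_bounded rho hg.
have [|N1 hN1] := hf rho (e / (2 * M')); first by rewrite divr_gt0// mulr_gt0.
have [|N2 hN2] := hg rho (e / (2 * M)); first by rewrite divr_gt0// mulr_gt0.
exists (maxn N (maxn N1 N2)) => n; rewrite !geq_max => /and3P[n0 n1 n2] z zr.
have [_ /(_ n n0)] := hM z zr; have [+ _] := hM' z zr.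
have := hN1 _ n1 z zr; have := hN2 _ n2 z zr; rewrite hornerM.
set x := (q n).[z]; set y := (q' n).[z] => h1 h2 h3 h4.
have -> : f z * g z - x * y = (f z - x) * g z + x * (g z - y) by ring.
apply: le_trans (cabsD _ _) _; rewrite !cabsM.
have -> : e = e / (2 * M') * M' + M * (e / (2 * M)) by field; lra.
by apply: lerD; apply: ler_pM; rewrite ?cabs_ge0.
Qed.

Lemma lucvg_comp q f a c : lucvg q f ->
  lucvg (fun n => q n \Po (a *: 'X + c%:P)) (fun z => f (a * z + c)).
Proof.
move=> hf rho e e0; have [N hN] := hf (cabs a * rho + cabs c) e e0.
exists N => n Nn z zr; rewrite horner_comp !hornerE; apply: hN => //.
by apply: le_trans (cabsD _ _) _; rewrite cabsM lerD2r ler_wpM2l ?cabs_ge0.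
Qed.

Lemma lucvg_conj q f : lucvg q f ->
  lucvg (fun n => map_poly conjc (q n)) (fun z => (f z^*)^*).
Proof.
move=> hf rho e e0; have [N hN] := hf rho e e0.
exists N => n Nn z zr; rewrite -{2}(conjcK z) horner_map -rmorphB cabsJ.
by apply: hN => //; rewrite cabsJ.
Qed.

(** Divided differences are linear in the polynomial, so [poly_quot_bound] applied to [q n - q m]
    makes the quotients uniformly Cauchy. The radius is enlarged to contain the node [a]. *)
Lemma lucvg_quot q f a : lucvg q f -> exists2 g,
  exists2 q', lucvg q' g & forall n, q n - (q n).[a]%:P = ('X - a%:P) * q' n &
  forall z, f z - f a = (z - a) * g z.
Proof.
move=> hf; have /choice [q' hq'] := fun n => poly_quot (q n) a.
have [|g hg] := @lucvg_cauchy q'.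
  move=> rho e e0; set r := Num.max rho (cabs a).
  have [|N hN] := lucvg_cauchy_rev hf (r + 1) (_ : 0 < e / 4); first by lra.
  exists N => n m Nn Nm z zr.
  rewrite -hornerN -hornerD (_ : e = 4 * (e / 4)); last by field.
  apply: (@poly_quot_bound _ (q n - q m) _ a r).
  - move=> w; rewrite !hornerE /=.
    have := poly_quotE w (hq' n); have := poly_quotE w (hq' m) => h1 h2.
    by rewrite mulrBr -h1 -h2; ring.
  - have : cabs a <= r by rewrite le_max lexx orbT.
    by lra.
  - by move=> w wr; rewrite !hornerE; exact: hN.
  - by rewrite /r le_max zr.
exists g; first by exists q'.
have h1 : lucvg (fun n => q n - (q n).[a]%:P) (fun z => f z - f a).
  move=> rho e e0; have e2 : 0 < e / 2 by lra.
  have [N1 hN1] := hf rho _ e2; have [N2 hN2] := hf (cabs a) _ e2.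
  exists (maxn N1 N2) => n; rewrite geq_max => /andP[n1 n2] z zr.
  have := hN1 _ n1 z zr; have := hN2 _ n2 a (lexx _); rewrite !hornerE.
  set x := (q n).[z]; set y := (q n).[a] => h1 h2.
  have -> : f z - f a - (x - y) = (f z - x) - (f a - y) by ring.
  by have := cabsB (f z - x) (f a - y); lra.
apply: (lucvg_uniq h1).
apply: (eq_lucvg _ _ (lucvgM (lucvg_const ('X - a%:P)) hg)).
  by move=> n z; rewrite hq'.
by move=> z; rewrite !hornerE.
Qed.

(** The quadratic remainder survives the limit because its constant depends only on a common bound
    for the approximants on the disc of radius [rho + 3]. *)
Lemma lucvg_deriv q f : lucvg q f -> exists2 D, lucvg (fun n => deriv (q n)) D &
  forall rho : R, exists2 K, 0 < K & forall z h, cabs z <= rho -> cabs h <= 1 ->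
    cabs (f (z + h) - f z - h * D z) <= K * cabs h ^+ 2.
Proof.
move=> hf; have [|D hD] := @lucvg_cauchy (fun n => deriv (q n)).
  move=> rho e e0.
  have [|N hN] := lucvg_cauchy_rev hf (rho + 1) (_ : 0 < e / 4); first by lra.
  exists N => n m Nn Nm z zr.
  rewrite -hornerN -hornerD -derivB (_ : e = 4 * (e / 4)); last by field.
  by apply: (poly_deriv_bound _ zr) => w wr; rewrite !hornerE; exact: hN.
exists D => // rho; have [M M0 [N hM]] := lucvg_bounded (rho + 3) hf.
exists (16 * M); first by lra.
move=> z h zr h1; apply: le_eps => e e0; have e3 : 0 < e / 3 by lra.
have [N1 hN1] := hf (rho + 3) _ e3; have [N2 hN2] := hD rho _ e3.
set n := maxn N (maxn N1 N2).
have := hN1 n; have := hN2 n; rewrite /n !leq_max !leqnn !orbT -/n.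
move=> /(_ isT z zr) d1 /(_ isT) d2.
have zh := cabsD z h.
have d3 : cabs (f z - (q n).[z]) <= e / 3 by apply: d2; lra.
have d4 : cabs (f (z + h) - (q n).[z + h]) <= e / 3 by apply: d2; lra.
have := @poly_taylor2 _ (q n) rho M _ z h zr h1.
move=> /(_ _)-/(_ _) T; have {}T := T (fun w wr => (hM w wr).2 n (leq_maxl _ _)).
move: T d1 d3 d4; set x := (q n).[z + h]; set y := (q n).[z].
set u := (deriv (q n)).[z] => T d1 d3 d4.
have -> : f (z + h) - f z - h * D z =
  (x - y - h * u) + ((f (z + h) - x) - (f z - y) - h * (D z - u)) by ring.
apply: le_trans (cabsD _ _) _; apply: lerD => //.
apply: le_trans (cabsB _ _) _; have := cabsB (f (z + h) - x) (f z - y).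
rewrite cabsM; have := cabs_ge0 (D z - u); have := cabs_ge0 h; nra.
Qed.

End Entire.

(** * Orders of zeros, factorization and Jensen's inequality *)

Section Zeros.
Variable R : realType.
Local Notation C := R[i].
Implicit Types (p : {poly C}) (z c a : C) (q : nat -> {poly C}) (f g : C -> C^o).

Lemma entire_ext f g : f =1 g -> entire f -> entire g.
Proof. by move=> fg [q hq]; exists q; apply: eq_lucvg fg hq. Qed.

Lemma entireD f g : entire f -> entire g -> entire (fun z => f z + g z : C).
Proof. by move=> [q hq] [q' hq']; exists (fun n => q n + q' n); exact: lucvgD. Qed.

Lemma entireM f g : entire f -> entire g -> entire (fun z => (f z : C) * g z : C).
Proof. by move=> [q hq] [q' hq']; exists (fun n => q n * q' n); exact: lucvgM. Qed.

Lemma entire_poly p : entire (fun z => p.[z]).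
Proof. by exists (fun=> p); exact: lucvg_const. Qed.

Lemma entire_cst a : entire (fun=> a).
Proof. by apply: entire_ext (entire_poly a%:P) => z; rewrite hornerC. Qed.

Lemma entire_comp f a c : entire f -> entire (fun z => f (a * z + c)).
Proof. by move=> [q hq]; eexists; exact: lucvg_comp hq. Qed.

Lemma entire_conj f : entire f -> entire (fun z => (f z^* : C)^*).
Proof. by move=> [q hq]; eexists; exact: lucvg_conj hq. Qed.

Lemma entire_quot f a : entire f ->
  exists2 g, entire g & forall z, (f z : C) - f a = (z - a) * g z.
Proof. by move=> [q /(lucvg_quot a) [g [q' hq' _] h]]; exists g => //; exists q'. Qed.

Lemma entire_bounded f (rho : R) : entire f ->
  exists2 M, 0 < M & forall z, cabs z <= rho -> cabs (f z) <= M.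
Proof.
move=> [q /(lucvg_bounded rho) [M M0 [N h]]]; exists M => // z zr.
by have [] := h z zr.
Qed.

Lemma entire_max f c (rho M : R) : entire f -> 0 <= rho ->
  (forall z, cabs (z - c) = rho -> cabs (f z) <= M) -> cabs (f c) <= M.
Proof.
move=> [q hq] rho0 h; apply: le_eps => e e0; have e2 : 0 < e / 2 by lra.
have [N hN] := hq (cabs c + rho) _ e2.
have : cabs (q N).[c] <= M + e / 2.
  apply: (@poly_max _ _ _ rho) => // z zr.
  have := hN N (leqnn N) z; have := cabsD (z - c) c; rewrite subrK zr => h1.
  move=> /(_ _)-/(_ _) h2; have {}h2 : cabs (f z - (q N).[z]) <= e / 2.
    by apply: hN => //; lra.
  have := h z zr; have := cabsB (f z) (f z - (q N).[z]).
  by rewrite opprB addrC subrK; lra.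
have : cabs (f c - (q N).[c]) <= e / 2 by apply: hN => //; lra.
by have := cabsD (f c - (q N).[c]) (q N).[c]; rewrite subrK; lra.
Qed.

(** Identifies the limit of the derivatives with the [derive1] on which [zero_order] is based; the
    quadratic remainder makes the difference quotients converge. *)
Lemma lucvg_derive1 q f : lucvg q f -> lucvg (fun n => deriv (q n)) (derive1 f) /\
  forall rho : R, exists2 K, 0 < K & forall z h, cabs z <= rho -> cabs h <= 1 ->
    cabs (f (z + h) - f z - h * (derive1 f) z) <= K * cabs h ^+ 2.
Proof.
move=> /lucvg_deriv [D hD h2].
suff -> : (derive1 f) = D by [].
apply/funext => z; rewrite /derive1; apply: cvg_lim => //.
(* A positive element of [R[i]] is a positive real number. *)
apply/cvgrPdist_le => -[e ei]; rewrite ltcE /= => /andP[/eqP -> e0].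
have [K K0 hK] := h2 (cabs z).
have d0 : 0 < Num.min 1 (e / K) by rewrite lt_min ltr01 divr_gt0.
have : \forall h \near (0:C^o)^', `|h| <= (Num.min 1 (e / K))%:C.
  by apply: dnbhs0_le; rewrite ltcR.
have hn : \forall h \near (0:C^o)^', h != 0 by exact: nbhs_dnbhs_neq.
apply: filterS2 hn => h hn0; rewrite normE lecR le_min => /andP[h1 he].
have := hK z h (lexx _) h1; rewrite normE => hk.
rewrite lecR.
have -> : D z - h^-1 *: (f (h + z) - f z) =
  - (h^-1 * (f (z + h) - f z - h * D z)).
  by rewrite -[_ *: _]/(_ * _) (addrC h z); field.
rewrite cabsN cabsM cabsV.
have hp : 0 < cabs h by rewrite cabs_gt0.
rewrite mulrC ler_pdivrMr//; apply: le_trans hk _.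
rewrite expr2 mulrA ler_pM2r//.
by move: he; rewrite ler_pdivlMr// mulrC.
Qed.

Lemma entire_derive1 f : entire f -> entire (derive1 f).
Proof. by move=> [q /lucvg_derive1 [h _]]; eexists; exact: h. Qed.

Lemma derive1_taylor f (rho : R) : entire f ->
  exists2 K, 0 < K & forall z h, cabs z <= rho -> cabs h <= 1 ->
    cabs (f (z + h) - f z - h * (derive1 f) z) <= K * cabs h ^+ 2.
Proof. by move=> [q /lucvg_derive1 [_ h]]; exact: h. Qed.

(** The product rule is checked on the approximating polynomials and passes to the limit by
    uniqueness. *)
Lemma derive1_Xsub_exp f g z m : entire g -> entire f ->
  (forall w, f w = (w - z) ^+ m.+1 * g w) ->
  forall w, (derive1 f) w = (w - z) ^+ m * (m.+1%:R * g w + (w - z) * (derive1 g) w).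
Proof.
move=> [qg hg] ef hf w.
have h1 : lucvg (fun n => ('X - z%:P) ^+ m.+1 * qg n) f.
  apply: (eq_lucvg _ _ (lucvgM (lucvg_const (('X - z%:P) ^+ m.+1)) hg)) => //.
  by move=> u; rewrite hf !hornerE.
have [h2 _] := lucvg_derive1 h1; have [h3 _] := lucvg_derive1 hg.
pose G u := (u - z) ^+ m * (m.+1%:R * g u + (u - z) * derive1 g u) : C.
suff : lucvg (fun n => deriv (('X - z%:P) ^+ m.+1 * qg n)) G.
  by move=> h; exact: (lucvg_uniq h2 h).
apply: (eq_lucvg _ _ (lucvgM (lucvg_const (('X - z%:P) ^+ m))
  (lucvgD (lucvgM (lucvg_const (m.+1%:R)) hg)
  (lucvgM (lucvg_const ('X - z%:P)) h3)))).
  move=> n u; rewrite poly.derivM deriv_exp !poly.derivE !hornerE /=.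
  rewrite !hornerMn !hornerE /= exprS -mulr_natl; ring.
move=> u; rewrite !hornerE; congr (_ * (_ * _ + _)).
by rewrite -polyC_natr hornerC.
Qed.

(** Differentiation lowers the exponent by one and replaces [g] by a function whose value at [z] is
    [m.+1%:R * g z], again non-zero. *)
Lemma derive1n_Xsub_exp f g z m : entire g -> g z != 0 ->
  (forall w, f w = (w - z) ^+ m * g w) ->
  (forall j, (j < m)%N -> derive1n j f z = 0) /\ derive1n m f z != 0.
Proof.
elim: m f g => [|m IH] f g eg gz hf.
  by split=> //; rewrite derive1n0 hf expr0 mul1r.
have ef : entire f.
  apply: entire_ext (entireM (entire_poly (('X - z%:P) ^+ m.+1)) eg) => w.
  by rewrite hf !hornerE.
have hd := derive1_Xsub_exp eg ef hf.
have [|||h1 h2] := IH (derive1 f) (fun w => m.+1%:R * g w + (w - z) * (derive1 g) w : C).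
- apply: entireD; first by apply: entireM => //; exact: entire_cst.
  apply: entireM (entire_derive1 eg).
  by apply: entire_ext (entire_poly ('X - z%:P)) => w; rewrite !hornerE.
- by rewrite subrr mul0r addr0 mulf_neq0// pnatr_eq0.
- exact: hd.
have it j : derive1n j.+1 f = derive1n j (derive1 f) by rewrite /derive1n -iterSr.
split=> [[_|j]|]; last by rewrite it.
- by rewrite derive1n0 hf subrr expr0n mul0r.
- by rewrite ltnS it; exact: h1.
Qed.

Lemma zero_order_factor f g z m : entire g -> g z != 0 ->
  (forall w, f w = (w - z) ^+ m * g w) -> zero_order f z = (m%:R)%:E.
Proof.
move=> eg gz hf; have [h1 h2] := derive1n_Xsub_exp eg gz hf.
apply/eqP; rewrite eq_le; apply/andP; split.
  apply: ge_ereal_sup => _ [k hk <-]; rewrite lee_fin ler_nat leqNgt.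
  by apply/negP => mk; move: h2; rewrite hk ?eqxx.
by apply: ereal_sup_ubound; exists m.
Qed.

(** Repetitions in [s] record multiplicities, so that counting zeros becomes counting entries of a
    list. *)
Definition linfac (s : seq C) z : C := \prod_(a <- s) (z - a).

Lemma entire_linfac s : entire (linfac s).
Proof.
apply: entire_ext (entire_poly (\prod_(a <- s) ('X - a%:P))) => z.
by rewrite horner_prod; apply: eq_bigr => a _; rewrite !hornerE.
Qed.

Lemma linfac_eq0 s z : (linfac s z == 0) = (z \in s).
Proof.
rewrite /linfac prodf_seq_eq0 /=; apply/hasP/idP => [[a]|zs].
  by rewrite subr_eq0 => + /eqP ->.
by exists z; rewrite ?subrr.
Qed.

Lemma linfac_filter (P : pred C) s z :
  linfac s z = linfac (seq.filter P s) z * linfac (seq.filter (predC P) s) z.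
Proof.
rewrite /linfac -big_cat; apply: perm_big.
by rewrite perm_sym perm_filterC.
Qed.

(* Divide the zeros out and apply the maximum principle at [c]. *)
Lemma jensen_size f g s c (rho M : R) : entire g -> 0 < rho ->
  (forall z, f z = linfac s z * g z) ->
  (forall a, a \in s -> cabs (a - c) <= rho) ->
  (forall z, cabs (z - c) = 3 * rho -> cabs (f z) <= M) ->
  cabs (f c) * 2 ^+ size s <= M.
Proof.
move=> eg r0 hf hs hM; set m := size s.
(* Each root is at distance at least [2 * rho] from the points of the circle and at most [rho] from
   [c]: one factor 2 per root. *)
have prod_ge z : cabs (z - c) = 3 * rho -> (2 * rho) ^+ m <= cabs (linfac s z).
  move=> zr; rewrite /linfac cabs_prod /m.
  elim: s hs {hf m} => [|a s IH] hs; first by rewrite big_nil.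
  rewrite big_cons /= exprS; apply: ler_pM; rewrite ?exprn_ge0 ?mulr_ge0 ?(ltW r0)//.
    have := hs a (mem_head _ _); have := cabs_lub (z - c) (a - c).
    by rewrite (_ : z - c - (a - c) = z - a); [rewrite zr; lra|ring].
  by apply: IH => b bs; apply: hs; rewrite inE bs orbT.
have prod_le : cabs (linfac s c) <= rho ^+ m.
  rewrite /linfac cabs_prod /m.
  elim: s hs {hf m prod_ge} => [|a s IH] hs; first by rewrite big_nil.
  rewrite big_cons /= exprS; apply: ler_pM; rewrite ?cabs_ge0//.
    by apply: prodr_ge0 => b _; exact: cabs_ge0.
    by rewrite cabs_distC hs// mem_head.
  by apply: IH => b bs; apply: hs; rewrite inE bs orbT.
have p0 : 0 < (2 * rho) ^+ m by rewrite exprn_gt0// mulr_gt0.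
have gc : cabs (g c) <= M / (2 * rho) ^+ m.
  apply: (entire_max eg (_ : 0 <= 3 * rho)); first by rewrite mulr_ge0 ?(ltW r0).
  move=> z zr; rewrite ler_pdivlMr//; apply: le_trans (hM z zr).
  by rewrite hf cabsM mulrC ler_wpM2r ?cabs_ge0// prod_ge.
rewrite hf cabsM; apply: le_trans (_ : rho ^+ m * (M / (2 * rho) ^+ m) * 2 ^+ m <= _).
  by rewrite ler_pM2r ?exprn_gt0//; apply: ler_pM; rewrite ?cabs_ge0.
rewrite exprMn le_eqVlt; apply/orP; left; apply/eqP.
field; by rewrite !expf_neq0// gt_eqF.
Qed.

(** The factors of the roots outside the disc are moved into the cofactor, which stays entire. *)
Lemma jensen_count f g s c (rho M : R) : entire g -> 0 < rho ->
  (forall z, f z = linfac s z * g z) ->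
  (forall z, cabs (z - c) = 3 * rho -> cabs (f z) <= M) ->
  cabs (f c) * 2 ^+ count (fun a => cabs (a - c) <= rho) s <= M.
Proof.
move=> eg r0 hf hM; set P := (fun _ => _); rewrite -size_filter.
apply: (@jensen_size f (fun z => linfac (seq.filter (predC P) s) z * g z)) hM => //.
- exact: entireM (entire_linfac _) eg.
- by move=> z; rewrite mulrA -linfac_filter.
- by move=> a; rewrite mem_filter => /andP[].
Qed.

(** Zeros are divided out one at a time. By [jensen_size] the list never has more than [B] entries,
    so the process stops, and it can only stop at a cofactor without zeros in the disc. *)
Lemma entire_factor f c (rho : R) : entire f -> f c != 0 -> 0 < rho ->
  exists s, exists2 g, entire g & [/\ forall z, f z = linfac s z * g z,
    forall a, a \in s -> cabs (a - c) <= rho &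
    forall z, cabs (z - c) <= rho -> g z != 0].
Proof.
move=> ef fc r0; have [M M0 hM] := entire_bounded (cabs c + 3 * rho) ef.
have {hM} hM z : cabs (z - c) = 3 * rho -> cabs (f z) <= M.
  by move=> zr; apply: hM; have := cabsD (z - c) c; rewrite subrK; lra.
have fc0 : 0 < cabs (f c) by rewrite cabs_gt0.
pose B := Num.truncn (M / cabs (f c)).
have bound s g : entire g -> (forall z, f z = linfac s z * g z) ->
    (forall a, a \in s -> cabs (a - c) <= rho) -> (size s <= B)%N.
  move=> eg hf hs; have := jensen_size eg r0 hf hs hM.
  rewrite mulrC -ler_pdivlMr// => h.
  rewrite /B truncn_ge_nat ?divr_ge0 ?cabs_ge0 ?(ltW M0)//.
  by apply: le_trans h; rewrite -natrX ler_nat ltnW// ltn_expl.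
(* [n] is fuel: it bounds the number of zeros that may still be divided out. *)
suff H n s g : entire g -> (forall z, f z = linfac s z * g z) ->
    (forall a, a \in s -> cabs (a - c) <= rho) -> (B < n + size s)%N ->
    exists s, exists2 g, entire g & [/\ forall z, f z = linfac s z * g z,
    forall a, a \in s -> cabs (a - c) <= rho &
    forall z, cabs (z - c) <= rho -> g z != 0].
  apply: (H B.+1 [::] f) => //; last by rewrite /= addn0.
  by move=> z; rewrite /linfac big_nil mul1r.
elim: n s g => [|n IH] s g eg hf hs; first by rewrite ltnNge (bound _ _ eg hf hs).
case: (pselect (exists2 z, cabs (z - c) <= rho & g z = 0)); last first.
  move=> h _; exists s, g => //; split => // z zr; apply/eqP => gz.
  by apply: h; exists z.
move=> [a ar ga] hB; have [g' eg' hg'] := entire_quot a eg.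
apply: (IH (a :: s) g' eg').
- move=> z; rewrite hf /linfac big_cons.
  by have := hg' z; rewrite ga subr0 => ->; ring.
- by move=> b; rewrite inE => /orP[/eqP ->|/hs].
- by rewrite /= addnS.
Qed.

Lemma linfac_count s a z :
  linfac s z = (z - a) ^+ count_mem a s * linfac (seq.filter (predC1 a) s) z.
Proof.
rewrite (linfac_filter (pred1 a)); congr (_ * _).
rewrite /linfac; elim: s => [|b s IH] /=; first by rewrite big_nil expr0.
case: eqVneq => [->|_]; last by rewrite add0n.
by rewrite big_cons IH -exprS.
Qed.

Lemma sum_count_mem_uniq (T : eqType) (t s : seq T) : uniq t ->
  (\sum_(z <- t) count_mem z s = count (mem t) s)%N.
Proof.
move=> ut; elim: s => [|b s IH]; first by rewrite big1.
rewrite /= big_split /= IH; congr (_ + _)%N.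
rewrite -(count_uniq_mem b ut) -sum1_count [RHS]big_mkcond /=.
by apply: eq_bigr => z _; rewrite eq_sym; case: eqP.
Qed.

(** Turns the extended sum of orders into a finite count: the zeros in the sector are the distinct
    entries of [s] there, each of order its multiplicity in [s]. *)
Lemma zero_count_factor f g s (r alpha beta : R) : entire g ->
  (forall z, f z = linfac s z * g z) ->
  (forall z, sector r alpha beta z -> g z != 0) ->
  zero_count f r alpha beta =
    ((count (mem (sector r alpha beta)) s)%:R)%:E.
Proof.
move=> eg hf hg; set S := sector r alpha beta.
pose t := undup (seq.filter (mem S) s).
have tE : S `&` [set z | f z = 0] = [set` t].
  apply/seteqP; split => z /=.
    move=> [zS]; rewrite hf => /eqP; rewrite mulf_eq0 (negPf (hg _ zS)) orbF.
    by rewrite linfac_eq0 => zs; rewrite mem_undup mem_filter zs andbT; exact/mem_set.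
  rewrite mem_undup mem_filter => /andP[/set_mem zS zs]; split => //.
  by rewrite hf; apply/eqP; rewrite mulf_eq0 linfac_eq0 zs.
rewrite /zero_count tE esum_fset; last 2 first.
- exact: finite_seq.
(* Orders are non-negative, since [m = 0] satisfies the defining condition vacuously. *)
- move=> z _; apply: ereal_sup_ubound; exists 0%N => //.
rewrite -fsbig_seq ?undup_uniq//.
rewrite (eq_big_seq (fun z => ((count_mem z s)%:R)%:E)); last first.
  move=> z. rewrite /t mem_undup mem_filter => /andP[/set_mem zS zs].
  apply: (@zero_order_factor f (fun w => linfac (seq.filter (predC1 z) s) w * g w)).
  - exact: entireM (entire_linfac _) eg.
  - by rewrite mulf_neq0 ?hg// linfac_eq0 mem_filter /= eqxx.
  - by move=> w; rewrite hf (linfac_count s z) mulrA.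
rewrite sumEFin; congr (_%:E); rewrite -natr_sum; congr (_%:R).
rewrite sum_count_mem_uniq ?undup_uniq//; apply: eq_in_count => z zs.
rewrite -[LHS]/(z \in t) /t mem_undup mem_filter zs andbT.
by [].
Qed.

End Zeros.

(** * The argument principle on a rectangle *)

Section Turning.
Variable R : realType.
Local Notation C := R[i].
Implicit Types (z w a v : C) (u : nat -> C) (t : R).

(* The principal argument, meaningful for [0 < Re w] only. *)
Definition arg w : R := atan (complex.Im w / complex.Re w).

Lemma arg_bound w : `|arg w| < pi / 2.
Proof. by rewrite ltr_norml atan_gtNpi2 atan_ltpi2. Qed.

Lemma arg_polar w : 0 < complex.Re w -> w = (cabs w)%:C * expi (arg w).
Proof.
case: w => a b /= a0; rewrite /arg /expi /=.
have c0 : cos (atan (b / a)) != 0.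
  by rewrite gt_eqF// cos_gt0_pihalf// atan_gtNpi2 atan_ltpi2.
have sE : sin (atan (b / a)) = b / a * cos (atan (b / a)).
  by rewrite -{2}(atanK (b / a)) /tan mulfVK.
have -> : Num.sqrt (a ^+ 2 + b ^+ 2) = a * Num.sqrt (1 + (b / a) ^+ 2).
  rewrite -{2}(ger0_norm (ltW a0)) -sqrtr_sqr -sqrtrM ?sqr_ge0//.
  by congr Num.sqrt; field; rewrite gt_eqF.
have s0 : Num.sqrt (1 + (b / a) ^+ 2) != 0.
  by rewrite gt_eqF// sqrtr_gt0 ltr_wpDr// sqr_ge0.
rewrite sE cos_atan; simpc; congr (_ +i* _); field; rewrite ?s0//= gt_eqF//.
Qed.

Lemma arg_unique (rho t : R) : 0 < rho -> `|t| < pi / 2 ->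
  arg (rho%:C * expi t) = t.
Proof.
move=> r0 ht; rewrite /arg /expi /=; rewrite !mul0r subr0 addr0.
rewrite -mulf_div divff ?gt_eqF// mul1r -/(tan t) tanK//.
by rewrite in_itv /= -ltr_norml.
Qed.

Lemma argM w v : 0 < complex.Re w -> 0 < complex.Re v ->
  `|arg w + arg v| < pi / 2 -> arg (w * v) = arg w + arg v.
Proof.
move=> w0 v0 h.
have cw : 0 < cabs w by apply: lt_le_trans (Re_le_cabs w); rewrite gtr0_norm.
have cv : 0 < cabs v by apply: lt_le_trans (Re_le_cabs v); rewrite gtr0_norm.
rewrite {1}(arg_polar w0) {1}(arg_polar v0) mulrACA -expiD.
by rewrite -rmorphM /= arg_unique// mulr_gt0.
Qed.

(** Both arguments are below [pi / 2] in modulus, so their difference is below [pi]; positivity of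
    its cosine then forces it below [pi / 2], which excludes a jump by 2 pi. *)
Lemma arg_ratio a w v : 0 < complex.Re (a * w) -> 0 < complex.Re (a * v) ->
  0 < complex.Re (v / w) -> arg (v / w) = arg (a * v) - arg (a * w).
Proof.
move=> w0 v0 vw0.
have cw : 0 < cabs (a * w) by apply: lt_le_trans (Re_le_cabs _); rewrite gtr0_norm.
have cv : 0 < cabs (a * v) by apply: lt_le_trans (Re_le_cabs _); rewrite gtr0_norm.
have [a0 hw] : a != 0 /\ w != 0.
  by move: cw; rewrite cabs_gt0 mulf_eq0 negb_or => /andP.
set t := arg (a * v) - arg (a * w); set r := cabs (a * v) / cabs (a * w).
have r0 : 0 < r by rewrite divr_gt0.
have e : v / w = r%:C * expi t.
  rewrite /t expiD expiN /r rmorphM /= fmorphV /=.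
  have -> : v / w = (a * v) / (a * w) by rewrite -mulf_div divff// mul1r.
  rewrite {1}(arg_polar v0) {1}(arg_polar w0); field.
  by rewrite expi_neq0 -[_%:C == 0]/(_%:C == 0%:C) (inj_eq (@complexI _)) gt_eqF.
rewrite e arg_unique//.
move: vw0; rewrite e /expi /= mul0r subr0 pmulr_rgt0// => ct.
have tpi : `|t| < pi.
  have := arg_bound (a * v); have := arg_bound (a * w).
  rewrite !ltr_norml /t => /andP[? ?] /andP[? ?]; apply/andP; split; lra.
rewrite ltNge; apply/negP => h; have p0 := pi_gt0 R.
move: ct; rewrite -cos_norm ltNge -(cos_pihalf R) => /negP; apply.
rewrite le_eqVlt; move: h; rewrite le_eqVlt => /orP[/eqP ->|h]; first by rewrite eqxx.
by rewrite ltr_cos ?h ?orbT// in_itv /=; apply/andP; split; lra.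
Qed.

Lemma argMi w : 0 < complex.Re w -> complex.Im w < 0 ->
  arg ('i%C * w) = arg w + pi / 2.
Proof.
move=> w0 wi; have aw : arg w < 0.
  rewrite /arg -[X in _ < X](atan0 R); apply: lt_atan.
  by rewrite pmulr_llt0// invr_gt0.
have cw : 0 < cabs w by apply: lt_le_trans (Re_le_cabs w); rewrite gtr0_norm.
have ii : 'i%C = expi (pi / 2) :> C by rewrite /expi cos_pihalf sin_pihalf.
rewrite {1}(arg_polar w0) ii mulrCA -expiD addrC arg_unique//.
have := arg_bound w; rewrite !ltr_norml => /andP[? ?]; apply/andP; split; lra.
Qed.

Lemma argMNi w : 0 < complex.Re w -> 0 < complex.Im w ->
  arg (- 'i%C * w) = arg w - pi / 2.
Proof.
move=> w0 wi; have aw : 0 < arg w.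
  rewrite /arg -[X in X < _](atan0 R); apply: lt_atan.
  by rewrite mulr_gt0// invr_gt0.
have cw : 0 < cabs w by apply: lt_le_trans (Re_le_cabs w); rewrite gtr0_norm.
have ii : - 'i%C = expi (- (pi / 2)) :> C.
  by rewrite /expi cosN sinN cos_pihalf sin_pihalf; apply/eqP; rewrite eq_complex /= oppr0 !eqxx.
rewrite {1}(arg_polar w0) ii mulrCA -expiD addrC arg_unique//.
have := arg_bound w; rewrite !ltr_norml => /andP[? ?]; apply/andP; split; lra.
Qed.

(** The open sector of half-angle [pi / 4]: the arguments of two such numbers add without leaving
    the principal branch. *)
Definition near1 w := `|complex.Im w| < complex.Re w.

Lemma near1_Re w : near1 w -> 0 < complex.Re w.
Proof. exact: le_lt_trans. Qed.

Lemma near1_arg w : near1 w -> `|arg w| < pi / 4.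
Proof.
move=> h; have w0 := near1_Re h; rewrite /arg -(atan1 R).
move: h; rewrite /near1 !ltr_norml -atanN => /andP[h1 h2].
by rewrite !lt_atan// ?ltr_pdivlMr ?ltr_pdivrMr ?mulN1r ?mul1r.
Qed.

Lemma near1_close w : cabs (w - 1) <= 1 / 4 -> near1 w.
Proof.
case: w => a b h; have := le_trans (Re_le_cabs _) h; have := le_trans (Im_le_cabs _) h.
rewrite /near1 /= subr0 !ler_norml => /andP[? ?] /andP[? ?].
by rewrite ltr_norml; apply/andP; split; lra.
Qed.

Lemma near1_argM w v : near1 w -> near1 v -> arg (w * v) = arg w + arg v.
Proof.
move=> hw hv; apply: argM; rewrite ?near1_Re//.
apply: le_lt_trans (ler_normD _ _) _.
have := near1_arg hw; have := near1_arg hv; have := pi_gt0 R; lra.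
Qed.

(* A discrete variation of the argument: contours are finite sequences of points
   at which the successive ratios are close to [1]. *)
Definition turn u n := \sum_(i < n) arg (u i.+1 / u i).

(** As long as the values stay in one open half-plane, rotated to the right one by [a], a single
    branch of the argument serves for all of them and the sum telescopes. *)
Lemma turn_half a u n : (forall i, (i <= n)%N -> 0 < complex.Re (a * u i)) ->
  (forall i, (i < n)%N -> 0 < complex.Re (u i.+1 / u i)) ->
  turn u n = arg (a * u n) - arg (a * u 0%N).
Proof.
move=> h1 h2.
rewrite -(telescope_sumr (fun i => arg (a * u i)) (leq0n n)) big_mkord /turn.
apply: eq_bigr => i _; have ii := ltn_ord i; rewrite /= (@arg_ratio a).
- by [].
- exact/h1/ltnW.
- exact: (h1 i.+1 ii).
- exact: h2.
Qed.

Lemma turn_half_bound a u n : (forall i, (i <= n)%N -> 0 < complex.Re (a * u i)) ->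
  (forall i, (i < n)%N -> 0 < complex.Re (u i.+1 / u i)) -> `|turn u n| <= pi.
Proof.
move=> h1 h2; rewrite (turn_half h1 h2).
apply: le_trans (ler_normB _ _) _.
have := arg_bound (a * u n); have := arg_bound (a * u 0%N); lra.
Qed.

Lemma turnM u u' n : (forall i, (i < n)%N -> near1 (u i.+1 / u i)) ->
  (forall i, (i < n)%N -> near1 (u' i.+1 / u' i)) ->
  turn (fun i => u i * u' i) n = turn u n + turn u' n.
Proof.
move=> h1 h2; rewrite /turn -[RHS]big_split /=; apply: eq_bigr => i _.
by rewrite -mulf_div; apply: near1_argM; [exact: h1|exact: h2].
Qed.

(** A discrete Cauchy theorem. The two ways across a cell have the same product of ratios, and
    [near1] makes the arguments add on both; the sum over all cells telescopes to the boundary. *)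
Lemma grid_turn (u : nat -> nat -> C) n :
  (forall i j, (i <= n)%N -> (j <= n)%N -> u i j != 0) ->
  (forall i j, (i < n)%N -> (j <= n)%N -> near1 (u i.+1 j / u i j)) ->
  (forall i j, (i <= n)%N -> (j < n)%N -> near1 (u i j.+1 / u i j)) ->
  turn (u^~ 0%N) n + turn (u n) n - turn (u^~ n) n - turn (u 0%N) n = 0.
Proof.
move=> u0 hh hv.
pose h i j := arg (u i.+1 j / u i j); pose v i j := arg (u i j.+1 / u i j).
have cell (i j : 'I_n) : h i j - h i j.+1 = v i j - v i.+1 j.
  have [ii jj] := (ltn_ord i, ltn_ord j).
  have e1 : h i j + v i.+1 j = arg (u i.+1 j.+1 / u i j).
    rewrite -[LHS](near1_argM (hh _ _ (ltn_ord i) (ltnW (ltn_ord j))) (hv i.+1 j (ltn_ord i) (ltn_ord j))).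
    by congr arg; field; rewrite !u0// ltnW.
  have e2 : v i j + h i j.+1 = arg (u i.+1 j.+1 / u i j).
    rewrite -[LHS](near1_argM (hv _ _ (ltnW (ltn_ord i)) (ltn_ord j)) (hh i j.+1 (ltn_ord i) (ltn_ord j))).
    by congr arg; field; rewrite !u0// ltnW.
  lra.
have E1 : turn (u^~ 0%N) n - turn (u^~ n) n = \sum_(i < n) \sum_(j < n) (h i j - h i j.+1).
  rewrite /turn -sumrB; apply: eq_bigr => i _.
  rewrite -(big_mkord xpredT (fun j => h i j - h i j.+1)).
  rewrite -[LHS]opprK opprB -(telescope_sumr (h i) (leq0n n)) -sumrN.
  by apply: eq_bigr => j _; rewrite opprB.
have E2 : turn (u 0%N) n - turn (u n) n = \sum_(i < n) \sum_(j < n) (v i j - v i.+1 j).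
  rewrite exchange_big /turn -sumrB; apply: eq_bigr => j _ /=.
  rewrite -(big_mkord xpredT (fun i => v i j - v i.+1 j)).
  rewrite -[LHS]opprK opprB -(telescope_sumr (v^~ j) (leq0n n)) -sumrN.
  by apply: eq_bigr => i _; rewrite opprB.
suff : turn (u^~ 0%N) n - turn (u^~ n) n = turn (u 0%N) n - turn (u n) n by lra.
by rewrite E1 E2; apply: eq_bigr => i _; apply: eq_bigr => j _; exact: cell.
Qed.

End Turning.

(** * Rectangles and fine subdivisions *)

Section Rectangles.
Variable R : realType.
Local Notation C := R[i].
Implicit Types (z w a : C) (f g : C -> C^o) (s : seq C).

Definition rect (x0 x1 y0 y1 : R) z :=
  (x0 <= complex.Re z <= x1) && (y0 <= complex.Im z <= y1).

Lemma entire_lip f (rho : R) : entire f -> exists2 L, 0 < L &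
  forall z h, cabs z <= rho -> cabs h <= 1 -> cabs (f (z + h) - f z) <= L * cabs h.
Proof.
move=> ef; have [K K0 hK] := derive1_taylor rho ef.
have [M M0 hM] := entire_bounded rho (entire_derive1 ef).
exists (K + M); first by lra.
move=> z h zr h1; have := hK z h zr h1; have := hM z zr => d1 d2.
rewrite -(subrK (h * (derive1 f) z) (f (z + h) - f z)).
apply: le_trans (cabsD _ _) _; rewrite cabsM mulrDl; apply: lerD.
  by apply: le_trans d2 _; rewrite ler_pM2l// expr2 ler_piMr// cabs_ge0.
by rewrite mulrC ler_wpM2r// cabs_ge0.
Qed.

Lemma rect_cabs x0 x1 y0 y1 z : rect x0 x1 y0 y1 z ->
  cabs z <= `|x0| + `|x1| + `|y0| + `|y1|.
Proof.
move=> /andP[/andP[a b] /andP[c d]]; apply: le_trans (cabs_le_ReIm z) _.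
have e1 : `|complex.Re z| <= `|x0| + `|x1|.
  have := ler_norm x1; have := ler_norm (- x0); rewrite normrN.
  have := normr_ge0 x0; have := normr_ge0 x1.
  by rewrite ler_norml => *; apply/andP; split; lra.
have e2 : `|complex.Im z| <= `|y0| + `|y1|.
  have := ler_norm y1; have := ler_norm (- y0); rewrite normrN.
  have := normr_ge0 y0; have := normr_ge0 y1.
  by rewrite ler_norml => *; apply/andP; split; lra.
lra.
Qed.

Lemma rect_lower f x0 x1 y0 y1 : x0 <= x1 -> y0 <= y1 -> entire f ->
  (forall z, rect x0 x1 y0 y1 z -> f z != 0) ->
  exists2 m, 0 < m & forall z, rect x0 x1 y0 y1 z -> m <= cabs (f z).
Proof.
move=> hx hy ef f0.
pose F (p : R * R) : R := cabs (f (p.1 +i* p.2)).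
have cF : continuous F.
  move=> [x y]; apply/cvgrPdist_le => e e0.
  have [L L0 hL] := entire_lip (cabs (x +i* y)) ef.
  pose d := Num.min (1 / 2) (e / (2 * L)).
  have d0 : 0 < d by rewrite lt_min divr_gt0// divr_gt0// mulr_gt0.
  exists (ball x d, ball y d); first by split; exact: nbhsx_ballx.
  move=> [x' y'] [] /=; rewrite /ball /= => h1 h2.
  have hh : cabs ((x' - x) +i* (y' - y)) <= 2 * d.
    apply: le_trans (cabs_le_ReIm _) _ => /=.
    by rewrite (distrC x') (distrC y'); lra.
  have hd1 : d <= 1 / 2 by rewrite /d ge_min lexx.
  have hd2 : d <= e / (2 * L) by rewrite /d ge_min lexx orbT.
  have h1' : cabs ((x' - x) +i* (y' - y)) <= 1 by lra.
  have := hL _ _ (lexx _) h1'.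
  have -> : (x +i* y) + ((x' - x) +i* (y' - y)) = x' +i* y'.
    by simpc; congr (_ +i* _); ring.
  move=> h; apply: le_trans (_ : cabs (f (x' +i* y') - f (x +i* y)) <= _).
    rewrite /F /= ler_norml; apply/andP; split.
      by have := cabs_lub (f (x' +i* y')) (f (x +i* y)); lra.
    by have := cabs_lub (f (x +i* y)) (f (x' +i* y')); rewrite cabs_distC; lra.
  apply: le_trans h _; move: hd2; rewrite ler_pdivlMr ?mulr_gt0//; nra.
have [|||c cA hc] := @compact_EVT_min _ _ F (`[x0, x1] `*` `[y0, y1]).
- by exists (x0, y0); split; rewrite /= in_itv /= lexx ?hx ?hy.
- by apply: compact_setX; exact: segment_compact.
- exact: continuous_subspaceT.
exists (F c).
  rewrite cabs_gt0; apply: f0; move: cA; rewrite inE => -[] /=.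
  by rewrite /rect /= !in_itv /= => -> ->.
move=> [a b] /andP[ha hb]; apply: (hc (a, b)).
by rewrite inE; split; rewrite /= in_itv.
Qed.

Lemma fine_ex f x0 x1 y0 y1 (D : R) : x0 <= x1 -> y0 <= y1 -> entire f ->
  (forall z, rect x0 x1 y0 y1 z -> f z != 0) ->
  exists N0, forall N, (N0 <= N)%N -> forall z w, rect x0 x1 y0 y1 z ->
    rect x0 x1 y0 y1 w -> cabs (w - z) <= D / N%:R -> near1 (f w / f z).
Proof.
move=> hx hy ef f0; have [m m0 hm] := rect_lower hx hy ef f0.
have [L L0 hL] := entire_lip (`|x0| + `|x1| + `|y0| + `|y1|) ef.
(* A step of length [e] changes [f] by at most [L * e <= m / 4], so ratios stay within 1/4 of 1. *)
pose e := Num.min 1 (m / (4 * L)).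
have e0 : 0 < e by rewrite lt_min ltr01 divr_gt0// mulr_gt0.
exists (Num.truncn (`|D| / e)).+1 => N hN z w hz hw.
have N0 : 0 < N%:R :> R by rewrite ltr0n; lia.
have : D / N%:R <= e.
  rewrite ler_pdivrMr// mulrC -ler_pdivrMr//.
  apply: (@le_trans _ _ (`|D| / e)); first by rewrite ler_pM2r ?invr_gt0// ler_norm.
  apply: ltW; apply: lt_le_trans (truncnS_gt _) _; by rewrite ler_nat.
move=> h1 h2; have {h1 h2} : cabs (w - z) <= e by lra.
rewrite le_min => /andP[h1]; rewrite ler_pdivlMr ?mulr_gt0// => h2.
have := hL z (w - z) (rect_cabs hz) h1; rewrite (addrC z) subrK => h3.
apply: near1_close.
have fz := f0 z hz.
have -> : f w / f z - 1 = (f w - f z) / f z by rewrite mulrBl divff.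
rewrite cabsM cabsV ler_pdivrMr ?cabs_gt0//.
apply: le_trans h3 _; have := hm z hz; nra.
Qed.

Definition pt z w (n i : nat) : C := z + (i%:R / n%:R : R)%:C * (w - z).

Definition segfine f z w n :=
  forall i, (i < n)%N -> near1 (f (pt z w n i.+1) / f (pt z w n i)).

Definition segturn f z w n := turn (fun i => f (pt z w n i)) n.

Lemma ptE z w n i : pt z w n i =
  (complex.Re z + i%:R / n%:R * (complex.Re w - complex.Re z)) +i*
  (complex.Im z + i%:R / n%:R * (complex.Im w - complex.Im z)).
Proof.
by case: z w => [a b] [c d]; rewrite /pt; simpc.
Qed.

Lemma pt0 z w n : pt z w n 0 = z.
Proof. by rewrite /pt !mul0r addr0. Qed.

Lemma ptn z w n : (0 < n)%N -> pt z w n n = w.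
Proof. by move=> n0; rewrite /pt divff ?pnatr_eq0 -?lt0n// mul1r addrC subrK. Qed.

Lemma interp_itv (a b lo hi : R) n i : (i <= n)%N -> lo <= a <= hi ->
  lo <= b <= hi -> lo <= a + i%:R / n%:R * (b - a) <= hi.
Proof.
move=> hin /andP[? ?] /andP[? ?].
have t0 : 0 <= (i%:R / n%:R : R) by rewrite divr_ge0.
have t1 : (i%:R / n%:R : R) <= 1.
  case: n hin {t0} => [|n] hin; first by rewrite invr0 mulr0.
  by rewrite ler_pdivrMr ?ltr0n// mul1r ler_nat.
by move: t0 t1; set t := _ / _ => t0 t1; apply/andP; split; nra.
Qed.

Lemma pt_rect x0 x1 y0 y1 z w n i : (i <= n)%N -> rect x0 x1 y0 y1 z ->
  rect x0 x1 y0 y1 w -> rect x0 x1 y0 y1 (pt z w n i).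
Proof.
move=> hin /andP[a b] /andP[c d]; rewrite ptE /rect /=.
by rewrite !interp_itv.
Qed.

Lemma pt_step z w n i : cabs (pt z w n i.+1 - pt z w n i) = cabs (w - z) / n%:R.
Proof.
have -> : pt z w n i.+1 - pt z w n i = (n%:R^-1 : R)%:C * (w - z).
  rewrite /pt -natr1 mulrDl mul1r rmorphD /=; ring.
by rewrite cabsM cabs_real ger0_norm ?invr_ge0// mulrC.
Qed.

Lemma segfine_ex f x0 x1 y0 y1 z w : entire f ->
  rect x0 x1 y0 y1 z -> rect x0 x1 y0 y1 w ->
  (forall z, rect x0 x1 y0 y1 z -> f z != 0) ->
  exists N0, forall N, (N0 <= N)%N -> segfine f z w N.
Proof.
move=> ef hz hw f0.
have hx : x0 <= x1 by move: hz => /andP[/andP[? ?] _]; lra.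
have hy : y0 <= y1 by move: hz => /andP[_ /andP[? ?]]; lra.
have [N0 hN0] := fine_ex (cabs (w - z)) hx hy ef f0.
exists N0 => N hN i hi; apply: (hN0 N hN).
- by apply: pt_rect => //; exact: ltnW.
- exact: pt_rect.
- by rewrite pt_step.
Qed.

Lemma segturnM f g z w n : segfine f z w n -> segfine g z w n ->
  segturn (fun z => f z * g z : C) z w n = segturn f z w n + segturn g z w n.
Proof. by move=> hf hg; rewrite /segturn turnM. Qed.

Lemma grid_argument f x0 x1 y0 y1 : x0 <= x1 -> y0 <= y1 -> entire f ->
  (forall z, rect x0 x1 y0 y1 z -> f z != 0) ->
  exists N0, forall N, (N0 <= N)%N ->
    segturn f (x0 +i* y0) (x1 +i* y0) N + segturn f (x1 +i* y0) (x1 +i* y1) N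
    - segturn f (x0 +i* y1) (x1 +i* y1) N - segturn f (x0 +i* y0) (x0 +i* y1) N = 0.
Proof.
move=> hx hy ef f0.
have [N0 hN0] := fine_ex (x1 - x0 + (y1 - y0)) hx hy ef f0.
exists N0.+1 => N hN.
have NN : (N0 <= N)%N by lia.
have Np : 0 < N%:R :> R by rewrite ltr0n; lia.
pose X i := x0 + i%:R / N%:R * (x1 - x0); pose Y j := y0 + j%:R / N%:R * (y1 - y0).
pose u i j : C := f (X i +i* Y j).
have XN : X N = x1 by rewrite /X divff ?gt_eqF// mul1r addrC subrK.
have YN : Y N = y1 by rewrite /Y divff ?gt_eqF// mul1r addrC subrK.
have X0 : X 0%N = x0 by rewrite /X !mul0r addr0.
have Y0 : Y 0%N = y0 by rewrite /Y !mul0r addr0.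
have rXY i j : (i <= N)%N -> (j <= N)%N -> rect x0 x1 y0 y1 (X i +i* Y j).
  by move=> hi hj; rewrite /rect /= /X /Y !interp_itv ?lexx ?hx ?hy.
have stepn (a b : R) i : a + i.+1%:R / N%:R * b - (a + i%:R / N%:R * b) = b / N%:R.
  by rewrite -natr1; field; rewrite gt_eqF.
have := @grid_turn _ u N _ _ _.
move=> /(_ _ _ _)-/(_ _ _ _) <-; last 3 first.
- by move=> i j hi hj; apply: f0; exact: rXY.
- move=> i j hi hj; apply: (hN0 _ NN); rewrite ?rXY//; first exact: ltnW.
  have -> : (X i.+1 +i* Y j) - (X i +i* Y j) = ((x1 - x0) / N%:R)%:C.
    by apply/eqP; rewrite eq_complex /= /X stepn subrr !eqxx.
  rewrite cabs_real ger0_norm ?divr_ge0 ?subr_ge0// ler_pM2r ?invr_gt0//; lra.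
- move=> i j hi hj; apply: (hN0 _ NN); rewrite ?rXY//; first exact: ltnW.
  have -> : (X i +i* Y j.+1) - (X i +i* Y j) = 'i%C * ((y1 - y0) / N%:R)%:C.
    by apply/eqP; rewrite eq_complex /= /Y stepn !(mul0r, mul1r, mulr0, subr0, sub0r, addr0, add0r, subrr, eqxx, oppr0).
  rewrite cabsM cabs_real /= expr0n expr1n add0r sqrtr1 mul1r.
  rewrite ger0_norm ?divr_ge0 ?subr_ge0// ler_pM2r ?invr_gt0//; lra.
have sx y : segturn f (x0 +i* y) (x1 +i* y) N = turn (fun i => f (X i +i* y)) N.
  by congr turn; apply/funext => i; rewrite ptE /= subrr mulr0 addr0.
have sy x : segturn f (x +i* y0) (x +i* y1) N = turn (fun i => f (x +i* Y i)) N.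
  by congr turn; apply/funext => i; rewrite ptE /= subrr mulr0 addr0.
by rewrite !sx !sy /u X0 Y0 XN YN.
Qed.

End Rectangles.

(** * Argument principle *)

Section ArgumentPrinciple.
Variable R : realType.
Local Notation C := R[i].
Implicit Types (z w a : C) (f g : C -> C^o) (s : seq C).

(** Counterclockwise circuit: the top and left sides are subdivided in the increasing direction,
    hence the minus signs. *)
Definition bturn f (x0 x1 y0 y1 : R) N : R :=
  segturn f (x0 +i* y0) (x1 +i* y0) N + segturn f (x1 +i* y0) (x1 +i* y1) N
  - segturn f (x0 +i* y1) (x1 +i* y1) N - segturn f (x0 +i* y0) (x0 +i* y1) N.

Definition bfine f (x0 x1 y0 y1 : R) N :=
  [/\ segfine f (x0 +i* y0) (x1 +i* y0) N, segfine f (x1 +i* y0) (x1 +i* y1) N,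
      segfine f (x0 +i* y1) (x1 +i* y1) N & segfine f (x0 +i* y0) (x0 +i* y1) N].

Definition bdry (x0 x1 y0 y1 : R) z := rect x0 x1 y0 y1 z &&
  [|| complex.Re z == x0, complex.Re z == x1, complex.Im z == y0 | complex.Im z == y1].

(** Each side is a degenerate rectangle, so [segfine_ex] only asks that [f] have no zero on that
    side. *)
Lemma bfine_ex f x0 x1 y0 y1 : x0 <= x1 -> y0 <= y1 -> entire f ->
  (forall z, bdry x0 x1 y0 y1 z -> f z != 0) ->
  exists N0, forall N, (N0 <= N)%N -> bfine f x0 x1 y0 y1 N.
Proof.
move=> hx hy ef f0.
have eqm (a b : R) : a <= b <= a -> b = a.
  by move=> /andP[? ?]; apply: le_anti; apply/andP; split.
have [N1 h1] : exists N0, forall N, (N0 <= N)%N ->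
    segfine f (x0 +i* y0) (x1 +i* y0) N.
  apply: (@segfine_ex _ _ x0 x1 y0 y0) => //; rewrite /rect /= ?lexx ?hx//.
  move=> z /andP[h /eqm e]; apply: f0; rewrite /bdry /rect h e lexx hy eqxx.
  by rewrite !orbT.
have [N2 h2] : exists N0, forall N, (N0 <= N)%N ->
    segfine f (x1 +i* y0) (x1 +i* y1) N.
  apply: (@segfine_ex _ _ x1 x1 y0 y1) => //; rewrite /rect /= ?lexx ?hy//.
  move=> z /andP[/eqm e h]; apply: f0; rewrite /bdry /rect h e lexx hx eqxx.
  by rewrite !orbT.
have [N3 h3] : exists N0, forall N, (N0 <= N)%N ->
    segfine f (x0 +i* y1) (x1 +i* y1) N.
  apply: (@segfine_ex _ _ x0 x1 y1 y1) => //; rewrite /rect /= ?lexx ?hx//.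
  move=> z /andP[h /eqm e]; apply: f0; rewrite /bdry /rect h e lexx hy eqxx.
  by rewrite !orbT.
have [N4 h4] : exists N0, forall N, (N0 <= N)%N ->
    segfine f (x0 +i* y0) (x0 +i* y1) N.
  apply: (@segfine_ex _ _ x0 x0 y0 y1) => //; rewrite /rect /= ?lexx ?hy//.
  by move=> z /andP[/eqm e h]; apply: f0; rewrite /bdry /rect h e lexx hx eqxx.
exists (maxn (maxn N1 N2) (maxn N3 N4)) => N.
rewrite !geq_max => /andP[/andP[n1 n2] /andP[n3 n4]].
by split; [exact: h1 n1|exact: h2 n2|exact: h3 n3|exact: h4 n4].
Qed.

Lemma bturnM f g x0 x1 y0 y1 N : bfine f x0 x1 y0 y1 N -> bfine g x0 x1 y0 y1 N ->
  bturn (fun z => f z * g z : C) x0 x1 y0 y1 N =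
  bturn f x0 x1 y0 y1 N + bturn g x0 x1 y0 y1 N.
Proof.
move=> [? ? ? ?] [? ? ? ?]; rewrite /bturn !segturnM//; lra.
Qed.

(** Seen from [a], each side lies in a half-plane, which ['i], 1, [- 'i] or -1 rotates to the right
    one. Changing the multiplier at a corner contributes [pi / 2], and there are four corners. *)
Lemma linear_bturn a x0 x1 y0 y1 N : (0 < N)%N ->
  x0 < complex.Re a < x1 -> y0 < complex.Im a < y1 ->
  bfine (fun z => z - a : C) x0 x1 y0 y1 N ->
  bturn (fun z => z - a : C) x0 x1 y0 y1 N = pi *+ 2.
Proof.
case: a => p q N0 /= /andP[p0 p1] /andP[q0 q1] [f1 f2 f3 f4].
rewrite /bturn /segturn.
have H (b z w : C) : segfine (fun z => z - (p +i* q) : C) z w N ->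
    0 < complex.Re (b * (z - (p +i* q))) -> 0 < complex.Re (b * (w - (p +i* q))) ->
    turn (fun i => pt z w N i - (p +i* q)) N =
    arg (b * (w - (p +i* q))) - arg (b * (z - (p +i* q))).
  move=> hf hz hw; rewrite (turn_half (a := b)) ?pt0 ?ptn//; last first.
    by move=> i hi; exact/near1_Re/hf.
  move=> i hi.
  have -> : complex.Re (b * (pt z w N i - (p +i* q))) =
     complex.Re (b * (z - (p +i* q))) + i%:R / N%:R *
     (complex.Re (b * (w - (p +i* q))) - complex.Re (b * (z - (p +i* q)))).
    rewrite ptE {hf hz hw}; case: b z w => [b1 b2] [z1 z2] [w1 w2] /=; ring.
  set A := complex.Re _ in hz *; set B := complex.Re _ in hw *.
  have m0 : 0 < Num.min A B by rewrite lt_min hz hw.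
  apply: (lt_le_trans m0).
  have /andP[//] : Num.min A B <= A + i%:R / N%:R * (B - A) <= Num.max A B.
  by apply: interp_itv => //; rewrite ge_min le_max lexx ?orbT.
rewrite (H 'i%C (x0 +i* y0) (x1 +i* y0))//=; try by rewrite ?mul0r ?mul1r; lra.
rewrite (H 1 (x1 +i* y0) (x1 +i* y1))//=; try by rewrite ?mul0r ?mul1r; lra.
rewrite (H (- 'i%C) (x0 +i* y1) (x1 +i* y1))//=; try by rewrite ?mul0r ?mul1r; lra.
rewrite (H (-1) (x0 +i* y0) (x0 +i* y1))//=; try by rewrite ?mul0r ?mul1r; lra.
set BL := (x0 +i* y0) - _; set BR := (x1 +i* y0) - _.
set TL := (x0 +i* y1) - _; set TR := (x1 +i* y1) - _.
have e1 : arg ('i%C * BR) = arg (1 * BR) + pi / 2.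
  by rewrite mul1r argMi// /BR /=; lra.
have e2 : arg ('i%C * BL) = arg (-1 * BL) - pi / 2.
  have -> : 'i%C * BL = - 'i%C * (-1 * BL) by ring.
  by rewrite argMNi// /BL /=; lra.
have e3 : arg (- 'i%C * TR) = arg (1 * TR) - pi / 2.
  by rewrite mul1r argMNi// /TR /=; lra.
have e4 : arg (- 'i%C * TL) = arg (-1 * TL) + pi / 2.
  have -> : - 'i%C * TL = 'i%C * (-1 * TL) by ring.
  by rewrite argMi// /TL /=; lra.
by rewrite e1 e2 e3 e4; lra.
Qed.

(** One linear factor is split off per root: it turns by 2 pi, and the zero-free cofactor left at
    the end turns by 0. *)
Lemma argument_principle f g s x0 x1 y0 y1 : x0 <= x1 -> y0 <= y1 -> entire g ->
  (forall z, rect x0 x1 y0 y1 z -> g z != 0) ->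
  (forall a, a \in s -> (x0 < complex.Re a < x1) && (y0 < complex.Im a < y1)) ->
  (forall z, f z = linfac s z * g z) ->
  exists N0, forall N, (N0 <= N)%N -> bturn f x0 x1 y0 y1 N = pi *+ 2 *+ size s.
Proof.
move=> hx hy eg g0.
elim: s f => [|a s IH] f hs hf.
  have [N0 h] := grid_argument hx hy eg g0; exists N0 => N /h e.
  have -> : f = g by apply/funext => z; rewrite hf /linfac big_nil mul1r.
  exact: e.
pose f' z : C^o := linfac s z * g z.
have hs' b : b \in s -> (x0 < complex.Re b < x1) && (y0 < complex.Im b < y1).
  by move=> bs; apply: hs; rewrite inE bs orbT.
have [N1 hN1] := IH f' hs' (fun=> erefl).
have bd z b : (x0 < complex.Re b < x1) && (y0 < complex.Im b < y1) ->
    bdry x0 x1 y0 y1 z -> z != b.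
  move=> /andP[/andP[b1 b2] /andP[b3 b4]] /andP[_ h]; apply/eqP => zb; move: h.
  by rewrite zb (gt_eqF b1) (lt_eqF b2) (gt_eqF b3) (lt_eqF b4).
have ef' : entire f' by exact: entireM (entire_linfac s) eg.
have [|N2 hN2] := bfine_ex hx hy ef'.
  move=> z hz; rewrite /f' mulf_neq0 ?g0//; last by case/andP: hz.
  by rewrite linfac_eq0; apply/negP => zs; move: (bd z z (hs' _ zs) hz); rewrite eqxx.
have el : entire (fun z => z - a : C).
  by apply: entire_ext (entire_poly ('X - a%:P)) => z; rewrite !hornerE.
have ha := hs a (mem_head _ _).
have [|N3 hN3] := bfine_ex hx hy el.
  by move=> z hz; rewrite subr_eq0; exact: bd ha hz.
exists (maxn (maxn N1 N2) N3).+1 => N hN.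
have -> : f = (fun z => (z - a) * f' z : C).
  by apply/funext => z; rewrite hf /linfac big_cons /f' mulrA.
rewrite (@bturnM (fun z => z - a : C) f'); [|apply: hN3|apply: hN2]; try lia.
rewrite hN1 ?linear_bturn ?mulrS//; try lia; try by case/andP: ha.
by apply: hN3; lia.
Qed.

Lemma entire_div_roots f s : entire f -> uniq s -> (forall a, a \in s -> f a = 0) ->
  exists2 g, entire g & forall z, f z = linfac s z * g z.
Proof.
elim: s f => [|a s IH] f ef us hs.
  by exists f => // z; rewrite /linfac big_nil mul1r.
have [g eg hg] := entire_quot a ef.
have fa : f a = 0 by apply: hs; rewrite mem_head.
have [||h eh hh] := IH g eg; first by case/andP: us.
  move=> b bs; have := hg b; rewrite fa subr0 hs ?inE ?bs ?orbT// => /esym/eqP.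
  rewrite mulf_eq0 subr_eq0 => /orP[/eqP ba|/eqP//].
  by move: us; rewrite /= -ba bs.
exists h => // z; have := hg z; rewrite fa subr0 => ->.
by rewrite hh /linfac big_cons mulrA.
Qed.

End ArgumentPrinciple.

Ltac complex_ext := apply/eqP; rewrite eq_complex /=; apply/andP; split; apply/eqP.

(** * Turning along a vertical segment *)

Section SideBound.
Variable R : realType.
Local Notation C := R[i].
Implicit Types (z w a : C) (f g : C -> C^o) (u : nat -> C).

(** Vanishing real parts have to be allowed, since samples are classified by [0 <= Re]; division by
    zero would make [arg] equal to 0 there. *)
Lemma closed_polar w : w != 0 -> 0 <= complex.Re w ->
  exists t : R, `|t| <= pi / 2 /\ w = (cabs w)%:C * expi t.
Proof.
case: w => a b w0 /= a0; have p0 := pi_gt0 R.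
case: (ltrgtP a 0) => [|a1|a1]; first by rewrite ltNge a0.
  exists (arg (a +i* b)); split; first exact/ltW/arg_bound.
  by rewrite {1}(@arg_polar _ (a +i* b)).
rewrite a1 expr0n add0r sqrtr_sqr; case: (lerP 0 b) => b0.
  exists (pi / 2); split; first (rewrite ger0_norm//; lra).
  by rewrite /expi cos_pihalf sin_pihalf ger0_norm//; complex_ext; ring.
exists (- (pi / 2)); split; first by rewrite normrN ger0_norm//; lra.
by rewrite /expi cosN sinN cos_pihalf sin_pihalf ltr0_norm//; complex_ext; ring.
Qed.

Lemma arg_ratio_polar (t t' r r' : R) w v : 0 < r -> 0 < r' ->
  w = r%:C * expi t -> v = r'%:C * expi t' -> `|t' - t| <= pi ->
  0 < complex.Re (v / w) -> arg (v / w) = t' - t.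
Proof.
move=> r0 r'0 -> -> tpi.
have rC0 : r%:C != 0 by rewrite -cabs_gt0 cabs_real gtr0_norm.
have -> : r'%:C * expi t' / (r%:C * expi t) = (r' / r)%:C * expi (t' - t).
  by rewrite expiD expiN rmorphM /= fmorphV /=; field; rewrite expi_neq0 rC0.
have q0 : 0 < r' / r by rewrite divr_gt0.
move=> ct; rewrite arg_unique//; move: ct; rewrite /= mul0r subr0 pmulr_rgt0// => ct.
rewrite ltNge; apply/negP => h; have p0 := pi_gt0 R.
move: ct; rewrite -cos_norm ltNge -(cos_pihalf R) => /negP; apply.
rewrite le_eqVlt; move: h; rewrite le_eqVlt => /orP[/eqP ->|h]; first by rewrite eqxx.
by rewrite ltr_cos ?h ?orbT// in_itv /=; apply/andP; split; lra.
Qed.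

(** Compare with the angle [t i] of [u i] or [- u i], whichever lies in the right half-plane. Both
    variations agree on a step without sign change, and a sign change costs at most
    [pi / 4 + pi]. *)
Lemma turn_sign_changes u n : (forall i, (i <= n)%N -> u i != 0) ->
  (forall i, (i < n)%N -> near1 (u i.+1 / u i)) ->
  `|turn u n| <= pi + pi *+ 2 * (count (fun i => (0 <= complex.Re (u i)) !=
     (0 <= complex.Re (u i.+1))) (iota 0 n))%:R.
Proof.
move=> u0 hn; have p0 := pi_gt0 R.
pose b i := 0 <= complex.Re (u i).
pose e i : C := if b i then 1 else -1.
have /choice [t ht] : forall i, exists t : R, (i <= n)%N -> `|t| <= pi / 2 /\
    e i * u i = (cabs (u i))%:C * expi t.
  move=> i; case: (leqP i n) => hi; last by exists 0.
  have [|| t [t1 t2]] := @closed_polar (e i * u i).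
  - by rewrite mulf_neq0 ?u0// /e; case: ifP; rewrite ?oppr_eq0 oner_eq0.
  - rewrite /e; case: ifPn; first by rewrite mul1r.
    by rewrite /b -ltNge mulN1r; case: (u i) => x y /=; rewrite oppr_ge0; exact: ltW.
  exists t => _; split=> //; rewrite t2 cabsM /e.
  by case: ifP; rewrite ?cabsN cabs1 mul1r.
suff H k : (k <= n)%N -> `|turn u k - (t k - t 0%N)| <=
    pi *+ 2 * (count (fun i => b i != b i.+1) (iota 0 k))%:R.
  have := H n (leqnn _); have [h1 _] := ht n (leqnn _); have [h2 _] := ht 0%N (leq0n _).
  rewrite -/(b _); set c := _ * _%:R => h3.
  have := ler_normD (turn u n - (t n - t 0%N)) (t n - t 0%N); rewrite subrK.
  by have := ler_normB (t n) (t 0%N); lra.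
elim: k => [_|k IH hk].
  by rewrite /turn big_ord0 subrr subr0 normr0 mulr0.
have -> : iota 0 k.+1 = iota 0 k ++ [:: k] by rewrite -addn1 iotaD.
rewrite /turn big_ord_recr -/(turn u k).
rewrite count_cat /= addn0.
have [h1 h1'] := ht k (ltnW hk); have [h2 h2'] := ht k.+1 hk.
have ck : 0 < cabs (u k) by rewrite cabs_gt0 u0// ltnW.
have ck1 : 0 < cabs (u k.+1) by rewrite cabs_gt0 u0.
rewrite natrD mulrDr; set A := arg _.
have -> : turn u k + A - (t k.+1 - t 0%N) =
   (turn u k - (t k - t 0%N)) + (A - (t k.+1 - t k)) by ring.
apply: le_trans (ler_normD _ _) _; apply: lerD; first by apply: IH; exact: ltnW.
have tt : `|t k.+1 - t k| <= pi by have := ler_normB (t k.+1) (t k); lra.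
case: eqVneq => bk; last first.
  have := near1_arg (hn k hk); rewrite -/A.
  by have := ler_normB A (t k.+1 - t k); rewrite mulr1; lra.
rewrite /A (_ : u k.+1 / u k = (e k.+1 * u k.+1) / (e k * u k)); last first.
  have -> : e k.+1 = e k by rewrite /e bk.
  by rewrite -mulf_div divff ?mul1r// /e; case: ifP; rewrite ?oppr_eq0 oner_eq0.
rewrite (arg_ratio_polar ck ck1 h1' h2')// ?subrr ?normr0 ?mulr0//.
rewrite (_ : (e k.+1 * u k.+1) / (e k * u k) = u k.+1 / u k).
  exact/near1_Re/hn.
have -> : e k.+1 = e k by rewrite /e bk.
by rewrite -mulf_div divff ?mul1r// /e; case: ifP; rewrite ?oppr_eq0 oner_eq0.
Qed.

(* The sign changes of [Re (b f)] along the segment are zeros of the entire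
   function [G w = (b f(X + i w) + (b f(X + i w^* ))^* ) / 2], which Jensen's
   inequality counts. *)
Lemma side_turn f (X H M : R) N : entire f -> 0 < H -> (0 < N)%N ->
  (forall i, (i <= N)%N -> f (pt (X -i* H) (X +i* H) N i) != 0) ->
  segfine f (X -i* H) (X +i* H) N ->
  (forall z, cabs (z - (X +i* H)) = 6 * H -> cabs (f z) <= M) ->
  exists2 m : nat, cabs (f (X +i* H)) * 2 ^+ m <= M &
    `|segturn f (X -i* H) (X +i* H) N| <= pi + pi *+ 4 * m%:R.
Proof.
move=> ef H0 N0 f0 hf hM.
set c0 := X +i* H.
have Np : 0 < N%:R :> R by rewrite ltr0n.
have fc0 : f c0 != 0 by have := f0 N (leqnn N); rewrite ptn.
(* The rotation for which [b * f c0] is the modulus of [f c0], so that passing to the real part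
   loses nothing at the centre of Jensen's disc. *)
pose b : C := (f c0)^* / (cabs (f c0))%:C.
have cf0 : 0 < cabs (f c0) by rewrite cabs_gt0.
have cfC : (cabs (f c0))%:C != 0 by rewrite -cabs_gt0 cabs_real gtr0_norm.
have cb : cabs b = 1.
  by rewrite /b cabsM cabsV cabsJ cabs_real gtr0_norm// divff// gt_eqF.
have bf : b * f c0 = (cabs (f c0))%:C.
  rewrite /b mulrAC; apply: (mulIf cfC); rewrite mulfVK//.
  rewrite mulrC -sqr_normc normE expr2; by [].
pose y i : R := - H + i%:R / N%:R * (2 * H).
have ptE' i : pt (X -i* H) (X +i* H) N i = X +i* y i.
  by rewrite ptE /= /y; complex_ext; ring.
pose G w : C^o := (b * f ('i%C * w + X%:C) + (b * f ('i%C * w^*%C + X%:C))^*%C) / 2.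
have eG : entire G.
  have e1 : entire (fun w => b * f ('i%C * w + X%:C) : C).
    by apply: entireM (entire_cst b) _; exact: entire_comp.
  have e2 := entire_conj e1.
  have e3 := entireM (entireD e1 e2) (entire_cst (2^-1)).
  exact: e3.
have iX (t : R) : 'i%C * t%:C + X%:C = X +i* t.
  by complex_ext; ring.
have Gr (t : R) : G t%:C = (complex.Re (b * f (X +i* t)))%:C.
  by rewrite ReJ_add /G conjc_real iX.
have GH : G H%:C = (cabs (f c0))%:C by rewrite Gr bf.
(* The segment from [- H] to [H] lies within [2 * H] of the centre [H], and Jensen's inequality uses
   the circle of three times that radius. *)
have GM z : cabs (z - H%:C) = 3 * (2 * H) -> cabs (G z) <= M.
  move=> zr.
  have h1 w : cabs (w - H%:C) = 6 * H -> cabs (b * f ('i%C * w + X%:C)) <= M.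
    move=> wr; rewrite cabsM cb mul1r; apply: hM.
    have -> : 'i%C * w + X%:C - (X +i* H) = 'i%C * (w - H%:C).
      by rewrite -iX; ring.
    by rewrite cabsM wr /= expr0n expr1n add0r sqrtr1 mul1r.
  rewrite /G cabsM cabsV (cabs_nat _ 2) ler_pdivrMr//.
  apply: le_trans (cabsD _ _) _; rewrite cabsJ.
  have e1 := h1 z; have e2 := h1 (conjc z).
  have : cabs (conjc z - H%:C) = 6 * H.
    rewrite -(conjc_real H) -(rmorphB (@conjc R)) cabsJ zr; ring.
  move=> /e2; have /e1 : cabs (z - H%:C) = 6 * H by rewrite zr; ring.
  lra.
pose phi (t : R) : R := complex.Re (b * f (X +i* t)).
have cphi : continuous phi.
  move=> t; apply/cvgrPdist_le => e e0.
  have [L L0 hL] := entire_lip (cabs (X +i* t)) ef.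
  pose d := Num.min 1 (e / L).
  have d0 : 0 < d by rewrite lt_min ltr01 divr_gt0.
  exists d => //= t' /= htt; rewrite /phi.
  have := hL (X +i* t) ('i%C * (t' - t)%:C) (lexx _).
  rewrite cabsM cabs_real /= expr0n expr1n add0r sqrtr1 mul1r => h.
  have {h} := h (_ : `|t' - t| <= 1).
  have t1 : `|t' - t| <= 1.
    by rewrite distrC; apply/ltW/(lt_le_trans htt); rewrite /d ge_min lexx.
  move=> /(_ t1).
  have -> : (X +i* t) + 'i%C * (t' - t)%:C = X +i* t'.
    by complex_ext; ring.
  move=> h; apply: (@le_trans _ _ (cabs (b * (f (X +i* t') - f (X +i* t))))).
    rewrite mulrBr; apply: le_trans (Re_le_cabs _).
    by rewrite distrC; case: (b * _) => ? ?; case: (b * _).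
  rewrite cabsM cb mul1r; apply: le_trans h _.
  have : `|t' - t| <= e / L.
    by rewrite distrC; apply/ltW/(lt_le_trans htt); rewrite /d ge_min lexx orbT.
  by rewrite ler_pdivlMr// mulrC.
pose B i := 0 <= phi (y i).
have ymono i j : (i <= j)%N -> y i <= y j.
  move=> ij; rewrite /y lerD2l ler_pM2r ?mulr_gt0// ler_pM2r ?invr_gt0// ler_nat//.
have ystrict i j : (i < j)%N -> y i < y j.
  move=> ij; rewrite /y ltrD2l ltr_pM2r ?mulr_gt0// ltr_pM2r ?invr_gt0// ltr_nat//.
have y0 : y 0%N = - H by rewrite /y !mul0r addr0.
have yN : y N = H by rewrite /y divff ?gt_eqF//; ring.
have /choice [xi hxi] : forall i, exists x, B i != B i.+1 ->
    [/\ y i <= x, x <= y i.+1 & phi x = 0].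
  move=> i; case: (boolP (B i != B i.+1)) => hB; last by exists 0.
  have [|||x] := @IVT _ phi (y i) (y i.+1) 0.
  - exact: ymono.
  - exact: continuous_subspaceT.
  - move: hB; rewrite /B ge_min le_max.
    by case: (lerP 0 (phi (y i))); case: (lerP 0 (phi (y i.+1))) => //= h1 h2 _;
      rewrite ?(ltW h1) ?(ltW h2) ?orbT.
  by rewrite in_itv /= => /andP[x1 x2] x0; exists x.
pose ch i := B i != B i.+1.
(* Neighbouring sign changes may share a zero at their common sample point. Those with indices of
   the same parity give distinct zeros. *)
have par (p : bool) : cabs (f c0) *
    2 ^+ count (fun i => ch i && (odd i == p)) (iota 0 N) <= M.
  pose l := seq.filter (fun i => ch i && (odd i == p)) (iota 0 N).
  have lP i : i \in l -> [/\ ch i, odd i = p & (i < N)%N].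
    by rewrite mem_filter mem_iota add0n => /andP[/andP[? /eqP ?] ?].
  have ul : uniq (map (fun i => (xi i)%:C) l).
    rewrite map_inj_in_uniq ?filter_uniq ?iota_uniq//.
    have lt i j : i \in l -> j \in l -> (i < j)%N -> xi i < xi j.
      move=> /lP[ci oi _] /lP[cj oj _] ij.
      have ij2 : (i.+1 < j)%N.
        rewrite ltn_neqAle ij andbT; apply/eqP => ij'.
        by move: oj; rewrite -ij' /= oi; case: (p).
      have [_ h1 _] := hxi i ci; have [h2 _ _] := hxi j cj.
      by have := ystrict _ _ ij2; lra.
    move=> i j il jl /complexI e; case: (ltngtP i j) => // h.
      by have := lt _ _ il jl h; rewrite e ltxx.
    by have := lt _ _ jl il h; rewrite e ltxx.
  have [|g eg hg] := entire_div_roots eG ul.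
    move=> a /mapP[i /lP[ci _ _] ->]; rewrite Gr -/(phi _).
    by have [_ _ ->] := hxi i ci.
  have := @jensen_size _ G g _ H%:C (2 * H) M eg _ hg _ GM.
  rewrite size_map size_filter GH cabs_real gtr0_norm//; apply.
    by rewrite mulr_gt0.
  move=> a /mapP[i /lP[ci _ iN] ->]; rewrite -rmorphB cabs_real.
  have [h1 h2 _] := hxi i ci.
  have := ymono _ _ iN; have := ymono _ _ (leq0n i); rewrite y0 yN => h3 h4.
  by rewrite ler_norml; apply/andP; split; lra.
(* All sign changes together are at most twice the larger parity class; this turns the 2 pi per sign
   change into 4 pi. *)
exists (maxn (count (fun i => ch i && (odd i == true)) (iota 0 N))
             (count (fun i => ch i && (odd i == false)) (iota 0 N))).
  by rewrite /maxn; case: ifP.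
pose u i := b * f (pt (X -i* H) (X +i* H) N i).
have b0 : b != 0 by rewrite -cabs_gt0 cb.
have hu i : u i.+1 / u i = f (pt (X -i* H) (X +i* H) N i.+1) / f (pt (X -i* H) (X +i* H) N i).
  by rewrite /u -mulf_div divff// mul1r.
have -> : segturn f (X -i* H) (X +i* H) N = turn u N.
  by rewrite /segturn /turn; apply: eq_bigr => i _; rewrite hu.
apply: le_trans (@turn_sign_changes u N _ _) _.
- by move=> i hi; rewrite mulf_neq0// f0.
- by move=> i hi; rewrite hu; exact: hf.
rewrite lerD2l (_ : pi *+ 4 = pi *+ 2 * 2); last by ring.
have p0 : 0 < pi *+ 2 :> R by rewrite mulrn_wgt0// pi_gt0.
rewrite -mulrA ler_pM2l// -natrM ler_nat.
have E i : ((0 <= complex.Re (u i)) != (0 <= complex.Re (u i.+1))) = ch i.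
  by rewrite /ch /B /phi /u !ptE'.
rewrite (eq_count E).
have -> : count ch (iota 0 N) = (count (fun i => ch i && (odd i == true)) (iota 0 N) +
   count (fun i => ch i && (odd i == false)) (iota 0 N))%N.
  elim: (iota 0 N) => //= i l ->; case: (ch i); case: (odd i) => /=; lia.
lia.
Qed.

End SideBound.

(** * Bessel functions *)

Section BesselSeries.
Variable R : realType.
Local Notation C := R[i].
Implicit Types (z : C) (k m n : nat) (x y : R).

Definition bcoef k m : C :=
  (-1) ^+ m / (m`! * (m + k)`!)%N%:R / 2%:R ^+ (2 * m + k).

Definition bpoly k n : {poly C} := \sum_(m < n) bcoef k m *: 'X^(2 * m + k).

Lemma bpoly0 k : bpoly k 0 = 0.
Proof. by rewrite /bpoly big_ord0. Qed.

Lemma bpolyS k n : bpoly k n.+1 = bpoly k n + bcoef k n *: 'X^(2 * n + k).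
Proof. by rewrite /bpoly big_ord_recr. Qed.

Lemma bin_le_exp2 n m : ('C(n, m) <= 2 ^ n)%N.
Proof.
case: (leqP m n) => h; last by rewrite bin_small.
rewrite -[2%N]/(1 + 1)%N expnDn (bigD1 (Ordinal (h : m < n.+1)%N)) //=.
by rewrite !exp1n !muln1 leq_addr.
Qed.

Lemma cabs_bcoef k m : cabs (bcoef k m) = (2 ^+ (2 * m + k))^-1 / (m`! * (m + k)`!)%N%:R.
Proof.
rewrite /bcoef !cabsM !cabsV !cabsX !cabs_nat cabsN cabs1 expr1n mul1r; exact: mulrC.
Qed.

(** [1 / (m! (m + k)!)] is the binomial [C(2m + k, m)] over [(2m + k)!], and the powers of 2 in
    [bcoef] absorb the binomial: the series is dominated by that of the exponential. *)
Lemma bterm_bound k m z (rho : R) : cabs z <= rho ->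
  cabs (bcoef k m * z ^+ (2 * m + k)) <= exp_coeff rho (2 * m + k).
Proof.
move=> zr; have r0 : 0 <= rho := le_trans (cabs_ge0 z) zr.
rewrite cabsM cabsX cabs_bcoef /exp_coeff /= mulrC.
apply: ler_pM; rewrite ?exprn_ge0 ?cabs_ge0 ?mulr_ge0 ?invr_ge0 ?exprn_ge0 ?ler0n//.
  by rewrite lerXn2r// nnegrE ?cabs_ge0.
rewrite -invfM lef_pV2 ?posrE ?mulr_gt0 ?exprn_gt0 ?ltr0n ?muln_gt0 ?fact_gt0//.
rewrite -natrX -natrM ler_nat.
have mn : (m <= 2 * m + k)%N by lia.
rewrite -(bin_fact mn) (_ : (2 * m + k - m = m + k)%N); last by lia.
by rewrite leq_mul2r bin_le_exp2 orbT.
Qed.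

Lemma bpoly_diff k n n' z (rho : R) : cabs z <= rho -> (n <= n')%N ->
  cabs ((bpoly k n').[z] - (bpoly k n).[z]) <=
  series (exp_coeff rho) (2 * n' + k)%N - series (exp_coeff rho) (2 * n + k)%N.
Proof.
move=> zr; have r0 : 0 <= rho := le_trans (cabs_ge0 z) zr.
elim: n' => [|n' IH]; first by rewrite leqn0 => /eqP ->; rewrite !subrr cabs0.
rewrite leq_eqVlt => /orP[/eqP ->|]; first by rewrite !subrr cabs0.
rewrite ltnS => /IH h; rewrite bpolyS hornerD hornerZ hornerXn.
rewrite addrAC; apply: le_trans (cabsD _ _) _.
have := bterm_bound k n' zr.
have -> : (2 * n'.+1 + k = (2 * n' + k).+2)%N by lia.
rewrite /series /= in h *; rewrite !big_nat_recr//=.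
by have := exp_coeff_ge0 (2 * n' + k).+1 r0; lra.
Qed.

Lemma lucvg_bpoly_ex k : exists f, lucvg (bpoly k) f.
Proof.
apply: lucvg_cauchy => rho e e0; have e2 : 0 < e / 2 by lra.
have /cvgrPdist_le/(_ (e / 2) e2) [N _ hN] :
  series (exp_coeff `|rho|) @ \oo --> expR `|rho| by exact: is_cvg_series_exp_coeff.
have H n m : (N <= n)%N -> (n <= m)%N -> forall z, cabs z <= rho ->
    cabs ((bpoly k n).[z] - (bpoly k m).[z]) <= e.
  move=> Nn nm z zr; rewrite cabs_distC.
  have := @bpoly_diff k n m z `|rho| (le_trans zr (ler_norm _)) nm.
  have /= := hN (2 * m + k)%N; have /= := hN (2 * n + k)%N.
  move=> /(_ ltac:(lia)); rewrite ler_distl => /andP[h1 h2].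
  move=> /(_ ltac:(lia)); rewrite ler_distl => /andP[h3 h4].
  lra.
exists N => n m Nn Nm z zr; case: (leqP n m) => h; first exact: H.
by rewrite cabs_distC; apply: H => //; exact: ltnW.
Qed.

Lemma lucvg_bpoly k : lucvg (bpoly k) (@besselJ R k).
Proof.
have [f hf] := lucvg_bpoly_ex k.
suff -> : @besselJ R k = f by [].
apply/funext => z; rewrite /besselJ; apply: cvg_lim => //.
apply/cvgrPdist_le => -[e ei]; rewrite ltcE /= => /andP[/eqP -> e0].
have [N hN] := hf (cabs z) e e0; exists N => // n /= Nn.
have := hN n Nn z (lexx _); rewrite normE lecR.
suff -> : (bpoly k n).[z] = series (fun m : nat =>
    (-1) ^+ m / (m`! * (m + k)`!)%N%:R * (z / 2%:R) ^+ (2 * m + k)%N : C^o) n by [].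
rewrite /series /= big_mkord /bpoly horner_sum; apply: eq_bigr => m _.
by rewrite hornerZ hornerXn /bcoef exprMn exprVn mulrAC mulrA.
Qed.

Lemma entire_besselJ k : entire (@besselJ R k).
Proof. by exists (bpoly k); exact: lucvg_bpoly. Qed.

Lemma besselJ_bound k z : cabs (besselJ k z) <= expR (cabs z).
Proof.
apply: le_eps => e e0; have [N hN] := lucvg_bpoly k (cabs z) e0.
have h := hN N (leqnn N) z (lexx _).
have := @bpoly_diff k 0 N z _ (lexx _) (leq0n _).
rewrite bpoly0 horner0 subr0 muln0 add0n.
have h2 : series (exp_coeff (cabs z)) (2 * N + k)%N <= expR (cabs z).
  apply: nondecreasing_cvgn_le; last exact: is_cvg_series_exp_coeff.
  by apply: nondecreasing_series => i _ _; exact/exp_coeff_ge0/cabs_ge0.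
have h3 : 0 <= series (exp_coeff (cabs z)) k.
  by rewrite /series /=; apply: sumr_ge0 => i _; exact/exp_coeff_ge0/cabs_ge0.
have := cabsD (besselJ k z - (bpoly k N).[z]) (bpoly k N).[z]; rewrite subrK; lra.
Qed.

Lemma bcoefS k m : 4 * (m.+1 * (m.+1 + k))%N%:R * bcoef k m.+1 = - bcoef k m.
Proof.
rewrite /bcoef addSn !factS exprS.
have -> : (2 * m.+1 + k = (2 * m + k).+2)%N by lia.
rewrite !exprS !natrM.
field; rewrite ?pnatr_eq0 -?lt0n ?fact_gt0 ?addSn//=.
by rewrite expf_neq0 ?pnatr_eq0//= -[1]/(1%:R) -!natrD !pnatr_eq0.
Qed.

End BesselSeries.

(** * Bessel's equation, symmetries and the modified function I_k *)

Section BesselFacts.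
Variable R : realType.
Local Notation C := R[i].
Implicit Types (z : C) (k m n : nat) (x y : R).

Definition bessel_op k (p : {poly C}) : {poly C} :=
  'X^2 * deriv (deriv p) + 'X * deriv p + ('X^2 - (k ^ 2)%:R%:P) * p.

Lemma mulX_derivXn n : 'X * deriv 'X^n = n%:R *: 'X^n :> {poly C}.
Proof.
case: n => [|n]; first by rewrite expr0 derivC mulr0 scale0r.
by rewrite derivXn /= mulrnAr -exprS scaler_nat.
Qed.

Lemma bessel_op_Xn k n z :
  (bessel_op k 'X^n).[z] = (n%:R ^+ 2 - k%:R ^+ 2) * z ^+ n + z ^+ n.+2.
Proof.
have h1 := mulX_derivXn n.
have : 'X * deriv ('X * deriv 'X^n) = n%:R *: ('X * deriv 'X^n) :> {poly C}.
  by rewrite {1}h1 derivZ scalerAr.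
rewrite poly.derivM derivX mul1r mulrDr h1 scalerA => h2.
rewrite /bessel_op !hornerD natrX.
have -> : 'X^2 * deriv (deriv 'X^n) = 'X * ('X * deriv (deriv 'X^n)) :> {poly C}.
  by rewrite mulrA -expr2.
rewrite h1.
have := congr1 (fun p : {poly C} => p.[z]) h2.
rewrite hornerD !hornerZ !hornerXn => h3.
have -> : ('X * ('X * deriv (deriv 'X^n))).[z] = (n%:R * n%:R - n%:R) * z ^+ n.
  by rewrite mulrBl -h3 addrAC subrr add0r.
rewrite hornerM hornerD hornerN hornerC hornerXn.
rewrite !hornerXn !exprS expr0; ring.
Qed.

(** The coefficient recurrence [bcoefS] makes all contributions cancel except that of the last
    term. *)
Lemma bessel_op_bpoly k n z :
  (bessel_op k (bpoly R k n)).[z] = - (4 * (n * (n + k))%N%:R * bcoef R k n * z ^+ (2 * n + k)).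
Proof.
elim: n => [|n IH].
  by rewrite bpoly0 /bessel_op !deriv0 !mulr0 !addr0 horner0 !mul0r oppr0.
rewrite bpolyS.
have -> : bessel_op k (bpoly R k n + bcoef R k n *: 'X^(2 * n + k)) =
    bessel_op k (bpoly R k n) + bcoef R k n *: bessel_op k 'X^(2 * n + k).
  rewrite /bessel_op !derivD !derivZ -!mul_polyC; ring.
rewrite hornerD IH hornerZ bessel_op_Xn bcoefS.
have -> : (2 * n.+1 + k = (2 * n + k).+2)%N by lia.
ring.
Qed.

Lemma lucvg_bpoly_op k : lucvg (fun n => bessel_op k (bpoly R k n.+1)) (fun=> 0).
Proof.
move=> rho e e0.
have rr : 0 < `|rho| ^+ 2 + 1 by have := sqr_ge0 `|rho|; lra.
have e2 : 0 < e / (`|rho| ^+ 2 + 1) by rewrite divr_gt0.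
have [N hN] := lucvg_cauchy_rev (@lucvg_bpoly R k) rho e2.
(* What is left is [z ^+ 2] times the last term of the series, a difference of consecutive partial
   sums. *)
exists N => n Nn z zr; rewrite sub0r cabsN bessel_op_bpoly bcoefS mulNr opprK.
have := hN n.+1 n (leqW Nn) Nn z zr.
rewrite bpolyS hornerD addrAC subrr add0r hornerZ hornerXn => h.
have -> : (2 * n.+1 + k = (2 * n + k) + 2)%N by lia.
rewrite exprD mulrA cabsM cabsX.
have h1 : cabs z ^+ 2 <= `|rho| ^+ 2 + 1.
  apply: le_trans (_ : `|rho| ^+ 2 <= _); last by lra.
  by rewrite lerXn2r ?nnegrE ?cabs_ge0// (le_trans zr) ?ler_norm.
have -> : e = e / (`|rho| ^+ 2 + 1) * (`|rho| ^+ 2 + 1) by rewrite divfK// gt_eqF.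
by apply: ler_pM; rewrite ?cabs_ge0 ?exprn_ge0 ?cabs_ge0.
Qed.

Lemma lucvg_shift (q : nat -> {poly C}) f : lucvg q f -> lucvg (fun n => q n.+1) f.
Proof.
by move=> h rho e /(h rho) [N hN]; exists N => n Nn; apply: hN; exact: leqW.
Qed.

Lemma bessel_ode k z :
  z ^+ 2 * derive1 (derive1 (@besselJ R k)) z + z * derive1 (@besselJ R k) z +
  (z ^+ 2 - k%:R ^+ 2) * besselJ k z = 0.
Proof.
have h0 := lucvg_shift (@lucvg_bpoly R k).
have [h1 _] := lucvg_derive1 h0; have [h2 _] := lucvg_derive1 h1.
pose F z : C := 'X^2.[z] * derive1 (derive1 (@besselJ R k)) z +
  'X.[z] * derive1 (@besselJ R k) z + ('X^2 - (k ^ 2)%:R%:P).[z] * besselJ k z.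
have hF := lucvgD (lucvgD (lucvgM (lucvg_const 'X^2) h2)
  (lucvgM (lucvg_const 'X) h1)) (lucvgM (lucvg_const ('X^2 - (k ^ 2)%:R%:P)) h0).
have := lucvg_uniq hF (@lucvg_bpoly_op k) z.
by rewrite !hornerE natrX.
Qed.

Lemma besselJ_opp k z : besselJ k (- z) = (-1) ^+ k * besselJ k z.
Proof.
have h1 := lucvg_comp (-1) 0 (@lucvg_bpoly R k).
have h2 := lucvgM (lucvg_const ((-1) ^+ k)%:P) (@lucvg_bpoly R k).
suff h3 : lucvg (fun n => bpoly R k n \Po (-1 *: 'X + 0%:P))
    (fun z => (-1) ^+ k * besselJ k z).
  by have := lucvg_uniq h1 h3 z; rewrite mulN1r addr0.
apply: (eq_lucvg _ _ h2) => [n w|w]; last by rewrite hornerC.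
rewrite hornerM hornerC horner_comp /bpoly !horner_sum.
rewrite mulr_sumr; apply: eq_bigr => m _; rewrite !hornerZ !hornerXn hornerD hornerZ.
rewrite hornerX hornerC addr0 mulN1r [(- w) ^+ _]exprNn.
have -> : (-1) ^+ (2 * m + k) = (-1) ^+ k :> C.
  by rewrite exprD exprM sqrrN !expr1n mul1r.
ring.
Qed.

Lemma besselJ_conj k z : besselJ k (z^*)%C = ((besselJ k z)^*)%C.
Proof.
have h1 := lucvg_conj (@lucvg_bpoly R k).
suff h2 : lucvg (bpoly R k) (fun w => conjc (besselJ k (conjc w))).
  by have := lucvg_uniq (@lucvg_bpoly R k) h2 (conjc z); rewrite conjcK.
apply: eq_lucvg h1 => // n w; congr (_.[_]).
rewrite /bpoly rmorph_sum; apply: eq_bigr => m _ /=.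
rewrite map_polyZ map_polyXn; congr (_ *: _).
by rewrite /bcoef !(rmorphM (@conjc R)) !fmorphV !rmorphXn rmorphN1 !rmorph_nat.
Qed.

Lemma imagX n : ('i%C : C) ^+ (2 * n) = (-1) ^+ n.
Proof. by rewrite exprM sqr_i. Qed.

(** The modified Bessel function I_k, that is i^(-k) J_k(i y). Its series [Iterm] has positive
    coefficients, and by [besselJ_imag] the real part discards nothing for [0 <= y]. *)
Definition besselI : nat -> R -> R :=
  locked (fun k y => complex.Re ((- 'i%C) ^+ k * besselJ k ('i%C * y%:C))).

Lemma besselIE k y : besselI k y = complex.Re ((- 'i%C) ^+ k * besselJ k ('i%C * y%:C)).
Proof. by rewrite /besselI -lock. Qed.

Definition Iterm k m y : R := (y / 2) ^+ (2 * m + k) / (m`! * (m + k)`!)%N%:R.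

Lemma bpoly_imag k n y :
  (bpoly R k n).['i%C * y%:C] = 'i%C ^+ k * (\sum_(m < n) Iterm k m y)%:C.
Proof.
rewrite /bpoly horner_sum rmorph_sum mulr_sumr; apply: eq_bigr => m _.
rewrite hornerZ hornerXn exprMn exprD imagX /bcoef /Iterm.
rewrite (rmorphM (real_complex R)) fmorphV rmorph_nat rmorphXn.
rewrite (rmorphM (real_complex R)) fmorphV rmorph_nat exprMn exprVn.
have e : (-1) ^+ m * (-1) ^+ m = 1 :> C by rewrite -exprMn mulrNN mulr1 expr1n.
transitivity (((-1) ^+ m * (-1) ^+ m : C) * ('i%C ^+ k * (y%:C ^+ (2 * m + k) /
  2 ^+ (2 * m + k) / (m`! * (m + k)`!)%:R))); first by ring.
by rewrite e mul1r.
Qed.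

Lemma Iterm_ge0 k m y : 0 <= y -> 0 <= Iterm k m y.
Proof. by move=> y0; rewrite divr_ge0// exprn_ge0// divr_ge0. Qed.

Lemma iXk k : (- 'i%C) ^+ k * 'i%C ^+ k = 1 :> C.
Proof. by rewrite -exprMn mulNr -expr2 sqr_i opprK expr1n. Qed.

Lemma iXk' k : 'i%C ^+ k * (- 'i%C) ^+ k = 1 :> C.
Proof. by rewrite mulrC iXk. Qed.

Lemma cvg_besselI k y : 0 <= y -> forall e : R, 0 < e -> exists N, forall n, (N <= n)%N ->
  cabs ((- 'i%C) ^+ k * besselJ k ('i%C * y%:C) - (\sum_(m < n) Iterm k m y)%:C) <= e.
Proof.
move=> y0 e e0; have [N hN] := @lucvg_bpoly R k y e e0.
exists N => n Nn; have := hN n Nn ('i%C * y%:C).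
rewrite cabsM cabs_real /= expr0n expr1n add0r sqrtr1 mul1r ger0_norm//.
move=> /(_ (lexx _)); rewrite bpoly_imag.
have -> : besselJ k ('i%C * y%:C) - 'i%C ^+ k * (\sum_(m < n) Iterm k m y)%:C =
   'i%C ^+ k * ((- 'i%C) ^+ k * besselJ k ('i%C * y%:C) - (\sum_(m < n) Iterm k m y)%:C).
  by rewrite mulrBr mulrA iXk' mul1r.
by rewrite cabsM cabsX /= expr0n expr1n add0r sqrtr1 expr1n mul1r.
Qed.

Lemma besselJ_imag k y : 0 <= y -> besselJ k ('i%C * y%:C) = 'i%C ^+ k * (besselI k y)%:C.
Proof.
move=> y0; set w := (- 'i%C) ^+ k * besselJ k ('i%C * y%:C).
suff h : complex.Im w = 0.
  have -> : (besselI k y)%:C = w by rewrite besselIE -/w; case: (w) h => a b /= ->.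
  by rewrite /w mulrA iXk' mul1r.
apply/eqP; rewrite -normr_eq0 eq_le normr_ge0 andbT; apply: le_eps => e e0.
have [N hN] := cvg_besselI k y0 e0; have := hN N (leqnn N); rewrite -/w add0r.
apply: le_trans; apply: le_trans (Im_le_cabs _).
by case: (w) => a b /=; rewrite subr0.
Qed.

Lemma cvg_besselI_real k y : 0 <= y -> forall e : R, 0 < e -> exists N, forall n, (N <= n)%N ->
  `|besselI k y - \sum_(m < n) Iterm k m y| <= e.
Proof.
move=> y0 e e0; have [N hN] := cvg_besselI k y0 e0; exists N => n Nn.
apply: le_trans (hN n Nn); apply: le_trans (Re_le_cabs _).
by rewrite besselIE; case: (_ * _).
Qed.

Lemma besselI_gt0 k y : 0 < y -> 0 < besselI k y.
Proof.
move=> y0; apply: (@lt_le_trans _ _ (Iterm k 0 y)).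
  by rewrite divr_gt0 ?exprn_gt0 ?divr_gt0 ?ltr0n ?muln_gt0 ?fact_gt0.
apply: le_eps => e e0; have [N hN] := cvg_besselI_real k (ltW y0) e0.
have := hN N.+1 (leqW (leqnn N)); rewrite ler_distl big_ord_recl => /andP[+ _].
have : 0 <= \sum_(m < N) Iterm k (lift ord0 m) y.
  by apply: sumr_ge0 => m _; apply: Iterm_ge0; exact: ltW.
set a := Iterm k _ y; have -> : a = Iterm k 0 y by [].
lra.
Qed.

Lemma besselI_le k x y : 0 <= x -> x <= y -> besselI k x <= besselI k y.
Proof.
move=> x0 xy; have y0 := le_trans x0 xy; apply: le_eps => e e0.
have e2 : 0 < e / 2 by lra.
have [N1 h1] := cvg_besselI_real k x0 e2; have [N2 h2] := cvg_besselI_real k y0 e2.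
have := h1 _ (leq_maxl N1 N2); have := h2 _ (leq_maxr N1 N2).
have : \sum_(m < maxn N1 N2) Iterm k m x <= \sum_(m < maxn N1 N2) Iterm k m y.
  apply: ler_sum => m _; rewrite /Iterm ler_pM2r ?invr_gt0 ?ltr0n ?muln_gt0 ?fact_gt0//.
  by rewrite lerXn2r ?nnegrE ?divr_ge0// ler_pM2r ?invr_gt0.
set A := \sum_(m < _) _; set B := \sum_(m < _) _; rewrite !ler_distl.
by move: A B (besselI k x) (besselI k y) => A B u v h /andP[? ?] /andP[? ?]; lra.
Qed.

Lemma besselI_le_exp k y : 0 <= y -> besselI k y <= expR y.
Proof.
move=> y0; rewrite besselIE.
apply: le_trans (ler_norm _) _; apply: le_trans (Re_le_cabs _) _.
rewrite cabsM cabsX cabsN [X in X ^+ k]/= expr0n expr1n add0r sqrtr1 expr1n mul1r.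
apply: le_trans (besselJ_bound _ _) _.
by rewrite cabsM cabs_real /= expr0n expr1n add0r sqrtr1 mul1r ger0_norm.
Qed.

End BesselFacts.

(** * Derivatives of real and complex curves *)

Section Curves.
Variable R : realType.
Local Notation C := R[i].
Implicit Types (f g : R -> R) (x t : R) (c d : R -> C).

Definition rd f x (l : R) := is_derive x (1 : R) (f : R -> R^o) l.

Lemma rd_eq f x l l' : rd f x l -> l = l' -> rd f x l'.
Proof. by move=> h <-. Qed.

Lemma rd_cst (a x : R) : rd (fun=> a) x 0.
Proof. exact: is_derive_cst. Qed.

Lemma rd_id x : rd (fun t => t) x 1.
Proof. exact: is_derive_id. Qed.

Lemma rdD f g x a b : rd f x a -> rd g x b -> rd (fun t => f t + g t) x (a + b).
Proof. by move=> h1 h2; exact: is_deriveD. Qed.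

Lemma rdN f x a : rd f x a -> rd (fun t => - f t) x (- a).
Proof. by move=> h1; exact: is_deriveN. Qed.

Lemma rdB f g x a b : rd f x a -> rd g x b -> rd (fun t => f t - g t) x (a - b).
Proof. by move=> h1 h2; exact: is_deriveB. Qed.

Lemma rdM f g x a b : rd f x a -> rd g x b ->
  rd (fun t => f t * g t) x (a * g x + f x * b).
Proof.
move=> h1 h2; have h : is_derive x 1 (f * g) (f x *: b + g x *: a).
  exact: is_deriveM.
by apply: rd_eq h _; rewrite -[_ *: _]/(_ * _) -[g x *: _]/(_ * _); ring.
Qed.

Lemma rd_comp f g x a b : rd f (g x) a -> rd g x b -> rd (fun t => f (g t)) x (a * b).
Proof.
by move=> h1 h2; have := @is_derive1_comp R f g x a b h1 h2.
Qed.

Lemma rdV f x a : f x != 0 -> rd f x a -> rd (fun t => (f t)^-1) x (- a / f x ^+ 2).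
Proof.
move=> fx h; have h1 := @is_deriveV R f x a 1 fx h.
by apply: rd_eq h1 _; rewrite -[_ *: _]/(_ * _); ring.
Qed.

Lemma rd_quadratic f x l (K e : R) : 0 < e ->
  (forall h, `|h| <= e -> `|f (x + h) - f x - h * l| <= K * h ^+ 2) -> rd f x l.
Proof.
move=> e0 H.
have cv : h^-1 *: (f (h *: (1 : R) + x) - f x) @[h --> (0 : R)^'] --> l.
  apply/cvgrPdist_le => r r0.
  have K1 : 0 < `|K| + 1 by have := normr_ge0 K; lra.
  have d0 : 0 < Num.min e (r / (`|K| + 1)) by rewrite lt_min e0 divr_gt0.
  have : \forall h \near (0 : R)^', `|h| <= Num.min e (r / (`|K| + 1)).
    exact: dnbhs0_le.
  have hn : \forall h \near (0 : R)^', h != 0 by exact: nbhs_dnbhs_neq.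
  apply: filterS2 hn => h hn0; rewrite le_min => /andP[h1 h2].
  have := H h h1; rewrite -[h *: 1]/(h * 1) mulr1 (addrC h) -[_ *: _]/(_ * _) => H1.
  have -> : l - h^-1 * (f (x + h) - f x) = - (h^-1 * (f (x + h) - f x - h * l)).
    by field.
  rewrite normrN normrM normfV.
  have hp : 0 < `|h| by rewrite normr_gt0.
  rewrite mulrC ler_pdivrMr//; apply: le_trans H1 _.
  rewrite -(real_normK (num_real h)) expr2 mulrA ler_pM2r//.
  move: h2; rewrite ler_pdivlMr// => h2.
  have := ler_norm K; nra.
split; first by apply/cvg_ex; exists l; exact: cv.
exact: cvg_lim cv.
Qed.

Lemma rd_within_continuous f (df : R -> R) a b :
  (forall x, a <= x <= b -> rd f x (df x)) -> {within `[a, b], continuous f}.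
Proof.
move=> h; apply: derivable_within_continuous => x; rewrite in_itv /= => hx.
by have := h x hx; move=> [].
Qed.

Lemma rd_mean f (df : R -> R) a b : a <= b ->
  (forall x, a <= x <= b -> rd f x (df x)) ->
  exists2 c, a <= c <= b & f b - f a = df c * (b - a).
Proof.
rewrite le_eqVlt => /orP[/eqP ->|ab] h.
  by exists b; rewrite ?lexx// !subrr mulr0.
have [||c] := @MVT R f df a b ab.
- by move=> x; rewrite in_itv /= => /andP[h1 h2]; apply: h; rewrite !ltW.
- exact: rd_within_continuous h.
by rewrite in_itv /= => /andP[h1 h2] e; exists c => //; rewrite !ltW.
Qed.

Lemma rd_nonincr f (df : R -> R) a b : a <= b ->
  (forall x, a <= x <= b -> rd f x (df x)) -> (forall x, a <= x <= b -> df x <= 0) ->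
  f b <= f a.
Proof.
move=> ab h h0; have [c hc e] := rd_mean ab h.
rewrite -subr_le0 e; have := h0 c hc; nra.
Qed.

Lemma rd_uniq f x a b : rd f x a -> rd f x b -> a = b.
Proof. by move=> [_ <-] [_ <-]. Qed.

Lemma rd_exp x : rd (@expR R) x (expR x).
Proof. exact: is_derive_expR. Qed.

(** [M * expR (- k)] is non-increasing. [M] may have any sign, so that lower bounds follow by
    applying it to an opposite. *)
Lemma gronwall (M dM k dk : R -> R) a b : a <= b ->
  (forall x, a <= x <= b -> rd M x (dM x)) ->
  (forall x, a <= x <= b -> rd k x (dk x)) ->
  (forall x, a <= x <= b -> dM x <= dk x * M x) ->
  M b <= M a * expR (k b - k a).
Proof.
move=> ab hM hk h.
have := @rd_nonincr (fun t => M t * expR (- k t))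
  (fun t => dM t * expR (- k t) + M t * (expR (- k t) * (- dk t))) a b ab.
move=> /(_ _)-/(_ _ _) H.
have {}H : M b * expR (- k b) <= M a * expR (- k a).
  apply: H => x hx.
    apply: rdM; first exact: hM.
    apply: (@rd_comp expR (fun t => - k t)); first exact: rd_exp.
    by apply: rdN; exact: hk.
  have := h x hx; have := expR_gt0 (- k x); nra.
rewrite -(ler_pM2r (expR_gt0 (- k b))) -mulrA -expRD.
by rewrite (_ : k b - k a + - k b = - k a)//; ring.
Qed.

Definition cder c t (v : C) :=
  rd (fun s => complex.Re (c s)) t (complex.Re v) /\
  rd (fun s => complex.Im (c s)) t (complex.Im v).

Lemma cder_eq c t v w : cder c t v -> v = w -> cder c t w.
Proof. by move=> h <-. Qed.

Lemma ReD (z w : C) : complex.Re (z + w) = complex.Re z + complex.Re w.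
Proof. by case: z; case: w. Qed.
Lemma ImD (z w : C) : complex.Im (z + w) = complex.Im z + complex.Im w.
Proof. by case: z; case: w. Qed.
Lemma ReN (z : C) : complex.Re (- z) = - complex.Re z.
Proof. by case: z. Qed.
Lemma ImN (z : C) : complex.Im (- z) = - complex.Im z.
Proof. by case: z. Qed.
Lemma ReM (z w : C) : complex.Re (z * w) =
  complex.Re z * complex.Re w - complex.Im z * complex.Im w.
Proof. by case: z; case: w. Qed.
Lemma ImM (z w : C) : complex.Im (z * w) =
  complex.Re z * complex.Im w + complex.Im z * complex.Re w.
Proof. by case: z; case: w. Qed.

Lemma cderD c d t v w : cder c t v -> cder d t w -> cder (fun s => c s + d s) t (v + w).
Proof.
move=> [h1 h2] [h3 h4]; split; rewrite ?ReD ?ImD.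
  rewrite (_ : (fun _ => _) = fun s => complex.Re (c s) + complex.Re (d s)).
    exact: rdD.
  by apply/funext => s; rewrite ReD.
rewrite (_ : (fun _ => _) = fun s => complex.Im (c s) + complex.Im (d s)).
  exact: rdD.
by apply/funext => s; rewrite ImD.
Qed.

Lemma cderM c d t v w : cder c t v -> cder d t w ->
  cder (fun s => c s * d s) t (v * d t + c t * w).
Proof.
move=> [h1 h2] [h3 h4]; split; rewrite ?ReD ?ImD ?ReM ?ImM.
  rewrite (_ : (fun _ => _) = fun s => complex.Re (c s) * complex.Re (d s) -
    complex.Im (c s) * complex.Im (d s)); last by apply/funext => s; rewrite ReM.
  by apply: rd_eq (rdB (rdM h1 h3) (rdM h2 h4)) _; ring.
rewrite (_ : (fun _ => _) = fun s => complex.Re (c s) * complex.Im (d s) +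
    complex.Im (c s) * complex.Re (d s)); last by apply/funext => s; rewrite ImM.
by apply: rd_eq (rdD (rdM h1 h4) (rdM h2 h3)) _; ring.
Qed.

Lemma cder_cst (a : C) t : cder (fun=> a) t 0.
Proof. by split; exact: rd_cst. Qed.

Lemma cderZ (a : C) c t v : cder c t v -> cder (fun s => a * c s) t (a * v).
Proof.
by move=> h; apply: cder_eq (cderM (cder_cst a t) h) _; rewrite mul0r add0r.
Qed.

Lemma cderN c t v : cder c t v -> cder (fun s => - c s) t (- v).
Proof.
move=> h; have := cderZ (-1) h; rewrite mulN1r.
by rewrite (_ : (fun _ => -1 * _) = fun s => - c s)//; apply/funext => s; rewrite mulN1r.
Qed.

Lemma cderB c d t v w : cder c t v -> cder d t w -> cder (fun s => c s - d s) t (v - w).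
Proof. by move=> h1 h2; apply: cderD h1 (cderN h2). Qed.

Lemma cder_real f t l : rd f t l -> cder (fun s => (f s)%:C) t l%:C.
Proof. by move=> h; split=> //=; exact: rd_cst. Qed.

Lemma cderV c t v : c t != 0 -> cder c t v -> cder (fun s => (c s)^-1) t (- v / c t ^+ 2).
Proof.
move=> c0 [h1 h2].
have n0 : complex.Re (c t) ^+ 2 + complex.Im (c t) ^+ 2 != 0.
  by rewrite -sqr_cabs expf_neq0// cabs_eq0.
move: n0; rewrite !expr2 => n0.
have hn := @rdV (fun s => complex.Re (c s) * complex.Re (c s) +
  complex.Im (c s) * complex.Im (c s)) _ _ n0 (rdD (rdM h1 h1) (rdM h2 h2)).
have E s : (c s)^-1 = (complex.Re (c s) * (complex.Re (c s) * complex.Re (c s) +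
    complex.Im (c s) * complex.Im (c s))^-1) +i* (- complex.Im (c s) *
    (complex.Re (c s) * complex.Re (c s) + complex.Im (c s) * complex.Im (c s))^-1).
  by case: (c s) => a b; complex_ext; rewrite -!expr2 ?mulNr.
have e2 : c t ^+ 2 != 0 by rewrite expf_neq0.
have key : - v / c t ^+ 2 = - v * (((c t)^*)%C ^+ 2) /
   ((complex.Re (c t) * complex.Re (c t) + complex.Im (c t) * complex.Im (c t)) ^+ 2)%:C.
  have e1 : (complex.Re (c t) * complex.Re (c t) + complex.Im (c t) * complex.Im (c t))%:C
      = c t * ((c t)^*)%C.
    by case: (c t) => a b; complex_ext; ring.
  rewrite (rmorphXn (real_complex R)) /= e1 exprMn; have : ((c t)^*)%C != 0 by rewrite conjc_eq0.
  by move=> q0; field; rewrite c0 q0.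
rewrite key.
rewrite -(fmorphV (real_complex R)) /=.
split.
  rewrite (_ : (fun _ => _) = fun s => complex.Re (c s) * (complex.Re (c s) *
     complex.Re (c s) + complex.Im (c s) * complex.Im (c s))^-1); last first.
    by apply/funext => s; rewrite E.
  apply: rd_eq (rdM h1 hn) _.
  rewrite !(ReM, ImM, ReN, ImN) /=.
  move: n0; case: (c t) => a b /=; case: (v) => p q /= n0.
  by field.
rewrite (_ : (fun _ => _) = fun s => - complex.Im (c s) * (complex.Re (c s) *
     complex.Re (c s) + complex.Im (c s) * complex.Im (c s))^-1); last first.
  by apply/funext => s; rewrite E.
apply: rd_eq (rdM (rdN h2) hn) _.
rewrite !(ReM, ImM, ReN, ImN) /=.
move: n0; case: (c t) => a b /=; case: (v) => p q /= n0.
by field.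
Qed.

Lemma cder_expi f t l : rd f t l -> cder (fun s => expi (f s)) t ('i%C * l%:C * expi (f t)).
Proof.
move=> h; split; rewrite !(ReM, ImM) /=.
  have hc : rd (@cos R) (f t) (- sin (f t)) by exact: is_derive_cos.
  by apply: rd_eq (rd_comp hc h) _; ring.
have hc : rd (@sin R) (f t) (cos (f t)) by exact: is_derive_sin.
by apply: rd_eq (rd_comp hc h) _; ring.
Qed.

Lemma cder_entire (F : C -> C^o) (z d : C) t : entire F ->
  cder (fun s => F (z + s%:C * d)) t (d * derive1 F (z + t%:C * d)).
Proof.
move=> eF; set w := z + _.
have [K K0 hK] := derive1_taylor (cabs w) eF.
have d1 : 0 < 1 / (cabs d + 1) by have := cabs_ge0 d; move=> ?; rewrite divr_gt0//; lra.
have H h : `|h| <= 1 / (cabs d + 1) ->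
    cabs (F (z + (t + h)%:C * d) - F (z + t%:C * d) - h%:C * (d * derive1 F w))
    <= (K * cabs d ^+ 2) * h ^+ 2.
  move=> hh; have := hK w (h%:C * d) (lexx _).
  rewrite cabsM cabs_real exprMn (real_normK (num_real h)).
  have -> : w + h%:C * d = z + (t + h)%:C * d by rewrite /w rmorphD; ring.
  have -> : h%:C * d * derive1 F w = h%:C * (d * derive1 F w) by ring.
  have -> : K * cabs d ^+ 2 * h ^+ 2 = K * (h ^+ 2 * cabs d ^+ 2) by ring.
  apply.
  move: hh; rewrite ler_pdivlMr ?mul1r//; last by have := cabs_ge0 d; lra.
  have := normr_ge0 h; have := cabs_ge0 d; nra.
split.
  apply: (@rd_quadratic _ _ _ (K * cabs d ^+ 2) _ d1) => h hh.
  apply: le_trans (H h hh); apply: le_trans (Re_le_cabs _).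
  by rewrite !(ReD, ReN) [complex.Re (h%:C * _)]ReM /= mul0r subr0.
apply: (@rd_quadratic _ _ _ (K * cabs d ^+ 2) _ d1) => h hh.
apply: le_trans (H h hh); apply: le_trans (Im_le_cabs _).
by rewrite !(ImD, ImN) [complex.Im (h%:C * _)]ImM /= mul0r addr0.
Qed.

(** Complex curves admit no mean value equality; project on the direction of [w = c b - c a] and use
    the real one. *)
Lemma cder_mean c (dc : R -> C) (K a b : R) : a <= b ->
  (forall x, a <= x <= b -> cder c x (dc x)) ->
  (forall x, a <= x <= b -> cabs (dc x) <= K) ->
  cabs (c b - c a) <= K * (b - a).
Proof.
move=> ab h hK; set w := c b - c a.
have [->|w0] := eqVneq w 0.
  rewrite cabs0 mulr_ge0 ?subr_ge0//; apply: le_trans (cabs_ge0 (dc a)) (hK a _).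
  by rewrite lexx.
pose F t := complex.Re ((w^*)%C * c t).
have hF x : a <= x <= b -> rd F x (complex.Re ((w^*)%C * dc x)).
  by move=> hx; have [] := cderZ (w^*)%C (h x hx).
have [x hx e] := rd_mean ab hF.
have : cabs w ^+ 2 = F b - F a.
  rewrite /F -ReN -ReD -mulrN -mulrDr -/w sqr_cabs ReM.
  by case: (w) => p q /=; ring.
rewrite e => e2.
have wp : 0 < cabs w by rewrite cabs_gt0.
rewrite -(ler_pM2l wp) -expr2 e2 mulrA ler_wpM2r ?subr_ge0//.
apply: le_trans (ler_norm _) _; apply: le_trans (Re_le_cabs _) _.
by rewrite cabsM cabsJ ler_pM2l// hK.
Qed.

Lemma rd_sqr_cabs c t v : cder c t v ->
  rd (fun s => cabs (c s) ^+ 2) t (2 * complex.Re (v * ((c t)^*)%C)).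
Proof.
move=> [h1 h2].
rewrite (_ : (fun _ => _) = fun s => complex.Re (c s) * complex.Re (c s) +
  complex.Im (c s) * complex.Im (c s)); last first.
  by apply/funext => s; rewrite sqr_cabs !expr2.
apply: rd_eq (rdD (rdM h1 h1) (rdM h2 h2)) _.
by rewrite ReM; case: (c t) => p q /=; ring.
Qed.

End Curves.

(** * Growth of real solutions *)

Section RealGrowth.
Variable R : realType.
Implicit Types (x y t : R).

Lemma exp_decay (a e : R) : 0 < e -> exists Y, forall y, Y <= y -> a * expR (- y) <= e.
Proof.
move=> e0; exists ((`|a| + 1) / e) => y hy.
have a1 : 0 < `|a| + 1 by have := normr_ge0 a; lra.
have y0 : 0 < y by apply: lt_le_trans hy; rewrite divr_gt0.
rewrite expRN ler_pdivrMr ?expR_gt0//.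
apply: (@le_trans _ _ (e * y)).
  have : (`|a| + 1) <= y * e by rewrite -ler_pdivrMr.
  by have := ler_norm a; lra.
by rewrite ler_pM2l//; have := expR_ge1Dx y; lra.
Qed.

(* [g] is a positive increasing solution of [g'' = (1 + nu / y^2) g]. *)
Variables (g g1 : R -> R) (nu : R).
Hypothesis n0 : 0 < nu.
Hypothesis rd_g : forall y, 0 < y -> rd g y (g1 y).
Hypothesis rd_g1 : forall y, 0 < y -> rd g1 y ((1 + nu / y ^+ 2) * g y).
Hypothesis g_gt0 : forall y, 0 < y -> 0 < g y.
Hypothesis g_le : forall x y, 0 < x -> x <= y -> g x <= g y.
Hypothesis start : exists2 c, 1 <= c & 0 <= g1 c.

(** Put [d = g1 - g]. The functions [- d] and [d - h * g] satisfy linear differential inequalities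
    of rates -1 and [- (1 + h)], so they are bounded by multiples of [expR (- y)], which finally
    fall below [h * g 1 <= h * g y]. *)
Lemma log_derive_cvg1 (eta : R) : 0 < eta ->
  exists2 Y, 1 <= Y & forall y, Y <= y -> `|g1 y - g y| <= eta * g y.
Proof.
move=> e0.
pose h := eta / 2; have h0 : 0 < h by rewrite /h; lra.
(* Beyond [c] one has [nu / y ^+ 2 <= nu / y <= h]. *)
pose c : R := 1 + nu / h.
have c1 : 1 <= c by rewrite /c lerDl divr_ge0// ltW.
have nuc y : c <= y -> nu / y ^+ 2 <= h.
  move=> cy; have y1 : 1 <= y by lra.
  have y20 : 0 < y ^+ 2 by rewrite exprn_gt0//; lra.
  rewrite ler_pdivrMr//.
  have : nu / h <= y by rewrite /c in cy; lra.
  rewrite ler_pdivrMr// => h1; apply: le_trans h1 _.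
  rewrite mulrC ler_pM2l// expr2 ler_peMr//; lra.
pose d y := g1 y - g y.
have rdd y : c <= y -> rd d y ((1 + nu / y ^+ 2) * g y - g1 y).
  by move=> cy; apply: rdB; [apply: rd_g1|apply: rd_g]; lra.
have gc y : c <= y -> g 1 <= g y by move=> cy; apply: g_le; lra.
have gg1 : 0 < g 1 by apply: g_gt0.
pose e y := d y - h * g y.
have up y : c <= y -> e y <= `|e c| * expR c * expR (- y).
  move=> cy.
  have H := @gronwall R e (fun y => ((1 + nu / y ^+ 2) * g y - g1 y) - h * g1 y)
    (fun t => - (1 + h) * t) (fun=> - (1 + h)) c y cy.
  have {}H : e y <= e c * expR (- (1 + h) * y - - (1 + h) * c).
    apply: H => x /andP[cx _].
    - apply: rdB; first exact: rdd.
      by apply: rd_eq (rdM (rd_cst h x) (rd_g _)) _; [lra|ring].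
    - by apply: rd_eq (rdM (rd_cst _ x) (rd_id x)) _; ring.
    - rewrite /e /d; have := nuc x cx; have := g_gt0 (_ : 0 < x) => h1 h2.
      have := h1 ltac:(lra); nra.
  apply: le_trans H _; rewrite -mulrA -expRD.
  apply: (@le_trans _ _ (`|e c| * expR (- (1 + h) * y - - (1 + h) * c))).
    by rewrite ler_pM2r ?expR_gt0// ler_norm.
  by rewrite ler_wpM2l// ler_expR; nra.
have lo y : c <= y -> - d y <= `|d c| * expR c * expR (- y).
  move=> cy.
  have H := @gronwall R (fun y => - d y) (fun y => - ((1 + nu / y ^+ 2) * g y - g1 y))
    (fun t => - t) (fun=> -1) c y cy.
  have {}H : - d y <= - d c * expR (- y - - c).
    apply: H => x /andP[cx _].
    - by apply: rdN; exact: rdd.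
    - by apply: rdN; exact: rd_id.
    - rewrite /d; have x0 : 0 < x by lra.
      have : 0 <= nu / x ^+ 2 * g x.
        by rewrite mulr_ge0 ?divr_ge0 ?exprn_ge0 ?(ltW (g_gt0 x0)) ?(ltW n0) ?(ltW x0).
      lra.
  apply: le_trans H _; rewrite -mulrA -expRD opprK (addrC c).
  by rewrite ler_pM2r ?expR_gt0// -normrN ler_norm.
have hg : 0 < h * g 1 by rewrite mulr_gt0.
have [Y1 hY1] := exp_decay (`|e c| * expR c) hg.
have [Y2 hY2] := exp_decay (`|d c| * expR c) hg.
exists (Num.max c (Num.max Y1 Y2)); first by rewrite le_max c1.
move=> y; rewrite !ge_max => /and3P[cy y1 y2].
have u := up y cy; have l := lo y cy; have a1 := hY1 y y1; have a2 := hY2 y y2.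
have hgy : h * g 1 <= h * g y by rewrite ler_pM2l// gc.
have eE : eta * g y = 2 * (h * g y) by rewrite /h; field.
have u' : d y <= 2 * (h * g y) by move: u; rewrite {1}/e; lra.
by rewrite -/(d y) ler_norml eE; apply/andP; split; lra.
Qed.

(** [g1 + g] is at most its own derivative, so it grows at least like [expR], from a positive value
    by [start]; and it is at most [3 * g] as soon as [|g1 - g| <= g]. *)
Lemma exp_lower : exists2 b, 0 < b & exists2 Y, 1 <= Y & forall y, Y <= y -> b * expR y <= g y.
Proof.
have [c c1 hc] := start.
have [Y Y1 hY] := log_derive_cvg1 ltr01.
have c0 : 0 < c by lra.
exists ((g1 c + g c) * expR (- c) / 3).
  have gc := g_gt0 c0; apply: divr_gt0 => //.
  by apply: mulr_gt0; [lra|exact: expR_gt0].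
exists (Num.max c Y); first by rewrite le_max c1.
move=> y; rewrite ge_max => /andP[cy Yy].
have := hY y Yy; rewrite mul1r ler_norml => /andP[h1 h2].
have H := @gronwall R (fun y => - (g1 y + g y))
  (fun y => - ((1 + nu / y ^+ 2) * g y + g1 y)) (fun t => t) (fun=> 1) c y cy.
have {}H : - (g1 y + g y) <= - (g1 c + g c) * expR (y - c).
  apply: H => x /andP[cx _].
  - by apply: rdN; apply: rdD; [apply: rd_g1|apply: rd_g]; lra.
  - exact: rd_id.
  - have x0 : 0 < x by lra.
    have : 0 <= nu / x ^+ 2 * g x.
      by rewrite mulr_ge0 ?divr_ge0 ?exprn_ge0 ?(ltW (g_gt0 x0)) ?(ltW n0) ?(ltW x0).
    lra.
move: H; rewrite expRD; set A := g1 c + g c; lra.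
Qed.

End RealGrowth.

Local Opaque besselJ.

(** * J_k on the imaginary axis *)

Section ImaginaryAxis.
Variable R : realType.
Local Notation C := R[i].
Implicit Types (x y t : R).
Variable k : nat.

Local Notation J := (@besselJ R k).
Local Notation J1 := (derive1 J).
Local Notation J2 := (derive1 J1).
Local Notation I := (@besselI R k).

Definition besselI1 : R -> R :=
  locked (fun y => complex.Re ((- 'i%C) ^+ k * ('i%C * J1 ('i%C * y%:C)))).
Definition besselI2 : R -> R :=
  locked (fun y => complex.Re ((- 'i%C) ^+ k * ('i%C * ('i%C * J2 ('i%C * y%:C))))).

Lemma cder_imag (F : C -> C^o) y : entire F ->
  cder (fun t => F ('i%C * t%:C)) y ('i%C * derive1 F ('i%C * y%:C)).
Proof.
move=> eF; have := cder_entire 0 'i%C y eF; rewrite add0r (mulrC y%:C).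
rewrite (_ : (fun _ => F (0 + _)) = fun s => F ('i%C * s%:C))//.
by apply/funext => s; rewrite add0r mulrC.
Qed.

Lemma rd_besselI y : rd I y (besselI1 y).
Proof.
have [h _] := cderZ ((- 'i%C) ^+ k) (cder_imag y (@entire_besselJ R k)).
rewrite /besselI1 -lock (_ : I = fun t => complex.Re ((- 'i%C) ^+ k * J ('i%C * t%:C)))//.
by apply/funext => t; rewrite besselIE.
Qed.

Lemma rd_besselI1 y : rd besselI1 y (besselI2 y).
Proof.
have h := cder_imag y (entire_derive1 (@entire_besselJ R k)).
by rewrite /besselI1 /besselI2 -!lock; have [] := cderZ ((- 'i%C) ^+ k) (cderZ 'i%C h).
Qed.

(** Negative [y] are included so that the imaginary part vanishes identically and can be
    differentiated. *)
Lemma besselJ_imag_real y : complex.Im ((- 'i%C) ^+ k * J ('i%C * y%:C)) = 0.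
Proof.
case: (lerP 0 y) => y0.
  by rewrite besselJ_imag// mulrA iXk mul1r.
have -> : 'i%C * y%:C = - ('i%C * (- y)%:C) :> C by rewrite rmorphN mulrN opprK.
rewrite besselJ_opp besselJ_imag; last by lra.
have -> : (- 'i%C) ^+ k * ((-1) ^+ k * ('i%C ^+ k * (I (- y))%:C)) =
  ((-1) ^+ k * I (- y))%:C.
  rewrite rmorphM rmorphXn rmorphN1 -[RHS]mul1r -(iXk R k); ring.
by [].
Qed.

Lemma derive_besselJ_imag y :
  (- 'i%C) ^+ k * ('i%C * J1 ('i%C * y%:C)) = (besselI1 y)%:C.
Proof.
rewrite /besselI1 -lock; set w := _ * _.
suff : complex.Im w = 0 by case: (w) => a b /= ->.
have [_ h] := cderZ ((- 'i%C) ^+ k) (cder_imag y (@entire_besselJ R k)).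
apply: (rd_uniq h); rewrite (_ : (fun _ => _) = fun=> 0); first exact: rd_cst.
by apply/funext => t; rewrite besselJ_imag_real.
Qed.

Lemma besselI_ode y : y ^+ 2 * besselI2 y + y * besselI1 y - (y ^+ 2 + k%:R ^+ 2) * I y = 0.
Proof.
have := bessel_ode k ('i%C * y%:C).
move=> /(congr1 (fun w => complex.Re ((- 'i%C) ^+ k * w))).
rewrite mulr0 /= => h; rewrite -[RHS]h /besselI2 /besselI1 -!lock besselIE.
set j2 := J2 _; set j1 := J1 _; set j := J _.
have e1 (r : R) (w : C) : r * complex.Re w = complex.Re (r%:C * w).
  by case: w => a b /=; ring.
have -> : (y ^+ 2 + k%:R ^+ 2) * complex.Re ((- 'i%C) ^+ k * j) =
  - complex.Re ((- 'i%C) ^+ k * (('i%C * y%:C) ^+ 2 - k%:R ^+ 2) * j).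
  rewrite e1 -ReN; congr complex.Re.
  rewrite rmorphD !rmorphXn rmorph_nat exprMn sqr_i; ring.
rewrite !e1 opprK -!ReD; congr complex.Re.
rewrite rmorphXn !exprMn; ring.
Qed.

(** The square root as an exponential: positive everywhere, with an immediate derivative. *)
Definition msqrt y : R := expR (ln y / 2).

Lemma rd_msqrt y : 0 < y -> rd msqrt y (msqrt y / (2 * y)).
Proof.
move=> y0; have h : rd (@ln R) y y^-1 by exact: is_derive1_ln.
have h1 : rd (fun t => ln t / 2) y (y^-1 / 2).
  by apply: rd_eq (rdM h (rd_cst (2^-1) y)) _; rewrite mulr0 addr0.
apply: rd_eq (rd_comp (rd_exp _) h1) _.
by rewrite /msqrt; field; rewrite gt_eqF.
Qed.

Lemma msqrt_gt0 y : 0 < msqrt y.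
Proof. exact: expR_gt0. Qed.

Lemma msqrt_le x y : 0 < x -> x <= y -> msqrt x <= msqrt y.
Proof.
move=> x0 xy; rewrite ler_expR ler_pM2r// ler_ln ?posrE//; lra.
Qed.

Lemma sqr_msqrt y : 0 < y -> msqrt y ^+ 2 = y.
Proof.
by move=> y0; rewrite expr2 -expRD (_ : ln y / 2 + ln y / 2 = ln y) ?lnK//; field.
Qed.

(** Liouville normal form: the factor [msqrt y] removes the first-order term of the modified Bessel
    equation, leaving [g'' = (1 + nu / y^2) g]. [gI1] is its derivative. *)
Definition gI : R -> R := locked (fun y => msqrt y * I y).
Definition gI1 : R -> R := locked (fun y => msqrt y * (besselI1 y + I y / (2 * y))).

Lemma gIE : gI = fun y => msqrt y * I y.
Proof. by rewrite /gI -lock. Qed.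

Lemma gI1E : gI1 = fun y => msqrt y * (besselI1 y + I y / (2 * y)).
Proof. by rewrite /gI1 -lock. Qed.

Definition nu : R := k%:R ^+ 2 - 1 / 4.

Lemma rd_gI y : 0 < y -> rd gI y (gI1 y).
Proof.
move=> y0; rewrite gIE gI1E; apply: rd_eq (rdM (rd_msqrt y0) (rd_besselI y)) _.
by field; rewrite gt_eqF.
Qed.

Lemma rd_gI1 y : 0 < y -> rd gI1 y ((1 + nu / y ^+ 2) * gI y).
Proof.
move=> y0; have y00 : y != 0 by rewrite gt_eqF.
rewrite gIE gI1E.
have h2 : rd (fun t => 2 * t) y 2.
  by apply: rd_eq (rdM (rd_cst 2 y) (rd_id y)) _; ring.
have h := @rdV _ (fun t => 2 * t) y 2.
have h3 := rdM (rd_msqrt y0) (rdD (rd_besselI1 y)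
  (rdM (rd_besselI y) (h (mulf_neq0 _ y00) h2))).
apply: rd_eq (h3 _) _; first by rewrite pnatr_eq0.
have e : besselI2 y = ((y ^+ 2 + k%:R ^+ 2) * I y - y * besselI1 y) / y ^+ 2.
  apply: (mulIf (expf_neq0 2 y00)); rewrite divfK ?expf_neq0//.
  by have := besselI_ode y; lra.
by rewrite e /nu; field.
Qed.

Lemma gI_gt0 y : 0 < y -> 0 < gI y.
Proof. by move=> y0; rewrite gIE mulr_gt0 ?msqrt_gt0// besselI_gt0. Qed.

Lemma gI_le x y : 0 < x -> x <= y -> gI x <= gI y.
Proof.
move=> x0 xy; rewrite gIE; apply: ler_pM; rewrite ?msqrt_le ?besselI_le ?(ltW (msqrt_gt0 _))//.
- exact/ltW/besselI_gt0.
- exact: ltW.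
Qed.

Hypothesis k0 : (0 < k)%N.

(** Order 0 is excluded here; in a section its term is the constant [a 0]. *)
Lemma nu_gt0 : 0 < nu.
Proof.
rewrite /nu; have : 1 <= (k%:R : R) by rewrite ler1n.
move=> ?; nra.
Qed.

(** The increasing function [besselI] has a point of non-negative derivative between 1 and 2. *)
Lemma gI1_start : exists2 c, 1 <= c & 0 <= gI1 c.
Proof.
have [|c /andP[c1 c2] e] := @rd_mean R I besselI1 1 2 _ (fun x _ => rd_besselI x).
  by lra.
exists c => //; rewrite gI1E mulr_ge0 ?(ltW (msqrt_gt0 _))//.
have h : I 1 <= I 2 by apply: besselI_le; rewrite ?ler1n.
have c0 : 0 < c := lt_le_trans ltr01 c1.
have I0 : 0 <= I c / (2 * c).
  exact: divr_ge0 (ltW (besselI_gt0 k c0)) (mulr_ge0 (ler0n _ 2) (ltW c0)).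
apply: (addr_ge0 _ I0).
have aux (p q r : R) : p <= q -> q - p = r * (2 - 1) -> 0 <= r by move=> *; lra.
exact: aux h e.
Qed.

Lemma gI_log_derive (eta : R) : 0 < eta ->
  exists2 Y, 1 <= Y & forall y, Y <= y -> `|gI1 y - gI y| <= eta * gI y.
Proof. exact: (@log_derive_cvg1 R gI gI1 nu nu_gt0 rd_gI rd_gI1 gI_gt0 gI_le). Qed.

Lemma gI_lower : exists2 b, 0 < b & exists2 Y, 1 <= Y & forall y, Y <= y -> b * expR y <= gI y.
Proof. exact: (@exp_lower R gI gI1 nu nu_gt0 rd_gI rd_gI1 gI_gt0 gI_le gI1_start). Qed.

End ImaginaryAxis.

(** * Bessel's equation along a horizontal line *)

Section Horizontal.
Variable R : realType.
Local Notation C := R[i].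
Implicit Types (x t : R).
Variables (y kappa : R) (j j1 j2 : R -> C).
Hypothesis y0 : 0 < y.
Hypothesis cj : forall x, cder j x (j1 x).
Hypothesis cj1 : forall x, cder j1 x (j2 x).
Let z x : C := x +i* y.
Hypothesis ode : forall x, z x ^+ 2 * j2 x + z x * j1 x +
  (z x ^+ 2 - kappa%:C ^+ 2) * j x = 0.
Let nu := kappa ^+ 2 - 1 / 4.
Hypothesis nu0 : 0 <= nu.

(* A branch of [sqrt (- i z)]. *)
Definition hsqrt x : C :=
  (expR (ln (x ^+ 2 + y ^+ 2) / 4))%:C * expi (- (atan (x / y) / 2)).

Let z0 x : z x != 0.
Proof. by rewrite /z eq_complex /= negb_and (gt_eqF y0) orbT. Qed.

Let n2 x : 0 < x ^+ 2 + y ^+ 2.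
Proof. by rewrite ltr_wpDl ?sqr_ge0 ?exprn_gt0. Qed.

Let cz x : cder z x 1.
Proof. by split; [exact: rd_id|exact: rd_cst]. Qed.

Lemma cder_hsqrt x : cder hsqrt x (hsqrt x / (2 * z x)).
Proof.
have yn : y != 0 by rewrite gt_eqF.
have e1 : rd (fun t => t ^+ 2 + y ^+ 2) x (2 * x).
  apply: rd_eq (rdD (rdM (rd_id x) (rd_id x)) (rd_cst (y ^+ 2) x)) _; ring.
have e2 : rd (@ln R) (x ^+ 2 + y ^+ 2) (x ^+ 2 + y ^+ 2)^-1 by exact: is_derive1_ln.
have e3 := rdM (@rd_comp _ _ (fun t => t ^+ 2 + y ^+ 2) _ _ _ e2 e1) (rd_cst (4^-1) x).
have e4 := cder_real (@rd_comp _ _ (fun t => ln (t ^+ 2 + y ^+ 2) / 4) _ _ _ (rd_exp _) e3).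
have a1 : rd (fun t => t / y) x (y^-1).
  by apply: rd_eq (rdM (rd_id x) (rd_cst (y^-1) x)) _; ring.
have a2 : rd (@atan R) (x / y) (1 + (x / y) ^+ 2)^-1 by exact: is_derive1_atan.
have a3 := cder_expi (rdN (rdM (@rd_comp _ _ (fun t => t / y) _ _ _ a2 a1) (rd_cst (2^-1) x))).
apply: cder_eq (cderM e4 a3) _; rewrite /hsqrt.
set E := expR _; set A := expi _.
rewrite mulr0 !addr0 -[2^-1]/(2^-1).
have n0 : x ^+ 2 + y ^+ 2 != 0 by rewrite gt_eqF.
have -> : (2 * z x)^-1 = (x / (2 * (x ^+ 2 + y ^+ 2))) +i* (- y / (2 * (x ^+ 2 + y ^+ 2))).
  apply: (mulfI (_ : 2 * z x != 0)); first by rewrite mulf_neq0// pnatr_eq0.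
  rewrite divff ?mulf_neq0 ?pnatr_eq0// /z -[2]/(2%:R) -(rmorph_nat (real_complex R)).
  by complex_ext; field.
have m0 : 1 + (x / y) ^+ 2 != 0.
  by rewrite gt_eqF// ltr_pwDl// sqr_ge0.
transitivity (E%:C * A * (((x ^+ 2 + y ^+ 2)^-1 * (2 * x) / 4)%:C +
   'i%C * (- ((1 + (x / y) ^+ 2)^-1 / y / 2))%:C)).
  rewrite rmorphM; ring.
congr (_ * _); complex_ext; field; rewrite ?n0 ?yn//=.
Qed.

Let u x : C := hsqrt x * j x.
Let v x : C := hsqrt x * (j1 x + j x / (2 * z x)).

Let cu x : cder u x (v x).
Proof.
apply: cder_eq (cderM (cder_hsqrt x) (cj x)) _; rewrite /v; ring.
Qed.

Let cv x : cder v x (- (1 - nu%:C / z x ^+ 2) * u x).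
Proof.
have zn := z0 x.
have c2 := cderZ 2 (cz x).
have z2 : 2 * z x != 0 by rewrite mulf_neq0// pnatr_eq0.
have ci := @cderV _ (fun t => 2 * z t) _ _ z2 c2.
apply: cder_eq (cderM (cder_hsqrt x) (cderD (cj1 x) (cderM (cj x) ci))) _.
have -> : j2 x = - (j1 x / z x) - (1 - kappa%:C ^+ 2 / z x ^+ 2) * j x.
  apply: (mulfI (expf_neq0 2 zn)); have := ode x.
  move=> /eqP; rewrite -addrA addr_eq0 => /eqP ->; field; exact: zn.
rewrite /u /nu rmorphB rmorphXn rmorphM fmorphV rmorph1 rmorph_nat; field; exact: zn.
Qed.

(** Variation of constants: [u = a e^(-ix) + b e^(ix)], where [v] is the derivative of [u]. Both
    amplitudes would be constant if [nu] were 0. *)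
Let a x : C := 2^-1 * (expi x * (u x + 'i%C * v x)).
Let b x : C := 2^-1 * (expi (- x) * (u x - 'i%C * v x)).

Let ca x : cder a x (2^-1 * ('i%C * expi x * (nu%:C / z x ^+ 2 * u x))).
Proof.
have h := cderM (cder_expi (rd_id x)) (cderD (cu x) (cderZ 'i%C (cv x))).
apply: cder_eq (cderZ (2^-1) h) _; congr (_ * _).
rewrite rmorph1 mulr1.
have i2 : 'i%C * 'i%C = -1 :> C by rewrite -expr2 sqr_i.
transitivity ('i%C * expi x * (nu%:C / z x ^+ 2 * u x) + ('i%C * 'i%C + 1) * expi x * v x).
  ring.
by rewrite i2 addNr !mul0r addr0.
Qed.

Let cb x : cder b x (- (2^-1 * ('i%C * expi (- x) * (nu%:C / z x ^+ 2 * u x)))).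
Proof.
have h := cderM (cder_expi (rdN (rd_id x))) (cderB (cu x) (cderZ 'i%C (cv x))).
apply: cder_eq (cderZ (2^-1) h) _; rewrite -[RHS]mulrN; congr (_ * _).
rewrite rmorphN rmorph1 mulrN1.
have i2 : 'i%C * 'i%C = -1 :> C by rewrite -expr2 sqr_i.
transitivity (- ('i%C * expi (- x) * (nu%:C / z x ^+ 2 * u x)) +
  ('i%C * 'i%C + 1) * expi (- x) * v x).
  ring.
by rewrite i2 addNr !mul0r addr0.
Qed.

Let uE x : u x * expi x = a x + b x * expi x ^+ 2.
Proof.
rewrite /a /b; have h : expi (- x) * expi x = 1 :> C by rewrite -expiD addrC subrr expi0.
transitivity (2^-1 * (expi x * (u x + 'i%C * v x)) +
  2^-1 * ((expi (- x) * expi x) * (u x - 'i%C * v x)) * expi x); last by ring.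
by rewrite h; field.
Qed.

Let cabs_u x : cabs (u x) <= cabs (a x) + cabs (b x).
Proof.
have := cabsD (a x) (b x * expi x ^+ 2).
by rewrite -uE !cabsM !cabs_expi !mulr1.
Qed.

Let cz2 x : y ^+ 2 <= cabs (z x) ^+ 2.
Proof. by rewrite sqr_cabs /= lerDr sqr_ge0. Qed.

Let half x (w : C) : cabs w = 1 ->
  cabs (2^-1 * (w * (nu%:C / z x ^+ 2 * u x))) <= nu / y ^+ 2 / 2 * cabs (u x).
Proof.
move=> w1; move: (u x) => U; rewrite !cabsM w1 !cabsV (cabs_nat _ 2) cabs_real cabsX (ger0_norm nu0) mul1r.
have h : nu / cabs (z x) ^+ 2 <= nu / y ^+ 2.
  by rewrite ler_wpM2l// lef_pV2 ?posrE ?exprn_gt0 ?cabs_gt0 ?z0//; exact: cz2.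
have := ler_wpM2r (cabs_ge0 U) h; lra.
Qed.

(** The total perturbation over a length [L] is of size [nu * L / y ^+ 2]. Gronwall's inequality for
    |a|^2 + |b|^2 bounds [u]; integrating the derivatives of [a] and [b] then shows that both hardly
    move. *)
Lemma horizontal_bound (G L : R) : 0 <= G -> cabs (a 0) <= 2 * G -> cabs (b 0) <= G ->
  2 * nu * L / y ^+ 2 <= 1 -> forall x, 0 <= x <= L ->
  cabs (u x * expi x - a 0) <= cabs (b 0) + 10 * expR 1 * nu * L / y ^+ 2 * G.
Proof.
move=> G0 ha hb hL x /andP[x0 xL].
have y2 : 0 < y ^+ 2 by rewrite exprn_gt0.
have q0 : 0 <= nu / y ^+ 2 by rewrite divr_ge0// ltW.
pose M t := cabs (a t) ^+ 2 + cabs (b t) ^+ 2.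
have ei t : cabs ('i%C * expi t : C) = 1.
  by rewrite cabsM cabs_expi mulr1 /= expr0n expr1n add0r sqrtr1.
(* [M 0 <= 5 * G ^+ 2], Gronwall's exponent is at most 1 by [hL], and |u|^2 is at most [2 * M t];
   the constant 10 e is a crude square root of 10 e. *)
have ubnd t : 0 <= t <= L -> cabs (u t) <= 10 * expR 1 * G.
  move=> /andP[t0 tL].
  have H := @gronwall R M _ (fun s => 2 * (nu / y ^+ 2) * s) (fun=> 2 * (nu / y ^+ 2))
    0 t t0 (fun x _ => rdD (rd_sqr_cabs (ca x)) (rd_sqr_cabs (cb x))).
  have {}H : M t <= M 0 * expR (2 * (nu / y ^+ 2) * t - 2 * (nu / y ^+ 2) * 0).
    apply: H => s _.
      by apply: rd_eq (rdM (rd_cst _ s) (rd_id s)) _; ring.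
    have r1 (w w' : C) : complex.Re (w * (w'^*)%C) <= cabs w * cabs w'.
      by apply: le_trans (ler_norm _) _; apply: le_trans (Re_le_cabs _) _; rewrite cabsM cabsJ.
    set da := 2^-1 * _; set db := - (2^-1 * _).
    have hda : cabs da <= nu / y ^+ 2 / 2 * (cabs (a s) + cabs (b s)).
      apply: le_trans (half s (ei s)) _; rewrite ler_wpM2l//; by rewrite divr_ge0.
    have hdb : cabs db <= nu / y ^+ 2 / 2 * (cabs (a s) + cabs (b s)).
      rewrite cabsN; apply: le_trans (half s (ei (- s))) _.
      rewrite ler_wpM2l//; by rewrite divr_ge0.
    have := r1 da (a s); have := r1 db (b s); rewrite /M.
    have := cabs_ge0 (a s); have := cabs_ge0 (b s).
    move: (cabs (a s)) (cabs (b s)) (cabs da) (cabs db) (complex.Re _) (complex.Re _) q0 hda hdb.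
    move: (nu / y ^+ 2) => q A B DA DB r2 r3 q0 hda hdb B0 A0 h3 h2.
    have h4 : DB * B <= q / 2 * (A + B) * B by rewrite ler_wpM2r.
    have h5 : DA * A <= q / 2 * (A + B) * A by rewrite ler_wpM2r.
    have h6 : 0 <= q * (A - B) ^+ 2 by rewrite mulr_ge0// sqr_ge0.
    nra.
  have e1 : expR (2 * (nu / y ^+ 2) * t - 2 * (nu / y ^+ 2) * 0) <= expR 1.
    rewrite ler_expR mulr0 subr0; apply: le_trans hL.
    rewrite -!mulrA ler_wpM2l// ler_wpM2l// mulrC ler_wpM2r// invr_ge0 ltW//.
  have E1 : 1 <= expR 1 :> R by rewrite -[X in X <= _]expR0 ler_expR.
  have M0 : M 0 <= 5 * G ^+ 2.
    rewrite /M; have := cabs_ge0 (a 0); have := cabs_ge0 (b 0); nra.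
  have M0p : 0 <= M 0 by rewrite addr_ge0 ?sqr_ge0.
  have Mt : M t <= 5 * G ^+ 2 * expR 1.
    apply: le_trans H _; apply: ler_pM => //; exact/ltW/expR_gt0.
  have u2 : cabs (u t) ^+ 2 <= (10 * expR 1 * G) ^+ 2.
    apply: (@le_trans _ _ (2 * M t)).
      have := cabs_u t; have := cabs_ge0 (u t); rewrite /M.
      move: (cabs (u t)) (cabs (a t)) (cabs (b t)) => U A B U0 h.
      have : 0 <= (A - B) ^+ 2 by exact: sqr_ge0.
      nra.
    have : 0 <= G ^+ 2 by exact: sqr_ge0.
    have : expR 1 <= expR 1 ^+ 2 :> R by nra.
    move: E1 Mt; move: (expR 1) (M t) => E m E1 Mt EE GG.
    have : G ^+ 2 * E <= G ^+ 2 * E ^+ 2 by rewrite ler_wpM2l.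
    nra.
  by move: u2; rewrite ler_pXn2r// nnegrE ?cabs_ge0// !mulr_ge0 ?expR_ge0.
have Kp t : 0 <= t <= x -> cabs (u t) <= 10 * expR 1 * G.
  by move=> /andP[t0 tx]; apply: ubnd; rewrite t0 (le_trans tx).
pose K := nu / y ^+ 2 / 2 * (10 * expR 1 * G).
have q2 : 0 <= nu / y ^+ 2 / 2 by rewrite divr_ge0.
have h1 : cabs (a x - a 0) <= K * (x - 0).
  apply: (cder_mean x0 (fun t _ => ca t)) => t ht.
  apply: le_trans (half t (ei t)) _; rewrite ler_wpM2l//; exact: Kp.
have h2 : cabs (b x - b 0) <= K * (x - 0).
  apply: (cder_mean x0 (fun t _ => cb t)) => t ht; rewrite cabsN.
  apply: le_trans (half t (ei (- t))) _; rewrite ler_wpM2l//; exact: Kp.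
have K0 : 0 <= K by rewrite mulr_ge0// !mulr_ge0 ?expR_ge0.
have -> : u x * expi x - a 0 = (a x - a 0) + ((b x - b 0) * expi x ^+ 2 + b 0 * expi x ^+ 2).
  by rewrite uE; ring.
apply: le_trans (cabsD _ _) _; have := cabsD ((b x - b 0) * expi x ^+ 2) (b 0 * expi x ^+ 2).
rewrite !cabsM !cabs_expi !mulr1.
have -> : 10 * expR 1 * nu * L / y ^+ 2 * G = 2 * (K * L).
  by rewrite /K; field; rewrite gt_eqF.
have : K * (x - 0) <= K * L by rewrite subr0 ler_wpM2l.
lra.
Qed.

End Horizontal.

(** * Asymptotics in the upper half-plane and bounds on the right *)

Section BesselAsymptotics.
Variable R : realType.
Local Notation C := R[i].
Implicit Types (x y t : R).
Variable k : nat.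

Local Notation J := (@besselJ R k).
Local Notation J1 := (derive1 J).
Local Notation J2 := (derive1 J1).

Lemma cder_line (F : C -> C^o) x y : entire F ->
  cder (fun t => F (t +i* y)) x (derive1 F (x +i* y)).
Proof.
move=> eF; have := cder_entire (0 +i* y) 1 x eF.
have e t : (0 +i* y) + t%:C * 1 = t +i* y by complex_ext; ring.
rewrite mul1r e (_ : (fun _ => F (_ + _)) = fun t => F (t +i* y))//.
by apply/funext => t; rewrite e.
Qed.

Lemma hsqrt0 y : 0 < y -> hsqrt y 0 = (msqrt y)%:C.
Proof.
move=> y0; rewrite /hsqrt mul0r atan0 mul0r oppr0 expi0 mulr1 expr0n add0r.
by rewrite lnXn// /msqrt; congr (expR _)%:C; rewrite mulr2n; field.
Qed.

Lemma derive_besselJ_imagE y : 'i%C * J1 ('i%C * y%:C) = 'i%C ^+ k * (besselI1 k y)%:C.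
Proof. by rewrite -derive_besselJ_imag mulrA iXk' mul1r. Qed.

(** The initial data are read off the imaginary axis: [a 0] and [b 0] are ['i ^+ k] times half the
    sum and half the difference of [gI] and [gI1], and [gI_log_derive] makes the second
    negligible. *)
Lemma bessel_upper (c eta : R) : (0 < k)%N -> 0 < c -> 0 < eta ->
  exists2 Y, 1 <= Y & forall x y, Y <= y -> 0 <= x <= c * y ->
    cabs (hsqrt y x * J (x +i* y) * expi x - 'i%C ^+ k * (gI k y)%:C) <= eta * gI k y.
Proof.
move=> k0 c0 eta0.
have n0 : 0 <= nu R k := ltW (nu_gt0 R k0).
pose e := Num.min 1 (eta / 2).
have e0 : 0 < e by rewrite lt_min ltr01 divr_gt0.
have [Y0 Y01 hY0] := gI_log_derive k0 e0.
(* For [y] beyond both, [A] keeps Gronwall's exponent at most 1 and [B] the drift of the amplitudes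
   below [eta / 2 * gI k y]. *)
pose A := 2 * nu R k * c; pose B := 20 * expR 1 * nu R k * c / eta.
have A0 : 0 <= A by rewrite !mulr_ge0// ltW.
have B0 : 0 <= B by rewrite divr_ge0 ?(ltW eta0)// !mulr_ge0 ?expR_ge0// ltW.
exists (Y0 + A + B); first by lra.
move=> x y hy hx.
have y0 : 0 < y by lra.
have yA : A <= y by lra.
have yB : B <= y by lra.
have y00 : y != 0 by rewrite gt_eqF.
have g0 := gI_gt0 k y0.
have he := hY0 y ltac:(lra).
have e1 : e <= 1 by rewrite /e ge_min lexx.
have e2 : e <= eta / 2 by rewrite /e ge_min lexx orbT.
have iy0 : (0 +i* y) = 'i%C * y%:C by complex_ext; ring.
have yC : y%:C != 0 by rewrite -cabs_gt0 cabs_real gtr0_norm.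
have ode t : (t +i* y) ^+ 2 * J2 (t +i* y) + (t +i* y) * J1 (t +i* y) +
    ((t +i* y) ^+ 2 - (k%:R)%:C ^+ 2) * J (t +i* y) = 0.
  by have := bessel_ode k (t +i* y); rewrite rmorph_nat.
have H := @horizontal_bound R y k%:R (fun t => J (t +i* y)) (fun t => J1 (t +i* y))
  (fun t => J2 (t +i* y)) y0 (fun t => cder_line t y (@entire_besselJ R k))
  (fun t => cder_line t y (entire_derive1 (@entire_besselJ R k))) ode n0 (gI k y) (c * y) (ltW g0).
have uE : hsqrt y 0 * J (0 +i* y) = 'i%C ^+ k * (gI k y)%:C.
  by rewrite hsqrt0// iy0 besselJ_imag ?(ltW y0)// gIE rmorphM /=; ring.
have vE : 'i%C * (hsqrt y 0 * (J1 (0 +i* y) + J (0 +i* y) / (2 * (0 +i* y)))) =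
    'i%C ^+ k * (gI1 k y)%:C.
  have i0 : 'i%C != 0 :> C by rewrite eq_complex /= oner_eq0 andbF.
  transitivity (hsqrt y 0 * ('i%C * J1 (0 +i* y) + 'i%C * (J (0 +i* y) / (2 * (0 +i* y))))).
    ring.
  rewrite hsqrt0// iy0 derive_besselJ_imagE besselJ_imag ?(ltW y0)// gI1E.
  rewrite rmorphM rmorphD rmorphM fmorphV rmorphM rmorph_nat /=.
  by field; rewrite yC i0.
rewrite uE vE oppr0 expi0 !mul1r in H.
have cik : cabs ('i%C ^+ k : C) = 1.
  by rewrite cabsX /= expr0n expr1n add0r sqrtr1 expr1n.
have aE : 2^-1 * ('i%C ^+ k * (gI k y)%:C + 'i%C ^+ k * (gI1 k y)%:C) =
   'i%C ^+ k * ((gI k y + gI1 k y) / 2)%:C.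
  by rewrite rmorphM rmorphD fmorphV rmorph_nat /=; ring.
have bE : 2^-1 * ('i%C ^+ k * (gI k y)%:C - 'i%C ^+ k * (gI1 k y)%:C) =
   'i%C ^+ k * ((gI k y - gI1 k y) / 2)%:C.
  by rewrite rmorphM rmorphB fmorphV rmorph_nat /=; ring.
have nuE : k%:R ^+ 2 - 4^-1 = nu R k by rewrite /nu mul1r.
rewrite aE bE !(cabsM ('i%C ^+ k)) !cik !mul1r !cabs_real nuE in H.
move: H he g0; move: (gI k y) (gI1 k y) => g g1 H he g0.
have eg : e * g <= g by rewrite ler_piMl// ltW.
have eg2 : e * g <= eta / 2 * g by rewrite ler_wpM2r// ltW.
have hb : `|(g - g1) / 2| <= e * g / 2.
  by rewrite normrM (ger0_norm (_ : 0 <= 2^-1 :> R)) ?invr_ge0// distrC; lra.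
have ha : `|(g + g1) / 2| <= 2 * g.
  by move: he; rewrite !ler_norml => /andP[h1 h2]; apply/andP; split; lra.
have hb1 : `|(g - g1) / 2| <= g by lra.
have q1 : 2 * nu R k * (c * y) / y ^+ 2 <= 1.
  have -> : 2 * nu R k * (c * y) / y ^+ 2 = A / y by rewrite /A; field.
  by rewrite ler_pdivrMr// mul1r.
set W := hsqrt y x * J (x +i* y) * expi x.
have h1 : cabs (W - 'i%C ^+ k * ((g + g1) / 2)%:C) <= `|(g - g1) / 2| + B / y * (eta / 2 * g).
  apply: le_trans (H ha hb1 q1 x hx) _.
  by rewrite lerD2l le_eqVlt; apply/orP; left; apply/eqP; rewrite /B; field; rewrite y00 gt_eqF.
have h2 : B / y * (eta / 2 * g) <= eta / 2 * g.
  rewrite ler_piMl ?mulr_ge0 ?(ltW g0) ?divr_ge0 ?(ltW eta0)//.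
  by rewrite ler_pdivrMr// mul1r.
have -> : W - 'i%C ^+ k * g%:C = (W - 'i%C ^+ k * ((g + g1) / 2)%:C) -
    'i%C ^+ k * ((g - g1) / 2)%:C.
  by rewrite !rmorphM rmorphD rmorphB fmorphV rmorph_nat /=; field.
apply: le_trans (cabsB _ _) _; rewrite (cabsM ('i%C ^+ k)) cik mul1r cabs_real.
lra.
Qed.

Lemma J2E (z : C) : z != 0 ->
  J2 z = - (J1 z / z) - J z + k%:R ^+ 2 / z ^+ 2 * J z.
Proof.
move=> z0; apply: (mulfI (expf_neq0 2 z0)); have := bessel_ode k z.
by move=> /eqP; rewrite -addrA addr_eq0 => /eqP ->; field.
Qed.

Let kk : R := k%:R ^+ 2.
Let kk0 : 0 <= kk := sqr_ge0 _.
Let M (z : C) := cabs (J z) ^+ 2 + cabs (J1 z) ^+ 2.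

(** Along the real axis the cross terms of [J] and [J1] in the derivative of [M] cancel and the
    first-order term damps. The remaining rate [kk / t ^+ 2] is integrable, so [M] stays bounded. *)
Let M_real x : 1 <= x -> M x%:C <= M 1 * expR kk.
Proof.
move=> x1.
have c1 t := cder_line t 0 (@entire_besselJ R k).
have c2 t := cder_line t 0 (entire_derive1 (@entire_besselJ R k)).
have H := @gronwall R (fun t => M t%:C) _ (fun t => - (kk * t^-1)) (fun t => kk / t ^+ 2) 1 x x1
  (fun t _ => rdD (rd_sqr_cabs (c1 t)) (rd_sqr_cabs (c2 t))).
apply: le_trans (H _ _) _ => {H}.
- move=> t /andP[t1 _]; have t0 : t != 0 by rewrite gt_eqF//; lra.
  apply: rd_eq (rdN (rdM (rd_cst kk t) (@rdV _ (fun t => t) _ _ t0 (rd_id t)))) _.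
  by field.
- move=> t /andP[t1 _]; have t0 : 0 < t by lra.
  have tC : t +i* 0 != 0 :> C by rewrite eq_complex /= negb_and gt_eqF.
  have q0 : 0 <= kk / t ^+ 2 by rewrite divr_ge0// exprn_ge0// ltW.
  rewrite (J2E tC) -/(real_complex_def (Phant R) t) /M.
  have kkt : k%:R ^+ 2 / t%:C ^+ 2 = (kk / t ^+ 2)%:C :> C.
    by rewrite rmorphM fmorphV !rmorphXn rmorph_nat.
  rewrite kkt -(fmorphV (real_complex R)).
  move: (J t%:C) (J1 t%:C) => [p q] [r s] /=.
  have ti : 0 < t^-1 by rewrite invr_gt0.
  move: q0 ti; move: (kk / t ^+ 2) (t^-1) => w ti w0 ti0.
  rewrite !sqr_sqrtr ?addr_ge0 ?sqr_ge0//.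
  have h1 : 0 <= w * ((p - r) ^+ 2 + (q - s) ^+ 2) by rewrite mulr_ge0 ?addr_ge0 ?sqr_ge0.
  have h2 : 0 <= ti * (r ^+ 2 + s ^+ 2) by rewrite mulr_ge0 ?addr_ge0 ?sqr_ge0// ltW.
  lra.
rewrite ler_wpM2l ?addr_ge0 ?sqr_ge0// ler_expR invr1.
by rewrite opprK mulr1 gerDr oppr_le0 mulr_ge0// invr_ge0; lra.
Qed.

Let M_vert_aux (A B a b e q : R) : e <= b + (1 + q) * a -> 0 <= q -> 0 <= a -> 0 <= b ->
  A <= b * a -> B <= e * b -> 2 * A + 2 * B <= (4 + q) * (a ^+ 2 + b ^+ 2).
Proof.
move=> he q0 a0 b0 hA hB.
have h1 : e * b <= (b + (1 + q) * a) * b by rewrite ler_wpM2r.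
have h2 : 0 <= q * ((a - b) ^+ 2) by rewrite mulr_ge0// sqr_ge0.
have h3 : 0 <= (a - b) ^+ 2 by exact: sqr_ge0.
have h4 : 0 <= q * (a ^+ 2 + b ^+ 2) by rewrite mulr_ge0// addr_ge0// sqr_ge0.
nra.
Qed.

(** Vertically nothing cancels, but for |z| >= 1 the equation gives |J''| <= |J'| + (1 + kk) |J|,
    hence a rate that does not depend on [x]. The sign [s] selects up or down. *)
Let M_vert x (s t : R) : 1 <= x -> `|s| = 1 -> 0 <= t ->
  M (x%:C + t%:C * (s%:C * 'i%C)) <= M x%:C * expR ((4 + kk) * t).
Proof.
move=> x1 s1 t0.
set d := s%:C * 'i%C.
have d1 : cabs d = 1.
  by rewrite cabsM cabs_real s1 /= expr0n expr1n add0r sqrtr1 mulr1.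
have c1 t := cder_entire x%:C d t (@entire_besselJ R k).
have c2 t := cder_entire x%:C d t (entire_derive1 (@entire_besselJ R k)).
have H := @gronwall R (fun t => M (x%:C + t%:C * d)) _ (fun t => (4 + kk) * t)
  (fun t => 4 + kk) 0 t t0 (fun t _ => rdD (rd_sqr_cabs (c1 t)) (rd_sqr_cabs (c2 t))).
apply: le_trans (H _ _) _ => {H}.
- by move=> u _; apply: rd_eq (rdM (rd_cst _ u) (rd_id u)) _; ring.
- move=> u _; set z := x%:C + u%:C * d.
  have z1 : 1 <= cabs z.
    apply: le_trans (Re_le_cabs _); apply: le_trans (ler_norm _).
    by rewrite /z /d /=; lra.
  have z0 : z != 0 by rewrite -cabs_gt0; lra.
  have r1 (w w' : C) : complex.Re (w * (w'^*)%C) <= cabs w * cabs w'.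
    by apply: le_trans (ler_norm _) _; apply: le_trans (Re_le_cabs _) _; rewrite cabsM cabsJ.
  have hJ2 : cabs (J2 z) <= cabs (J1 z) + (1 + kk) * cabs (J z).
    rewrite (J2E z0).
    apply: le_trans (cabsD _ _) _; rewrite mulrDl mul1r addrA; apply: lerD.
      apply: le_trans (cabsB _ _) _; rewrite cabsN lerD2r cabsM cabsV.
      by rewrite ler_piMr ?cabs_ge0// invf_le1 ?(lt_le_trans ltr01).
    rewrite (cabsM _ (J z)) ler_wpM2r ?cabs_ge0// (cabsM _ (_^-1)) cabsV !cabsX cabs_nat -/kk.
    by rewrite ler_piMr// invf_le1 ?exprn_gt0 ?exprn_ege1// (lt_le_trans ltr01).
  have hA := r1 (d * J1 z) (J z); have hB := r1 (d * J2 z) (J1 z).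
  rewrite (cabsM d (J1 z)) d1 mul1r in hA; rewrite (cabsM d (J2 z)) d1 mul1r in hB.
  exact: M_vert_aux hJ2 kk0 (cabs_ge0 _) (cabs_ge0 _) hA hB.
by rewrite !mul0r addr0 mulr0 subr0.
Qed.

Lemma le_sqr_succ (q e : R) : 0 <= q -> 1 <= e -> q * e <= ((q + 1) * e) ^+ 2.
Proof. by move=> q0 e1; rewrite exprMn; apply: ler_pM => //; nra. Qed.

(** Go from 1 along the real axis and then vertically. Unlike [besselJ_bound], the result is uniform
    in the real part, as Jensen's inequality on a far vertical side demands. *)
Lemma bessel_right_bound : exists2 B, 0 < B & exists2 K, 0 < K &
  forall z : C, 1 <= complex.Re z -> cabs (besselJ k z) <= B * expR (K * `|complex.Im z|).
Proof.
have M0 z : 0 <= M z by rewrite addr_ge0// sqr_ge0.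
set Q := M 1 * expR kk.
have Q0 : 0 <= Q by rewrite mulr_ge0 ?M0 ?expR_ge0.
exists (Q + 1); first by lra.
have hk : 0 < 4 + kk by exact: ltr_pwDl.
exists (4 + kk) => //.
move=> z z1; set x := complex.Re z in z1 *; set y := complex.Im z.
have [s s1 hz] : exists2 s : R, `|s| = 1 & z = x%:C + (`|y|)%:C * (s%:C * 'i%C).
  case: (lerP 0 y) => y0.
    exists 1; first by rewrite normr1.
    rewrite (ger0_norm y0) /x /y; case: (z) => a b; complex_ext; ring.
  exists (-1); first by rewrite normrN1.
  rewrite (ltr0_norm y0) /x /y; case: (z) => a b; complex_ext; ring.
have h := M_vert z1 s1 (normr_ge0 y); rewrite -hz in h.
have h2 := M_real z1.
set E := expR ((4 + kk) * `|y|) in h *.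
have E1 : 1 <= E.
  by rewrite /E -[X in X <= _](@expR0 R) ler_expR mulr_ge0// ltW.
have h3 : M z <= Q * E.
  by apply: le_trans h _; rewrite ler_wpM2r// expR_ge0.
have h4 : cabs (J z) ^+ 2 <= ((Q + 1) * E) ^+ 2.
  apply: (@le_trans _ _ (M z)); first by rewrite /M lerDl sqr_ge0.
  exact: le_trans h3 (le_sqr_succ Q0 E1).
have hq : 0 <= (Q + 1) * E by apply: mulr_ge0; [exact: addr_ge0|exact: expR_ge0].
by rewrite -(@ler_pXn2r R 2 isT (cabs (J z)) ((Q + 1) * E) (cabs_ge0 _) hq).
Qed.

End BesselAsymptotics.

(** * Zeros of Kapteyn sections *)

Section KapteynSection.
Variable R : realType.
Local Notation C := R[i].
Implicit Types (x y t : R) (a : nat -> C) (z : C).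

Lemma kapteynE a n z : kapteyn_section a n z =
  \sum_(k < n.+1) a k * besselJ k (k%:R * z).
Proof. by []. Qed.

Lemma entire_sum (n : nat) (F : nat -> C -> C^o) : (forall k, entire (F k)) ->
  entire (fun z => \sum_(k < n) F k z : C).
Proof.
move=> h; elim: n => [|n IH].
  by apply: entire_ext (entire_cst 0) => z; rewrite big_ord0.
by apply: entire_ext (entireD IH (h n)) => z; rewrite big_ord_recr.
Qed.

Lemma entire_besselJ_scale k : entire (fun z : C => besselJ k (k%:R * z)).
Proof.
by apply: entire_ext (entire_comp k%:R 0 (@entire_besselJ R k)) => z; rewrite addr0.
Qed.

Lemma entire_kapteyn a n : entire (kapteyn_section a n).
Proof.
apply: (@entire_sum n.+1 (fun k z => a k * besselJ k (k%:R * z) : C)) => k.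
exact: entireM (entire_cst (a k)) (entire_besselJ_scale k).
Qed.

Lemma kapteyn_opp a n z : kapteyn_section a n (- z) =
  kapteyn_section (fun k => (-1) ^+ k * a k) n z.
Proof.
by apply: eq_bigr => k _; rewrite mulrN besselJ_opp mulrA (mulrC (a k)).
Qed.

(** Carries estimates from the upper half-plane to the lower one, at the price of conjugated
    coefficients of the same modulus. *)
Lemma kapteyn_conj a n z : kapteyn_section a n (z^*)%C =
  ((kapteyn_section (fun k => ((a k)^*)%C) n z)^*)%C.
Proof.
rewrite !kapteynE (rmorph_sum (@conjc R)); apply: eq_bigr => k _ /=.
rewrite [RHS](rmorphM (@conjc R)) /= conjcK -besselJ_conj.
by rewrite [in RHS](rmorphM (@conjc R)) /= conjc_nat.
Qed.

Lemma besselJ00 : besselJ 0 0 = 1 :> C.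
Proof.
have h := @lucvg_bpoly R 0.
apply/eqP; rewrite -subr_eq0 -cabs_eq0 eq_le cabs_ge0 andbT; apply: le_eps => e e0.
have [N hN] := h 0 e e0; have := hN N.+1 (leqW (leqnn N)) 0.
rewrite cabs0 => /(_ (lexx _)).
rewrite /bpoly horner_sum big_ord_recl big1; last first.
  by move=> i _; rewrite hornerZ hornerXn expr0n mulr0.
rewrite hornerZ hornerXn expr0 /bcoef !fact0 !expr0 !divr1 addr0 mul1r add0r; by [].
Qed.

Lemma kapteyn0 a z : kapteyn_section a 0 z = a 0%N.
Proof. by rewrite kapteynE big_ord1 mul0r besselJ00 mulr1. Qed.

Lemma kapteyn_bound a n : exists2 B, 0 < B &
  forall z, cabs (kapteyn_section a n z) <= B * expR (n%:R * cabs z).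
Proof.
exists (\sum_(k < n.+1) cabs (a k) + 1).
  by rewrite ltr_wpDl// sumr_ge0// => k _; exact: cabs_ge0.
move=> z; rewrite kapteynE; apply: le_trans (cabs_sum _ _ _) _.
apply: (@le_trans _ _ (\sum_(k < n.+1) cabs (a k) * expR (n%:R * cabs z))).
  apply: ler_sum => k _; rewrite cabsM; apply: ler_wpM2l; first exact: cabs_ge0.
  apply: le_trans (besselJ_bound _ _) _; rewrite ler_expR cabsM cabs_nat.
  by rewrite ler_wpM2r ?cabs_ge0// ler_nat -ltnS.
by rewrite -mulr_suml ler_wpM2r ?expR_ge0// lerDl.
Qed.

Lemma finite_bound (n : nat) (P : nat -> R -> Prop) :
  (forall k, (k < n)%N -> exists Y, forall y, Y <= y -> P k y) ->
  exists Y, forall y, Y <= y -> forall k, (k < n)%N -> P k y.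
Proof.
elim: n => [|n IH] h; first by exists 0.
have [|Y1 h1] := IH; first by move=> k kn; apply: h; exact: ltnW.
have [Y2 h2] := h n (ltnSn n).
exists (Num.max Y1 Y2) => y; rewrite ge_max => /andP[y1 y2] k.
by rewrite ltnS leq_eqVlt => /orP[/eqP ->|]; [exact: h2|exact: h1].
Qed.

Lemma kapteyn_right_bound a n : exists2 B, 0 < B & exists2 K, 0 < K &
  forall z, 1 <= complex.Re z ->
    cabs (kapteyn_section a n z) <= B * expR (K * `|complex.Im z|).
Proof.
have H k : exists BK : R * R, [/\ 0 < BK.1, 0 < BK.2 & forall z, 1 <= complex.Re z ->
    cabs (besselJ k (k%:R * z)) <= BK.1 * expR (BK.2 * `|complex.Im z|)].
  case: k => [|k].
    exists (1, 1); split => // z _; rewrite mul0r besselJ00 cabs1 !mul1r.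
    by rewrite -[X in X <= _](@expR0 R) ler_expR.
  have [B B0 [K K0 h]] := @bessel_right_bound R k.+1.
  exists (B, K * k.+1%:R); split => //=; first by rewrite mulr_gt0.
  have ReIm z : complex.Re (k.+1%:R * z) = k.+1%:R * complex.Re z /\
      complex.Im (k.+1%:R * z) = k.+1%:R * complex.Im z.
    by rewrite -(rmorph_nat (real_complex R)); case: z => p q /=; split; ring.
  move=> z z1; have [e1 e2] := ReIm z; apply: le_trans (h _ _) _.
    rewrite e1 -[X in X <= _]mulr1; apply: ler_pM => //; by rewrite ler1n.
  by rewrite e2 normrM ger0_norm// mulrA.
have /choice [BK hBK] := H.
elim: n => [|n [B B0 [K K0 IH]]].
  exists (cabs (a 0%N) + 1); first by have := cabs_ge0 (a 0%N); lra.
  exists 1 => // z _; rewrite kapteyn0 mul1r.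
  apply: (@le_trans _ _ ((cabs (a 0%N) + 1) * 1)); first by lra.
  apply: ler_wpM2l; first by have := cabs_ge0 (a 0%N); lra.
  by rewrite -[X in X <= _](@expR0 R) ler_expR.
have [b1 b2 h] := hBK n.+1.
exists (B + cabs (a n.+1) * (BK n.+1).1).
  by rewrite ltr_wpDr// mulr_ge0 ?cabs_ge0// ltW.
exists (K + (BK n.+1).2); first by lra.
move=> z z1; rewrite kapteynE big_ord_recr -kapteynE.
apply: le_trans (cabsD _ _) _; rewrite mulrDl; apply: lerD.
  apply: le_trans (IH z z1) _; rewrite ler_pM2l// ler_expR ler_wpM2r//.
  by rewrite lerDl ltW.
rewrite cabsM -mulrA; apply: ler_wpM2l; first exact: cabs_ge0.
apply: le_trans (h z z1) _; rewrite ler_pM2l// ler_expR ler_wpM2r//.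
by rewrite lerDr ltW.
Qed.

Lemma msqrtM x y : 0 < x -> 0 < y -> msqrt (x * y) = msqrt x * msqrt y.
Proof. by move=> x0 y0; rewrite /msqrt lnM ?posrE// mulrDl expRD. Qed.

Lemma msqrt_le_exp y : 0 < y -> msqrt y <= expR (y / 2).
Proof.
move=> y0; rewrite ler_expR ler_pM2r//.
exact/ltW/ln_sublinear.
Qed.

Lemma hsqrtM x y t : 0 < t -> 0 < y -> hsqrt (t * y) (t * x) = (msqrt t)%:C * hsqrt y x.
Proof.
move=> t0 y0; rewrite /hsqrt mulrA -rmorphM /msqrt -expRD.
have -> : t * x / (t * y) = x / y by field; rewrite gt_eqF ?y0// gt_eqF.
congr ((expR _)%:C * _).
have -> : (t * x) ^+ 2 + (t * y) ^+ 2 = t ^+ 2 * (x ^+ 2 + y ^+ 2) by ring.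
have xy : 0 < x ^+ 2 + y ^+ 2 by rewrite ltr_wpDl ?sqr_ge0 ?exprn_gt0.
by rewrite lnM ?posrE ?exprn_gt0// lnXn// mulr2n; field.
Qed.

Lemma cabs_hsqrt_le (c x y : R) : 0 <= c -> 0 < y -> 0 <= x <= c * y ->
  cabs (hsqrt y x) <= msqrt ((1 + c) * y).
Proof.
move=> c0 y0 /andP[x0 xc].
have cy : 0 < (1 + c) * y by rewrite mulr_gt0//; lra.
have xy : 0 < x ^+ 2 + y ^+ 2 by rewrite ltr_wpDl ?sqr_ge0 ?exprn_gt0.
rewrite /hsqrt cabsM cabs_expi mulr1 cabs_real ger0_norm ?expR_ge0//.
rewrite ler_expR; apply: (@le_trans _ _ (ln (((1 + c) * y) ^+ 2) / 4)).
  rewrite ler_pM2r// ler_ln ?posrE ?exprn_gt0//.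
  have : 0 <= c * y * y by rewrite !mulr_ge0// ltW.
  have : x ^+ 2 <= (c * y) ^+ 2 by rewrite lerXn2r// nnegrE// mulr_ge0// ltW.
  nra.
by rewrite lnXn// mulr2n le_eqVlt; apply/orP; left; apply/eqP; field.
Qed.

End KapteynSection.

(** * Dominance of the last term *)

Section Dominance.
Variable R : realType.
Local Notation C := R[i].
Implicit Types (x y t : R) (a : nat -> C) (z : C).

Lemma cabs_iX k : cabs ('i%C ^+ k : C) = 1.
Proof. by rewrite cabsX /= expr0n expr1n add0r sqrtr1 expr1n. Qed.

Lemma natC_mul k x y : k%:R * (x +i* y) = (k%:R * x) +i* (k%:R * y) :> C.
Proof. rewrite -(rmorph_nat (real_complex R)); complex_ext; ring. Qed.

(** Half powers of [y] cost at most [expR (y / 2)]. As [k <= n - 1], a second factor [expR (y / 2)]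
    is spare and absorbs the constant [Q]. *)
Lemma low_term (n k : nat) (c eta : R) : (k < n)%N -> 0 < c -> 0 < eta ->
  exists Y, forall y, Y <= y -> forall x, 0 <= x <= c * y ->
    cabs (hsqrt y x * besselJ k (k%:R * (x +i* y))) <= eta * expR (n%:R * y).
Proof.
move=> kn c0 eta0.
(* [Q] serves both cases: 2 for [k >= 1], from [bessel_upper] with relative error 1, and
   [msqrt (1 + c)] for [k = 0], where only [hsqrt] is left. *)
pose Q : R := 2 + msqrt (1 + c).
have Q2 : 2 <= Q by rewrite /Q lerDl expR_ge0.
have [Y1 hY1] := exp_decay Q eta0.
suff [Y0 hY0] : exists Y0, forall y, Y0 <= y -> 0 < y -> forall x, 0 <= x <= c * y ->
    cabs (hsqrt y x * besselJ k (k%:R * (x +i* y))) <= Q * expR (y / 2 + k%:R * y).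
  exists (Num.max 1 (Num.max Y0 (2 * Y1))) => y; rewrite !ge_max => /and3P[y1 y0 y2] x hx.
  have yp : 0 < y by lra.
  apply: le_trans (hY0 y y0 yp x hx) _.
  have h := hY1 (y / 2) ltac:(lra).
  have kn1 : (k%:R : R) <= n%:R - 1 by rewrite lerBrDr natr1 ler_nat.
  have -> : n%:R * y = y / 2 + (y / 2 + (n%:R - 1) * y) by field.
  apply: (@le_trans _ _ (Q * expR (y / 2 + (n%:R - 1) * y))).
    rewrite ler_pM2l; last by lra.
    by rewrite ler_expR lerD2l ler_wpM2r// ltW.
  rewrite [X in _ <= _ * X]expRD mulrA ler_wpM2r ?expR_ge0//.
  by rewrite -ler_pdivrMr ?expR_gt0// -expRN.
case: k kn => [|k] kn.
  exists 0 => y _ y0 x hx; rewrite mul0r besselJ00 mulr1 mul0r addr0.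
  apply: le_trans (cabs_hsqrt_le (ltW c0) y0 hx) _.
  rewrite msqrtM//; last by lra.
  apply: ler_pM; rewrite ?expR_ge0//; last exact: msqrt_le_exp.
  by rewrite /Q lerDr.
have [Y0 Y01 h] := bessel_upper (ltn0Sn k) c0 (ltr01).
exists Y0 => y hy y0 x hx; set K : R := k.+1%:R.
have K1 : 1 <= K by rewrite /K ler1n.
have K0 : 0 < K by lra.
have Ky : Y0 <= K * y by apply: (le_trans hy); rewrite ler_peMl// ltW.
have Kx : 0 <= K * x <= c * (K * y).
  move: hx => /andP[x0 xc]; rewrite mulr_ge0 ?(ltW K0)//= mulrCA.
  by rewrite ler_pM2l.
have := h _ _ Ky Kx; rewrite mul1r natC_mul -/K hsqrtM//.
set S := hsqrt y x; set j := besselJ _ _; set g := gI _ _ => h1.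
have g0 : 0 < g by apply: gI_gt0; rewrite mulr_gt0.
have h2 : cabs ((msqrt K)%:C * S * j) <= 2 * g.
  have := cabsD ((msqrt K)%:C * S * j * expi (K * x) - 'i%C ^+ k.+1 * g%:C) ('i%C ^+ k.+1 * g%:C).
  rewrite subrK (cabsM _ (expi _)) cabs_expi mulr1.
  rewrite (cabsM ('i%C ^+ _)) cabs_iX mul1r.
  rewrite (cabs_real g) gtr0_norm//; lra.
have gle : g <= msqrt K * (expR (y / 2) * expR (K * y)).
  rewrite /g gIE msqrtM// -mulrA ler_pM2l ?expR_gt0//.
  apply: ler_pM; rewrite ?expR_ge0 ?msqrt_le_exp//.
    by apply/ltW/besselI_gt0; rewrite mulr_gt0.
  by apply: besselI_le_exp; rewrite mulr_ge0// ltW.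
have mK : 0 < msqrt K by exact: expR_gt0.
rewrite -mulrA cabsM cabs_real gtr0_norm// in h2.
rewrite expRD -(ler_pM2l mK); apply: le_trans h2 _.
have E0 : 0 <= msqrt K * (expR (y / 2) * expR (K * y)) by rewrite !mulr_ge0 ?expR_ge0.
rewrite mulrCA; apply: (@le_trans _ _ (2 * (msqrt K * (expR (y / 2) * expR (K * y))))).
  by rewrite ler_pM2l.
by rewrite ler_wpM2r.
Qed.

(** [al] is half of an angle below [pi / 2], so [cos (al *+ 2)] is non-negative and division by
    [hsqrt] cannot lead out of the half-plane. *)
Lemma hsqrt_polar x y : 0 < y -> 0 <= x ->
  exists2 s : R, 0 < s & exists2 al : R, 1 / 2 <= cos al &
    hsqrt y x = s%:C * expi (- al) /\ cabs (hsqrt y x) = s.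
Proof.
move=> y0 x0; exists (expR (ln (x ^+ 2 + y ^+ 2) / 4)); first exact: expR_gt0.
exists (atan (x / y) / 2); last first.
  by split=> //; rewrite cabsM cabs_expi mulr1 cabs_real ger0_norm// expR_ge0.
set al := atan _ / 2.
have := atan_ltpi2 (x / y); have := atan_gtNpi2 (x / y) => h1 h2.
have c1 : 0 <= cos al.
  by apply: cos_ge0_pihalf; rewrite /al; have := pi_gt0 R; move=> ?; apply/andP; split; lra.
have c2 : 0 <= cos (al *+ 2).
  apply: cos_ge0_pihalf; have -> : al *+ 2 = atan (x / y) by rewrite /al; field.
  by apply/andP; split; lra.
rewrite cos_mulr2n in c2; nra.
Qed.

(** With [S = hsqrt y x], the normalized [S * q] lies within [G / 4] of [G > 0]: one eighth is
    allowed for the lower terms, one eighth for the last. Undoing the angle of [S] leaves a real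
    part of at least [G / 2 - G / 4], up to a positive factor. *)
Lemma section_dominant a n (c : R) : (0 < n)%N -> a n != 0 -> 0 < c ->
  exists2 Y, 1 <= Y & exists2 m : R, 0 < m & exists b : C, forall x y, Y <= y ->
    0 <= x <= c * y ->
    0 < complex.Re (b * kapteyn_section a n (x +i* y) * expi (n%:R * x)) /\
    m <= cabs (kapteyn_section a n (x +i* y)).
Proof.
move=> n0 an c0.
set A := cabs (a n); have A0 : 0 < A by rewrite cabs_gt0.
set N : R := n%:R; have N1 : 1 <= N by rewrite /N ler1n.
have N0 : 0 < N by lra.
have [b b0 [Y1 Y11 hY1]] := gI_lower R n0.
have e8 : 0 < 1 / 8 :> R by lra.
have [Y2 Y21 hY2] := bessel_upper n0 c0 e8.
have mN : 0 < msqrt N by exact: expR_gt0.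
(* An [N]-th share of the budget [A * G / 8]; the summand 1 guards against vanishing
   coefficients. *)
pose eta k := A * (b / msqrt N) / (8 * N * (cabs (a k) + 1)).
have eta0 k : 0 < eta k.
  by rewrite /eta !(divr_gt0, mulr_gt0)//; have := cabs_ge0 (a k); lra.
have [Y3 hY3] := @finite_bound R n (fun k y => forall x, 0 <= x <= c * y ->
    cabs (hsqrt y x * besselJ k (k%:R * (x +i* y))) <= eta k * expR (N * y))
  (fun k kn => low_term kn c0 (eta0 k)).
pose Y := Num.max Y1 (Num.max Y2 Y3).
exists Y; first by rewrite /Y le_max Y11.
exists (A * (b / (msqrt N * (1 + c))) / 4).
  by rewrite !(divr_gt0, mulr_gt0)//; lra.
exists ((a n * 'i%C ^+ n)^-1) => x y hy hx.
move: hy; rewrite /Y !ge_max => /and3P[y1 y2 y3].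
have yp : 0 < y by lra.
have x0 : 0 <= x by case/andP: hx.
have Ny : y <= N * y by rewrite ler_peMl// ltW.
set f := kapteyn_section a n (x +i* y); set S := hsqrt y x.
set G := gI n (N * y) / msqrt N.
have g0 : 0 < gI n (N * y) by apply: gI_gt0; rewrite mulr_gt0.
have G0 : 0 < G by rewrite divr_gt0.
have Gb : b / msqrt N * expR (N * y) <= G.
  by rewrite /G mulrAC ler_pM2r ?invr_gt0//; apply: hY1; lra.
have cin : cabs ('i%C ^+ n : C) = 1 by exact: cabs_iX.
have an0 : a n * 'i%C ^+ n != 0.
  by rewrite -cabs_gt0 cabsM cin mulr1.
pose E := expi (N * x).
pose low := \sum_(k < n) a k * besselJ k (k%:R * (x +i* y)).
have fE : f = low + a n * besselJ n (n%:R * (x +i* y)).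
  by rewrite /f kapteynE big_ord_recr.
have lowb : cabs (S * low) <= A * G / 8.
  rewrite /low mulr_sumr; apply: le_trans (cabs_sum _ _ _) _.
  apply: (@le_trans _ _ (\sum_(k < n) A * G / (8 * N))).
    apply: ler_sum => k _; rewrite mulrCA cabsM.
    apply: (@le_trans _ _ (cabs (a k) * (eta k * expR (N * y)))).
      by apply: ler_wpM2l; [exact: cabs_ge0|exact: hY3].
    have ak : 0 < cabs (a k) + 1 by have := cabs_ge0 (a k); lra.
    have -> : cabs (a k) * (eta k * expR (N * y)) =
        A / (8 * N) * (b / msqrt N * expR (N * y)) * (cabs (a k) / (cabs (a k) + 1)).
      by rewrite /eta; field; rewrite !gt_eqF.
    have -> : A * G / (8 * N) = A / (8 * N) * G * 1 by field; rewrite gt_eqF.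
    have q0 : 0 <= A / (8 * N) by rewrite divr_ge0 ?mulr_ge0// ltW.
    apply: ler_pM.
    - by rewrite !mulr_ge0 ?expR_ge0 ?invr_ge0 ?mulr_ge0 ?(ltW A0) ?(ltW b0) ?(ltW mN) ?(ltW N0).
    - by rewrite divr_ge0 ?cabs_ge0// ltW.
    - by rewrite ler_wpM2l.
    - by rewrite ler_pdivrMr// mul1r lerDl.
  rewrite sumr_const card_ord -mulr_natr -/N le_eqVlt; apply/orP; left; apply/eqP.
  by field; rewrite gt_eqF.
have topb : cabs (S * besselJ n (n%:R * (x +i* y)) * E - 'i%C ^+ n * G%:C) <= G / 8.
  have hx' : 0 <= N * x <= c * (N * y).
    by case/andP: hx => _ xc; rewrite mulr_ge0 ?(ltW N0)//= mulrCA ler_pM2l.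
  have := hY2 _ _ (le_trans y2 Ny) hx'; rewrite -natC_mul hsqrtM// -/S -/E.
  set j := besselJ _ _ => h.
  rewrite -(ler_pM2l mN) -{1}(gtr0_norm mN) -cabs_real -cabsM.
  have -> : (msqrt N)%:C * (S * j * E - 'i%C ^+ n * G%:C) =
     (msqrt N)%:C * S * j * E - 'i%C ^+ n * (gI n (N * y))%:C.
    have -> : gI n (N * y) = msqrt N * G by rewrite /G mulrCA divff ?mulr1// gt_eqF.
    rewrite (rmorphM (real_complex R) (msqrt N) G) /=. ring.
  apply: le_trans h _; rewrite /G le_eqVlt; apply/orP; left; apply/eqP.
  by field; rewrite gt_eqF.
pose q := (a n * 'i%C ^+ n)^-1 * f * E.
have Sq : cabs (S * q - G%:C) <= G / 4.
  have -> : S * q - G%:C = (a n * 'i%C ^+ n)^-1 * ((S * low) * E +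
      a n * (S * besselJ n (n%:R * (x +i* y)) * E - 'i%C ^+ n * G%:C)).
    rewrite /q fE; set j := besselJ _ _; field.
    by move: an0; rewrite mulf_eq0 negb_or andbC.
  rewrite cabsM cabsV cabsM cin mulr1 -/A mulrC ler_pdivrMr//.
  apply: le_trans (cabsD _ _) _.
  rewrite (cabsM _ E) cabs_expi mulr1 (cabsM (a n)) -/A.
  have : A * cabs (S * besselJ n (n%:R * (x +i* y)) * E - 'i%C ^+ n * G%:C) <= A * (G / 8).
    by rewrite ler_pM2l.
  move: lowb; set u := cabs _; set v := A * cabs _; lra.
have [s s0 [al cal [SE Sabs]]] := hsqrt_polar yp x0.
rewrite -/S in SE Sabs.
have qE : q = (s^-1)%:C * (expi al * (S * q)).
  have sC : s%:C != 0 by rewrite -cabs_gt0 cabs_real gtr0_norm.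
  rewrite SE expiN (fmorphV (real_complex R)) /=; field.
  by rewrite expi_neq0 sC.
split.
  rewrite -/E -/q qE.
  have -> : expi al * (S * q) = G%:C * expi al + expi al * (S * q - G%:C) by ring.
  have ReE (r : R) (w : C) : complex.Re (r%:C * w) = r * complex.Re w.
    by rewrite ReM /= mul0r subr0.
  rewrite ReE pmulr_rgt0 ?invr_gt0// ReD ReE /=.
  have : cabs (expi al * (S * q - G%:C)) <= G / 4 by rewrite cabsM cabs_expi mul1r.
  have := Re_le_cabs (expi al * (S * q - G%:C)); rewrite ler_norml.
  set r := complex.Re _; set ca := cabs _ => /andP[h1 _] h2.
  have : G * (1 / 2) <= G * cos al by rewrite ler_pM2l.
  lra.
have qlow : G * (3 / 4) <= s * cabs q.
  have := cabs_lub G%:C (G%:C - S * q); rewrite (_ : G%:C - (G%:C - S * q) = S * q); last by ring.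
  rewrite (cabs_distC G%:C) cabs_real gtr0_norm// cabsM Sabs.
  lra.
have fq : cabs f = A * cabs q.
  rewrite /q !cabsM cabsV cabsM cin mulr1 -/A cabs_expi mulr1 mulrA divff ?mul1r//.
  by rewrite gt_eqF.
(* The square root is replaced by its square, which is larger here; the lower bound for [G] is still
   linear in [y], so the quotient stays above a constant. *)
have sb : s <= (1 + c) * y.
  rewrite -Sabs; apply: le_trans (cabs_hsqrt_le (ltW c0) yp hx) _.
  have cy1 : 1 <= (1 + c) * y by nra.
  have m1 : 1 <= msqrt ((1 + c) * y).
    rewrite /msqrt -[X in X <= _]expR0 ler_expR divr_ge0//.
    by rewrite ln_ge0.
  rewrite -[X in _ <= X]sqr_msqrt; last by lra.
  by rewrite expr2 ler_peMl// expR_ge0.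
have Gy : b / msqrt N * y <= G.
  apply: le_trans Gb; rewrite ler_pM2l ?divr_gt0//.
  by have := expR_ge1Dx (N * y); lra.
have s1 : s * (b / (msqrt N * (1 + c))) <= b / msqrt N * y.
  have -> : b / msqrt N * y = ((1 + c) * y) * (b / (msqrt N * (1 + c))).
    by field; rewrite !gt_eqF//; lra.
  by rewrite ler_wpM2r// divr_ge0 ?mulr_ge0 ?(ltW b0) ?(ltW mN)//; lra.
rewrite fq -mulrA ler_pM2l//.
rewrite -(ler_pM2l s0); apply: le_trans (le_trans _ qlow).
  exact: lexx.
move: s1 Gy; set u := b / (msqrt N * (1 + c)); set w := b / msqrt N * y; lra.
Qed.

End Dominance.

(** * Counting zeros in a rectangle *)

Section RectCount.
Variable R : realType.
Local Notation C := R[i].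
Implicit Types (x y t : R) (a : nat -> C) (z w : C) (s : seq C).

Lemma near1_mul_Re w z : near1 w -> near1 z -> 0 < complex.Re (w * z).
Proof.
case: w z => [p q] [u v]; rewrite /near1 /= => h1 h2.
have : `|q * v| < p * u by rewrite normrM; apply: ltr_pM.
by rewrite ltr_norml => /andP[_ h]; lra.
Qed.

Lemma cabs_expi_sub1 t : cabs (expi t - 1) <= `|t|.
Proof.
have H (u : R) : 0 <= u -> cabs (expi u - 1) <= u.
  move=> u0; have := @cder_mean R (@expi R) (fun t => 'i%C * 1%:C * expi t) 1 0 u u0.
  rewrite expi0 subr0 mul1r; apply => x _.
    exact: (@cder_expi R (fun t => t) x 1 (rd_id x)).
  by rewrite !cabsM cabs_expi cabs_real normr1 /= expr0n expr1n add0r sqrtr1 !mulr1.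
case: (lerP 0 t) => t0; first by rewrite ger0_norm//; exact: H.
have -> : expi t - 1 = - (expi t * (expi (- t) - 1)).
  by rewrite mulrBr -expiD subrr expi0 mulr1 opprB.
by rewrite cabsN cabsM cabs_expi mul1r ltr0_norm//; apply: H; lra.
Qed.

Lemma near1_expi t : `|t| <= 1 / 4 -> near1 (expi t).
Proof. by move=> h; apply: near1_close; apply: le_trans (cabs_expi_sub1 t) h. Qed.

Lemma arg_expi t : `|t| <= 1 / 4 -> arg (expi t) = t.
Proof.
move=> h; have := @arg_unique R 1 t ltr01; rewrite mul1r; apply.
by apply: le_lt_trans h _; have := pihalf_ge1 R; lra.
Qed.

(** The product of [f] with [expi (nn * x)] keeps to a half-plane and turns by at most [pi], while
    the exponential turns by exactly [nn * (x1 - x0)]. *)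
Lemma side_top (f : C -> C^o) (b : C) (nn x0 x1 y : R) : x0 <= x1 -> 0 <= nn ->
  (forall x, x0 <= x <= x1 -> 0 < complex.Re (b * f (x +i* y) * expi (nn * x))) ->
  exists N0, forall N, (N0 <= N)%N -> segfine f (x0 +i* y) (x1 +i* y) N ->
    `|segturn f (x0 +i* y) (x1 +i* y) N + nn * (x1 - x0)| <= pi.
Proof.
move=> x01 nn0 hb.
exists (Num.truncn (4 * (nn * (x1 - x0)))).+1 => N hN hf.
have L0 : 0 <= nn * (x1 - x0) by rewrite mulr_ge0// subr_ge0.
have N0 : 0 < N%:R :> R by rewrite ltr0n; lia.
pose st := nn * (x1 - x0) / N%:R.
have st0 : 0 <= st by rewrite divr_ge0.
have st1 : `|st| <= 1 / 4.
  rewrite ger0_norm// ler_pdivrMr//.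
  have : 4 * (nn * (x1 - x0)) <= N%:R.
    by apply/ltW/(lt_le_trans (truncnS_gt _)); rewrite ler_nat.
  lra.
pose X i : R := x0 + i%:R / N%:R * (x1 - x0).
have ptX i : pt (x0 +i* y) (x1 +i* y) N i = X i +i* y.
  by rewrite ptE /= subrr mulr0 addr0.
pose E i : C := expi (nn * X i).
have Est i : E i.+1 / E i = expi st.
  rewrite /E -expiN -expiD; congr expi; rewrite /X -natr1 /st; field.
  by rewrite gt_eqF.
have tE : turn E N = nn * (x1 - x0).
  rewrite /turn; under eq_bigr do rewrite Est arg_expi//.
  by rewrite sumr_const card_ord -mulr_natr /st divfK// gt_eqF.
pose u i := f (pt (x0 +i* y) (x1 +i* y) N i).
have fE i : (i < N)%N -> near1 (E i.+1 / E i) by move=> _; rewrite Est; exact: near1_expi.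
have -> : segturn f (x0 +i* y) (x1 +i* y) N + nn * (x1 - x0) = turn (fun i => u i * E i) N.
  by rewrite turnM// tE.
apply: (@turn_half_bound _ b).
  move=> i hi; rewrite mulrA /u ptX; apply: hb.
  by apply: interp_itv => //; rewrite lexx x01.
move=> i hi; rewrite -mulf_div; apply: near1_mul_Re; [exact: hf|exact: fE].
Qed.

Lemma arg_conj w : arg (w^*)%C = - arg w.
Proof. by case: w => p q; rewrite /arg /= mulNr atanN. Qed.

Lemma segturn_conj (f g : C -> C^o) z w n : (forall u, f (u^*)%C = ((g u)^*)%C) ->
  segturn f (z^*)%C (w^*)%C n = - segturn g z w n.
Proof.
move=> h; have ptc i : pt (z^*)%C (w^*)%C n i = ((pt z w n i)^*)%C.
  by case: z w => [z1 z2] [w1 w2]; rewrite !ptE /=; complex_ext; ring.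
rewrite /segturn /turn -sumrN; apply: eq_bigr => i _.
by rewrite !ptc !h -arg_conj (rmorphM (@conjc R)) fmorphV.
Qed.

Lemma segfine_conj (f g : C -> C^o) z w n : (forall u, f (u^*)%C = ((g u)^*)%C) ->
  segfine f (z^*)%C (w^*)%C n -> segfine g z w n.
Proof.
move=> h; have ptc i : pt (z^*)%C (w^*)%C n i = ((pt z w n i)^*)%C.
  by case: z w => [z1 z2] [w1 w2]; rewrite !ptE /=; complex_ext; ring.
move=> hf i hi; have := hf i hi; rewrite !ptc !h.
rewrite -(fmorphV (@conjc R)) -(rmorphM (@conjc R)) /near1.
by case: (_ / _) => p q /=; rewrite normrN.
Qed.

(* The number of zeros produced by Jensen's inequality, from [2 ^ m <= B e^E / m0]. *)
Lemma jensen_log (m : nat) (v B m0 E : R) : 0 < B -> 0 < m0 -> m0 <= v ->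
  v * 2 ^+ m <= B * expR E -> m%:R <= (ln (B / m0) + E) / ln 2.
Proof.
move=> B0 m00 mv h.
have l2 : 0 < ln 2 :> R by rewrite ln_gt0// ltr1n.
rewrite ler_pdivlMr// mulrC mulr_natr -lnXn//.
rewrite -[X in _ <= _ + X](@expRK R) -lnM ?posrE ?expR_gt0 ?divr_gt0//.
rewrite ler_ln ?posrE ?exprn_gt0 ?mulr_gt0 ?expR_gt0 ?divr_gt0//.
rewrite mulrAC ler_pdivlMr// mulrC; apply: le_trans h.
by rewrite ler_pM2r// exprn_gt0.
by rewrite invr_gt0.
Qed.

Lemma kapteyn_dominant a n (c : R) : (0 < n)%N -> a n != 0 -> 0 < c ->
  exists2 Y, 1 <= Y & exists2 m : R, 0 < m & exists b b' : C, forall x y, Y <= y ->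
    0 <= x <= c * y ->
    [/\ 0 < complex.Re (b * kapteyn_section a n (x +i* y) * expi (n%:R * x)),
     0 < complex.Re (b' * kapteyn_section (fun k => ((a k)^*)%C) n (x +i* y) * expi (n%:R * x)),
     m <= cabs (kapteyn_section a n (x +i* y)) &
     m <= cabs (kapteyn_section a n (x +i* - y))].
Proof.
move=> n0 an c0.
have [Y Y1 [m m0 [b H]]] := section_dominant n0 an c0.
have an' : ((a n)^*)%C != 0 by rewrite conjc_eq0.
have [Y' Y1' [m' m0' [b' H']]] :=
  @section_dominant R (fun k => ((a k)^*)%C) n c n0 an' c0.
exists (Num.max Y Y'); first by rewrite le_max Y1.
exists (Num.min m m'); first by rewrite lt_min m0 m0'.
exists b, b' => x y; rewrite ge_max => /andP[hy hy'] hx.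
have [h1 h2] := H x y hy hx; have [h3 h4] := H' x y hy' hx.
split; [exact: h1|exact: h3| |].
  by apply: le_trans h2; rewrite ge_min lexx.
rewrite -[x +i* - y]/((x +i* y)^*)%C kapteyn_conj cabsJ.
by apply: le_trans h4; rewrite ge_min lexx orbT.
Qed.

Lemma common_bound4 (n1 n2 n3 n4 : nat) : exists N,
  [/\ (0 < N)%N, (n1 <= N)%N, (n2 <= N)%N, (n3 <= N)%N & (n4 <= N)%N].
Proof. by exists (n1 + n2 + n3 + n4).+1; split; lia. Qed.

Definition inside (x0 x1 H : R) : pred C :=
  fun z => (x0 < complex.Re z < x1) && (- H < complex.Im z < H).

(** [D] precedes [c], on which only [Y] and [B] depend; a later choice of [c] can thus make [D * H]
    a small fraction of [x1]. *)
Lemma rect_count a n : (0 < n)%N -> a n != 0 ->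
  exists2 D : R, 0 <= D & forall c : R, 0 < c -> exists2 Y, 1 <= Y & exists B : R,
  forall (x0 x1 H rho : R) s (g : C -> C^o), 0 < x0 < 1 -> Y <= H -> x1 <= c * H ->
    1 + 6 * H <= x1 -> entire g -> (forall z, kapteyn_section a n z = linfac s z * g z) ->
    (forall z, cabs z <= rho -> g z != 0) -> x1 + H <= rho ->
    x0 \notin map (@complex.Re R) s -> x1 \notin map (@complex.Re R) s ->
    `|pi * (count (inside x0 x1 H) s)%:R - n%:R * x1| <= B + D * H.
Proof.
move=> n0 an.
have [B1 B10 hB1] := kapteyn_bound a n.
have [B2 B20 [K K0 hB2]] := kapteyn_right_bound a n.
have l2 : 0 < ln 2 :> R by rewrite ln_gt0// ltr1n.
have p0 := pi_gt0 R.
set f := kapteyn_section a n.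
have nn0 : 0 <= (n%:R : R) by [].
(* A side turns by 4 pi per Jensen zero, halved on dividing the boundary turning by 2. The factor 7
   bounds heights on the circle of radius [6 * H] about a point of height [H]. *)
exists (pi *+ 2 * (7 * K / ln 2) + pi *+ 2 * (7 * n%:R / ln 2)).
  have h (q : R) : 0 <= q -> 0 <= pi *+ 2 * (q / ln 2).
    by move=> q0; apply: mulr_ge0; [rewrite mulrn_wge0// ltW|apply: divr_ge0 => //; exact: ltW].
  by apply: addr_ge0; apply: h; apply: mulr_ge0 => //; exact: ltW.
move=> c c0.
have [Y Y1 [m0 m00 [b [b' dom]]]] := kapteyn_dominant n0 an c0.
exists Y => //.
exists (pi *+ 2 + pi *+ 2 * (ln (B2 / m0) / ln 2) + pi *+ 2 * ((ln (B1 / m0) + n%:R) / ln 2) + n%:R).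
move=> x0 x1 H rho s g /andP[x00 x01] YH x1c x1H eg hf g0 rhoK nx0 nx1.
have H0 : 0 < H by lra.
have hx01 : x0 <= x1 by lra.
have hH : - H <= H by lra.
have ef : entire f by exact: entire_kapteyn.
have fzero z : f z = 0 -> cabs z <= rho -> z \in s.
  move=> fz zr; have := hf z; rewrite -/f fz => /esym/eqP.
  by rewrite mulf_eq0 (negPf (g0 _ zr)) orbF linfac_eq0.
have rectrho z : rect x0 x1 (- H) H z -> cabs z <= rho.
  move=> /andP[/andP[r1 r2] /andP[r3 r4]]; apply: le_trans (cabs_le_ReIm z) _.
  apply: le_trans rhoK; apply: lerD; rewrite ler_norml; apply/andP; split; lra.
have domx x : x0 <= x <= x1 -> 0 <= x <= c * H.
  by move=> /andP[? ?]; apply/andP; split; lra.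
(* Vertical sides avoid the zeros by the choice of [x0] and [x1], horizontal sides by dominance. *)
have fb z : bdry x0 x1 (- H) H z -> f z != 0.
  move=> /andP[hz hb]; have [hzr _] := andP hz; apply/negP => /eqP fz.
  have zs := fzero z fz (rectrho z hz).
  case/or4P: hb => /eqP e.
  - by move: nx0; rewrite -e map_f.
  - by move: nx1; rewrite -e map_f.
  - have [_ _ _] := dom (complex.Re z) H YH (domx _ hzr).
    have -> : complex.Re z +i* - H = z by case: (z) e => p q /= ->.
    by rewrite -/f fz cabs0 leNgt m00.
  - have [_ _ + _] := dom (complex.Re z) H YH (domx _ hzr).
    have -> : complex.Re z +i* H = z by case: (z) e => p q /= ->.
    by rewrite -/f fz cabs0 leNgt m00.
pose s1 := seq.filter (inside x0 x1 H) s.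
pose g1 : C -> C^o := fun z => linfac (seq.filter (predC (inside x0 x1 H)) s) z * g z.
have eg1 : entire g1 by exact: entireM (entire_linfac _) eg.
have g10 z : rect x0 x1 (- H) H z -> g1 z != 0.
  move=> hz; rewrite /g1 mulf_neq0 ?g0 ?rectrho//.
  rewrite linfac_eq0; apply/negP; rewrite mem_filter => /andP[nin zs].
  have fz : f z = 0 by rewrite hf; apply/eqP; rewrite mulf_eq0 linfac_eq0 zs.
  have : ~~ bdry x0 x1 (- H) H z by apply/negP => /fb; rewrite fz eqxx.
  rewrite /bdry hz /= !negb_or => /and4P[n1 n2 n3 n4].
  move: nin; rewrite /= /inside => /negP; apply.
  move: hz; rewrite /rect => /andP[/andP[r1 r2] /andP[r3 r4]].
  by rewrite !lt_neqAle r1 r2 r3 r4 n2 n4 eq_sym n1 eq_sym n3.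
have hs1 (u : C) : u \in s1 -> (x0 < complex.Re u < x1) && (- H < complex.Im u < H).
  by rewrite mem_filter => /andP[].
have hf1 z : f z = linfac s1 z * g1 z.
  by rewrite hf (linfac_filter (inside x0 x1 H)) -mulrA.
have [N1 hN1] := argument_principle hx01 hH eg1 g10 hs1 hf1.
have [N2 hN2] := bfine_ex hx01 hH ef fb.
have [|N3 hN3] := @side_top f b n%:R x0 x1 H hx01 nn0.
  by move=> x hx; have [+ _ _ _] := dom x H YH (domx x hx).
pose f' := kapteyn_section (fun k => ((a k)^*)%C) n.
have [|N4 hN4] := @side_top f' b' n%:R x0 x1 H hx01 nn0.
  by move=> x hx; have [_ + _ _] := dom x H YH (domx x hx).
have [N [hN k1 k2 k3 k4]] := common_bound4 N1 N2 N3 N4.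
have [f1 f2 f3 f4] := hN2 N k2.
have top := hN3 N k3 f3.
have fc : forall u, f (u^*)%C = ((f' u)^*)%C by move=> u; exact: kapteyn_conj.
have f1' : segfine f' (x0 +i* H) (x1 +i* H) N 
  by apply: (@segfine_conj f f' _ _ N fc); exact: f1.
have bot := hN4 N k4 f1'.
have botE : segturn f (x0 +i* - H) (x1 +i* - H) N = - segturn f' (x0 +i* H) (x1 +i* H) N.
  have -> : x0 +i* - H = ((x0 +i* H)^*)%C by [].
  have -> : x1 +i* - H = ((x1 +i* H)^*)%C by [].
  by rewrite (segturn_conj _ _ _ fc).
have side x i : (x == x0) || (x == x1) -> (i <= N)%N ->
    f (pt (x -i* H) (x +i* H) N i) != 0.
  move=> hx hi; apply: fb; apply/andP; split.
    apply: pt_rect => //; rewrite /rect /= ?lexx ?hH ?andbT;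
      by case/orP: hx => /eqP ->; rewrite ?lexx ?hx01.
  rewrite ptE /= subrr mulr0 addr0.
  by case/orP: hx => ->; rewrite ?orbT.
have sR i := side x1 i ltac:(by rewrite eqxx orbT).
have sL i := side x0 i ltac:(by rewrite eqxx).
(* Since [1 + 6 * H <= x1], Jensen's circle stays in the half-plane [Re z >= 1], where the bound by
   the height alone is available. *)
have [|mR hR1 hR2] := @side_turn R f x1 H (B2 * expR (K * (7 * H))) N ef H0 hN sR f2.
  move=> z hz.
  have hz1 : `|complex.Re (z - (x1 +i* H))| <= 6 * H by rewrite -hz; exact: Re_le_cabs.
  have hz2 : `|complex.Im (z - (x1 +i* H))| <= 6 * H by rewrite -hz; exact: Im_le_cabs.
  rewrite ReD ReN ler_norml /= in hz1; rewrite ImD ImN ler_norml /= in hz2.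
  case/andP: hz1 => h1 h2; case/andP: hz2 => h3 h4.
  apply: le_trans (hB2 z _) _; first by move: h1 x1H H0; clear; lra.
  rewrite ler_pM2l// ler_expR ler_pM2l// ler_norml.
  by move: h3 h4 H0; clear => *; apply/andP; split; lra.
(* Near the imaginary axis the circle lies in a disc of radius [1 + 7 * H], so the global
   exponential bound suffices. *)
have [|mL hL1 hL2] := @side_turn R f x0 H (B1 * expR (n%:R * (1 + 7 * H))) N ef H0 hN sL f4.
  move=> z hz; apply: le_trans (hB1 z) _; rewrite ler_pM2l// ler_expR ler_wpM2l//.
  have := cabsD (z - (x0 +i* H)) (x0 +i* H); rewrite subrK hz.
  have := cabs_le_ReIm (x0 +i* H); rewrite [complex.Re _]/= [complex.Im _]/= (gtr0_norm x00) (gtr0_norm H0).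
  move: (cabs z) (cabs (x0 +i* H)) H0 x01 => u v; clear => *; lra.
have [_ _ mR0 _] := dom x1 H YH (domx x1 ltac:(by rewrite lexx hx01)).
have [_ _ mL0 _] := dom x0 H YH (domx x0 ltac:(by rewrite lexx hx01)).
have jR := jensen_log B20 m00 mR0 hR1.
have jL := jensen_log B10 m00 mL0 hL1.
have := hN1 N k1.
rewrite /bturn botE size_filter.
set cnt := count _ s.
move: top bot hR2 hL2 jR jL.
rewrite !(mulrDl _ _ (ln 2)^-1).
move: (segturn f (x0 +i* H) (x1 +i* H) N) (segturn f' (x0 +i* H) (x1 +i* H) N)
  (segturn f (x1 +i* - H) (x1 +i* H) N) (segturn f (x0 +i* - H) (x0 +i* H) N).
move=> Tt Tb Tr Tl.
rewrite -[pi *+ 2 *+ cnt]mulr_natr.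
move: (mR%:R : R) (mL%:R : R) (cnt%:R : R) (ln (B2 / m0) / ln 2) (ln (B1 / m0) / ln 2).
move=> rR rL rC l1 lB.
have -> : K * (7 * H) / ln 2 = 7 * K / ln 2 * H by ring.
have -> : n%:R * (1 + 7 * H) / ln 2 = n%:R / ln 2 + 7 * n%:R / ln 2 * H by ring.
have hn : 0 <= n%:R * x0 <= n%:R.
  by rewrite mulr_ge0 ?(ltW x00)//= ler_piMr// ltW.
have -> : (pi *+ 2 * (7 * K / ln 2) + pi *+ 2 * (7 * n%:R / ln 2)) * H =
  2 * (pi * (7 * K / ln 2 * H)) + 2 * (pi * (7 * n%:R / ln 2 * H)) by ring.
move: (7 * K / ln 2 * H) (7 * n%:R / ln 2 * H) (n%:R / ln 2) => q1 q2 q3.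
move=> h1 h2 h3 h4 h5 h6 h7.
have j1 : pi * rR <= pi * (l1 + q1) by rewrite ler_pM2l.
have j2 : pi * rL <= pi * (lB + (q3 + q2)) by rewrite ler_pM2l.
move: h1 h2 h3 h4 hn; rewrite !ler_norml mulrBr => /andP[h1 h1'] /andP[h2 h2'] /andP[h3 h3'].
move=> /andP[h4 h4'] /andP[h8 h8'].
move: h1 h1' h2 h2' h3 h3' h4 h4' h8 h8' h7 j1 j2.
move: (n%:R * x1) (n%:R * x0) (n%:R : R) => nx nx00 nr.
by clear; move=> *; apply/andP; split; lra.
Qed.

End RectCount.

(** * Zero-free regions and sectors *)

Section ZeroCounts.
Variable R : realType.
Local Notation C := R[i].
Implicit Types (x y t r : R) (a : nat -> C) (z w : C) (s : seq C).

Lemma exists_notin (l : seq R) x y : x < y -> exists2 t, x < t < y & t \notin l.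
Proof.
elim: l x y => [|b l IH] x y xy; first by exists ((x + y) / 2) => //; lra.
have [hb|hb] := leP b ((x + y) / 2).
  have [|t ht tl] := IH ((x + y) / 2) y; first lra.
  by exists t; rewrite ?inE ?negb_or ?tl ?andbT ?gt_eqF//; lra.
have [|t ht tl] := IH x ((x + y) / 2); first lra.
by exists t; rewrite ?inE ?negb_or ?tl ?andbT ?lt_eqF//; lra.
Qed.

Definition disc (rho : R) : pred C := fun z => cabs z <= rho.

(** The bound is uniform over all factorizations of [f], because a new one is taken for each
    radius. *)
Lemma count_disc_bound (f : C -> C^o) c (rho : R) : entire f -> f c != 0 -> 0 < rho ->
  exists N, forall s (g : C -> C^o), entire g -> (forall z, f z = linfac s z * g z) ->
    (count (disc rho) s <= N)%N.
Proof.
move=> ef fc rho0; pose rho' := rho + cabs c.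
have r0 : 0 < rho' by rewrite ltr_pwDl ?cabs_ge0.
have [M M0 hM] := entire_bounded (cabs c + 3 * rho') ef.
have {hM} hM z : cabs (z - c) = 3 * rho' -> cabs (f z) <= M.
  by move=> zr; apply: hM; have := cabsD (z - c) c; rewrite subrK; lra.
have fc0 : 0 < cabs (f c) by rewrite cabs_gt0.
exists (Num.truncn (M / cabs (f c))) => s g eg hf.
have := jensen_count eg r0 hf hM; rewrite mulrC -ler_pdivlMr// => h.
rewrite truncn_ge_nat ?divr_ge0 ?cabs_ge0 ?(ltW M0)//.
apply: le_trans h; rewrite -natrX ler_nat ltnW//.
apply: leq_ltn_trans (ltn_expl _ (ltnSn 1)); apply: sub_count => u /= ur.
by rewrite /disc in ur; have := cabsB u c; rewrite /rho'; lra.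
Qed.

(** Dominance excludes high zeros in the first quadrant; conjugation adds the fourth and
    [kapteyn_opp] the left half-plane. *)
Lemma kapteyn_zero_bound a n (c : R) : (0 < n)%N -> a n != 0 -> 0 < c ->
  exists2 Y, 1 <= Y & forall z, kapteyn_section a n z = 0 ->
    `|complex.Re z| <= c * `|complex.Im z| -> `|complex.Im z| < Y.
Proof.
move=> n0 an c0.
have half b : b n != 0 -> exists2 Y, 1 <= Y & forall x y, kapteyn_section b n (x +i* y) = 0 ->
    0 <= x <= c * `|y| -> `|y| < Y.
  move=> bn; have [Y Y1 [m m0 [b1 [b2 dom]]]] := kapteyn_dominant n0 bn c0.
  exists Y => // x y fz hx; rewrite ltNge; apply/negP => hy.
  have [_ _ h1 h2] := dom x `|y| hy hx.
  have [y0|y0] := leP 0 y.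
    by move: h1; rewrite (ger0_norm y0) fz cabs0 leNgt m0.
  by move: h2; rewrite (ltr0_norm y0) opprK fz cabs0 leNgt m0.
have [Y1 Y11 h1] := half a an.
have [|Y2 _ h2] := half (fun k => (-1) ^+ k * a k).
  by rewrite mulf_neq0// signr_eq0.
exists (Num.max Y1 Y2); first by rewrite le_max Y11.
move=> [x y] fz /= hx; rewrite lt_max.
have [x0|x0] := leP 0 x.
  by rewrite (h1 x y)// x0 -(ger0_norm x0) hx.
have fz' : kapteyn_section (fun k => (-1) ^+ k * a k) n (- x +i* - y) = 0.
  by rewrite -kapteyn_opp -fz; congr kapteyn_section; complex_ext; rewrite opprK.
have := h2 (- x) (- y) fz'; rewrite normrN => ->; first by rewrite orbT.
by rewrite oppr_ge0 (ltW x0) -(ltr0_norm x0) hx.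
Qed.

Lemma kapteyn_neq0 a n : (0 < n)%N -> a n != 0 -> exists z, kapteyn_section a n z != 0.
Proof.
move=> n0 an; have [Y _ h] := kapteyn_zero_bound n0 an ltr01.
exists (0 +i* `|Y|); apply/negP => /eqP /h /=.
by rewrite normr0 mul1r !normr_id normr_ge0 => /(_ isT); rewrite ltNge ler_norm.
Qed.

Lemma kapteyn_factor a n (rho : R) : (0 < n)%N -> a n != 0 ->
  exists s, exists2 g : C -> C^o, entire g &
    (forall z, kapteyn_section a n z = linfac s z * g z) /\
    (forall z, cabs z <= rho -> g z != 0).
Proof.
move=> n0 an; have [c fc] := kapteyn_neq0 n0 an.
have [|s [g eg [hf _ g0]]] := @entire_factor R _ c (`|rho| + cabs c + 1) (entire_kapteyn a n) fc.
  by rewrite ltr_wpDl// addr_ge0// cabs_ge0.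
exists s, g => //; split => // z zr; apply: g0.
by apply: le_trans (cabsB _ _) _; have := ler_norm rho; lra.
Qed.

Lemma kapteyn_count_bound a n (rho : R) : (0 < n)%N -> a n != 0 -> 0 < rho ->
  exists N, forall s (g : C -> C^o), entire g ->
    (forall z, kapteyn_section a n z = linfac s z * g z) ->
    (count (disc rho) s <= N)%N.
Proof.
move=> n0 an rho0; have [c fc] := kapteyn_neq0 n0 an.
exact: count_disc_bound (entire_kapteyn a n) fc rho0.
Qed.

Lemma sectorE r (alpha beta : R) z : sector r alpha beta z <->
  exists rho t : R, [/\ 0 < rho < r, alpha < t < beta & z = rho%:C * expi t].
Proof.
have E (rho t : R) : rho%:C * expi t = (rho * cos t) +i* (rho * sin t).
  by rewrite /expi; simpc.
by split => -[rho [t [h1 h2 ->]]]; exists rho, t; rewrite E.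
Qed.

Lemma sector_lt r (alpha beta : R) z : sector r alpha beta z -> 0 < cabs z < r.
Proof.
move=> /sectorE[rho [t [h _ ->]]]; case/andP: (h) => h0 _.
by rewrite cabsM cabs_expi mulr1 cabs_real gtr0_norm.
Qed.

Lemma sector_Re r (delta : R) z : delta < pi / 2 -> sector r (- delta) delta z ->
  0 < complex.Re z.
Proof.
move=> hd [rho [t [/andP[rho0 _] /andP[t1 t2] ->]]] /=.
by rewrite mulr_gt0// cos_gt0_pihalf//; apply/andP; split; lra.
Qed.

Lemma tan_gt0_pihalf x : 0 < x < pi / 2 -> 0 < tan x.
Proof.
move=> /andP[x0 x1]; have p0 := pi_gt0 R.
by rewrite divr_gt0 ?sin_gt0_pihalf ?cos_gt0_pihalf// ?x0 ?x1 ?andbT//; lra.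
Qed.

Lemma sector_slope r (delta : R) z : 0 < delta < pi / 2 -> 0 < complex.Re z ->
  `|complex.Im z| < tan delta * complex.Re z -> cabs z < r -> sector r (- delta) delta z.
Proof.
move=> /andP[d0 d1] z0 hz zr; apply/sectorE; exists (cabs z), (arg z).
have p0 := pi_gt0 R.
split; last exact: arg_polar.
  by rewrite zr andbT; apply: lt_le_trans (Re_le_cabs z); rewrite gtr0_norm.
rewrite /arg -ltr_norml.
have dE : atan (tan delta) = delta by rewrite tanK// in_itv /=; apply/andP; split; lra.
move: hz; rewrite -ltr_pdivrMr// -[X in _ / X](gtr0_norm z0) -normf_div.
move: (complex.Im z / complex.Re z) => v; rewrite !ltr_norml => /andP[v1 v2].
by apply/andP; split; rewrite -dE -?atanN; apply: lt_atan.
Qed.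

Lemma sector_rot r (theta alpha beta : R) z :
  sector r alpha beta z -> sector r (theta + alpha) (theta + beta) (expi theta * z).
Proof.
move=> /sectorE[rho [t [h1 /andP[h2 h3] ->]]]; apply/sectorE; exists rho, (theta + t).
by split => //; [rewrite !ltrD2l h2|rewrite expiD mulrCA].
Qed.

End ZeroCounts.

(** * Zeros around the positive real axis *)

Section RightCount.
Variable R : realType.
Local Notation C := R[i].
Implicit Types (x y t r : R) (a : nat -> C) (z w : C) (s : seq C).

Lemma count_le_add (T : eqType) (s : seq T) (P Q Q' : pred T) :
  (forall u, u \in s -> P u -> Q u || Q' u) -> (count P s <= count Q s + count Q' s)%N.
Proof.
move=> h; rewrite -count_predUI; apply: leq_trans (leq_addr _ _).
elim: s h => //= b s IH h; apply: leq_add.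
  by have := h b (mem_head _ _); rewrite /=; case: (P b) => // ->.
by apply: IH => u us; apply: h; rewrite inE us orbT.
Qed.

(** The sector is compared with two rectangles, one ending just beyond [r] and one just before
    [r - q]; the discrepancies lie in the fixed disc of radius [rho0], whose count is bounded. *)
Lemma right_count a n (delta e : R) : (0 < n)%N -> a n != 0 -> 0 < delta < pi / 2 -> 0 < e ->
  exists2 R1, 0 < R1 & forall r s (g : C -> C^o), R1 <= r -> entire g ->
    (forall z, kapteyn_section a n z = linfac s z * g z) ->
    (forall z, cabs z <= 3 * r -> g z != 0) ->
    `|pi * (count (mem (sector r (- delta) delta)) s)%:R - n%:R * r| <= e * r.
Proof.
move=> n0 an hd e0; have [D D0 hD] := rect_count n0 an.
have tau0 := tan_gt0_pihalf hd; have p0 := pi_gt0 R.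
have nn0 : 0 <= (n%:R : R) by [].
(* 48 makes room for Jensen's circles, [(tan delta)^-1] places [c * |Im z| < Re z] inside the
   sector, and the last summand makes the errors [n * q] and [2 * D * q] together at most
   [e / 2 * r] for [q = r / c]. *)
pose c := 48 + (tan delta)^-1 + 2 * (n%:R + 2 * D) / e.
have d0 : 0 <= 2 * (n%:R + 2 * D) / e.
  by rewrite divr_ge0 ?(ltW e0)// mulr_ge0// addr_ge0// mulr_ge0.
have t0 : 0 < (tan delta)^-1 by rewrite invr_gt0.
have c48 : 48 <= c by rewrite /c; lra.
have ct : (tan delta)^-1 <= c by rewrite /c; lra.
have ce : n%:R + 2 * D <= e / 2 * c.
  have -> : n%:R + 2 * D = e / 2 * (2 * (n%:R + 2 * D) / e) by field; rewrite gt_eqF.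
  by rewrite ler_pM2l ?divr_gt0// /c; lra.
have c0 : 0 < c by lra.
have [Y1 Y11 [B hB]] := hD c c0.
have [Y Y2 hY] := kapteyn_zero_bound n0 an c0.
have cY : 48 <= c * Y by apply: le_trans c48 _; rewrite ler_peMr// ltW.
pose rho0 := c * Y + Y.
have [|N hN] := @kapteyn_count_bound R a n rho0 n0 an; first by rewrite /rho0; lra.
(* Beyond [W] the errors that do not grow with [r] are at most [e / 2 * r]. *)
pose W := 2 * (`|B| + n%:R + pi * N%:R) / e.
have W0 : 0 <= W.
  by rewrite divr_ge0 ?(ltW e0)// mulr_ge0// !addr_ge0// mulr_ge0// ltW.
have cY1 : 48 <= c * Y1 by apply: le_trans c48 _; rewrite ler_peMr// ltW.
exists (4 + c * Y1 + W); first by lra.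
move=> r s g hr eg hf g0.
have dich u : u \in s -> 0 <= complex.Re u ->
    c * `|complex.Im u| < complex.Re u \/ disc rho0 u.
  move=> us u0; have [h|h] := ltP (c * `|complex.Im u|) (complex.Re u); [by left|right].
  have fu : kapteyn_section a n u = 0.
    by rewrite hf; apply/eqP; rewrite mulf_eq0 linfac_eq0 us.
  have hI := hY u fu ltac:(by rewrite (ger0_norm u0)).
  have hc : c * `|complex.Im u| <= c * Y by rewrite ler_pM2l// ltW.
  have := cabs_le_ReIm u; rewrite (ger0_norm u0) /disc /rho0.
  by move: h hI hc; clear; lra.
(* Zeros with [c * |Im z| < Re z < r] have height below [q]. The rectangles get half-height [2 * q],
   so that [c * (2 * q) = 2 * r] exceeds their right ends. *)
pose q := r / c; have cq : c * q = r by rewrite /q mulrC divfK// gt_eqF.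
have r0 : 0 < r by lra.
have q0 : 0 < q by rewrite divr_gt0.
have q48 : 48 * q <= r by rewrite -cq ler_pM2r.
have qY : Y1 <= 2 * q.
  rewrite -(ler_pM2l c0) mulrCA cq; lra.
have qe : n%:R * q + 2 * (D * q) <= e / 2 * r.
  have -> : n%:R * q + 2 * (D * q) = (n%:R + 2 * D) * q by ring.
  by have -> : e / 2 * r = e / 2 * c * q; [rewrite -cq; ring|rewrite ler_pM2r].
have We : B + n%:R + pi * N%:R <= e / 2 * r.
  have : `|B| + n%:R + pi * N%:R <= e / 2 * r.
    have -> : `|B| + n%:R + pi * N%:R = e / 2 * W by rewrite /W; field; rewrite gt_eqF.
    by rewrite ler_pM2l ?divr_gt0//; lra.
  by have := ler_norm B; lra.
have hNs := hN s g eg hf.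
have [x0 hx0 nx0] := exists_notin (map (@complex.Re R) s) (@ltr01 R).
have [x00 x01] := andP hx0.
have hd2 : delta < pi / 2 by case/andP: hd.
have [|X1 /andP[X11 X12] nX1] := @exists_notin R (map (@complex.Re R) s) r (r + 1); first lra.
(* Ending before [r - q] ensures [|z| <= Re z + |Im z| < r] for the zeros of height below [q]. *)
have [|X2 /andP[X21 X22] nX2] := @exists_notin R (map (@complex.Re R) s) (r - q - 1) (r - q).
  lra.
have [u1 u2 u3] : [/\ X1 <= c * (2 * q), 1 + 6 * (2 * q) <= X1 & X1 + 2 * q <= 3 * r].
  by rewrite mulrCA cq; move: q48 hr cY1 W0 X11 X12 q0; clear => *; split; lra.
have [v1 v2 v3] : [/\ X2 <= c * (2 * q), 1 + 6 * (2 * q) <= X2 & X2 + 2 * q <= 3 * r].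
  by rewrite mulrCA cq; move: q48 hr cY1 W0 X21 X22 q0; clear => *; split; lra.
have up := hB x0 X1 (2 * q) (3 * r) s g hx0 qY u1 u2 eg hf g0 u3 nx0 nX1.
have lo := hB x0 X2 (2 * q) (3 * r) s g hx0 qY v1 v2 eg hf g0 v3 nx0 nX2.
have cu : (count (mem (sector r (- delta) delta)) s <=
    count (inside x0 X1 (2 * q)) s + count (disc rho0) s)%N.
  apply: count_le_add => u us /set_mem hu.
  have u0 := sector_Re hd2 hu; have /andP[_ ur] := sector_lt hu.
  have Rr : complex.Re u < r by apply: le_lt_trans ur; apply: le_trans (Re_le_cabs u); exact: ler_norm.
  have [h|->] := dich u us (ltW u0); last by rewrite orbT.
  case: (boolP (disc rho0 u)) => [_|]; first by rewrite orbT.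
  rewrite orbF /disc -ltNge /rho0 => hu2.
  have hI : `|complex.Im u| < q by rewrite -(ltr_pM2l c0) cq; exact: lt_trans Rr.
  have hI2 : 48 * `|complex.Im u| <= c * `|complex.Im u| by rewrite ler_wpM2r.
  have := cabs_le_ReIm u; rewrite (gtr0_norm u0) => hc.
  have hx : x0 < complex.Re u by move: hc hu2 hI2 h cY Y2 x01 (normr_ge0 (complex.Im u)); clear; lra.
  rewrite /inside hx /= -ltr_norml; move: Rr X11 hI q0; clear => *; apply/andP; split; lra.
have cl : (count (inside x0 X2 (2 * q)) s <=
    count (mem (sector r (- delta) delta)) s + count (disc rho0) s)%N.
  apply: count_le_add => u us /andP[/andP[h1 h2] h3].
  have u0 : 0 < complex.Re u by lra.
  have [h|->] := dich u us (ltW u0); last by rewrite orbT.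
  apply/orP; left; apply/mem_set; apply: sector_slope => //.
    rewrite -(ltr_pM2l t0) mulKf ?gt_eqF//.
    by apply: le_lt_trans h; rewrite ler_wpM2r.
  apply: le_lt_trans (cabs_le_ReIm u) _; rewrite (gtr0_norm u0).
  have : `|complex.Im u| < q by rewrite -(ltr_pM2l c0) cq; lra.
  by move: h2 X22; clear; lra.
have nX1r : n%:R * X1 <= n%:R * (r + 1) by rewrite ler_wpM2l// ltW.
have nX2r : n%:R * (r - q - 1) <= n%:R * X2 by rewrite ler_wpM2l// ltW.
have nq0 : 0 <= n%:R * q by rewrite mulr_ge0// ltW.
move: up lo cu cl hNs nX1r nX2r nq0 qe We p0 nn0; rewrite -!(ler_nat R) !natrD.
clear; move: (count (inside x0 X1 _) s)%:R (count (inside x0 X2 _) s)%:R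
  (count (disc rho0) s)%:R (count (mem (sector r _ _)) s)%:R (n%:R : R) (N%:R : R).
move=> C1 C2 Cd Cs m M; rewrite !ler_norml => /andP[_ a2] /andP[a3 _] a5 a6 a7.
move=> a8 a9 a10 a11 a12 p0 m0.
have b5 : pi * Cs <= pi * (C1 + Cd) by rewrite ler_pM2l.
have b6 : pi * C2 <= pi * (Cs + Cd) by rewrite ler_pM2l.
have b7 : pi * Cd <= pi * M by rewrite ler_pM2l.
move: a2 a3 a8 a9 a10 a11 a12 b5 b6 b7; clear => *; apply/andP; split; lra.
Qed.

End RightCount.

(** * Zero counts in sectors of arbitrary direction *)

Section SectorCounts.
Variable R : realType.
Local Notation C := R[i].
Implicit Types (x y t r : R) (a : nat -> C) (z w : C) (s : seq C).

Lemma cvg_count_ratio (F : R -> \bar R) (l : R) :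
  (forall e, 0 < e -> exists2 R1, 0 < R1 & forall r, R1 <= r ->
    exists2 k : nat, F r = (k%:R)%:E & `|k%:R - l * r| <= e * r) ->
  (F r * (r^-1)%:E)%E @[r --> +oo%R] --> l%:E.
Proof.
move=> h; have H e : 0 < e -> \forall r \near +oo%R,
    exists2 v, (F r * (r^-1)%:E)%E = v%:E & `|l - v| <= e.
  move=> /h[R1 R10 hR]; near=> r.
  have rR : R1 <= r by near: r; apply: nbhs_pinfty_ge; exact: num_real.
  have r0 : 0 < r by exact: lt_le_trans rR.
  have [k Fk hk] := hR r rR; exists (k%:R * r^-1); first by rewrite Fk -EFinM.
  have -> : l - k%:R * r^-1 = - ((k%:R - l * r) / r) by field; rewrite gt_eqF.
  by rewrite normrN normf_div (gtr0_norm r0) ler_pdivrMr.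
apply/fine_cvgP; split.
  by apply: filterS (H 1 ltr01) => r [v -> _].
apply/cvgrPdist_le => e /H; apply: filterS => r [v hv].
by rewrite /= hv.
Unshelve. all: by end_near.
Qed.

Lemma linfac_sign (b : bool) s z :
  linfac s ((-1) ^+ b * z) =
  (-1) ^+ b ^+ size s * linfac (map (fun u => (-1) ^+ b * u) s) z.
Proof.
rewrite /linfac; elim: s => [|u s IH]; first by rewrite !big_nil mulr1.
rewrite /= !big_cons IH exprS -!mulrA mulrCA [RHS]mulrCA; congr (_ * _).
rewrite [RHS]mulrA; congr (_ * _).
by rewrite mulrBr mulrA -expr2 sqrr_sign mul1r.
Qed.

Lemma kapteyn_sign a n (b : bool) z : kapteyn_section a n ((-1) ^+ b * z) =
  kapteyn_section (fun k => (-1) ^+ b ^+ k * a k) n z.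
Proof.
case: b; first by rewrite expr1 mulN1r kapteyn_opp.
rewrite expr0 mul1r; congr (kapteyn_section _ n z).
by apply/funext => k; rewrite expr1n mul1r.
Qed.

Lemma axis_count a n (b : bool) (theta delta e : R) : (0 < n)%N -> a n != 0 ->
  expi theta = (-1) ^+ b -> 0 < delta < pi / 2 -> 0 < e ->
  exists2 R1, 0 < R1 & forall r, R1 <= r -> exists2 k : nat,
    zero_count (kapteyn_section a n) r (theta - delta) (theta + delta) = (k%:R)%:E &
    `|k%:R - n%:R / pi * r| <= e * r.
Proof.
move=> n0 an hb hd e0; have p0 := pi_gt0 R.
pose a' k := (-1) ^+ b ^+ k * a k.
have an' : a' n != 0 by rewrite mulf_neq0// expf_neq0// signr_eq0.
(* The tolerance is [pi * e] because [right_count] estimates [pi] times the number of zeros. *)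
have [R1 R10 hR] := right_count n0 an' hd (mulr_gt0 p0 e0).
exists R1 => // r rR; have r0 : 0 < r by exact: lt_le_trans rR.
have [s [g eg [hf g0]]] := kapteyn_factor (3 * r) n0 an'.
have := hR r s g rR eg hf g0; set k := count _ s => hk; exists k; last first.
  have -> : k%:R - n%:R / pi * r = (pi * k%:R - n%:R * r) / pi.
    by rewrite mulrBl (mulrC pi) mulfK ?gt_eqF// mulrAC.
  by rewrite normf_div (gtr0_norm p0) ler_pdivrMr// (mulrC _ pi) mulrA.
pose sg u : C := (-1) ^+ b * u.
have sgK : involutive sg by move=> u; rewrite /sg mulrA -expr2 sqrr_sign mul1r.
pose h : C -> C^o := fun z => (-1) ^+ b ^+ size s * g (sg z).
have eh : entire h.
  apply: entireM (entire_cst _) _.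
  by apply: entire_ext (entire_comp ((-1) ^+ b) 0 eg) => z; rewrite addr0.
have hfs z : kapteyn_section a n z = linfac (map sg s) z * h z.
  rewrite -{1}(sgK z) kapteyn_sign hf linfac_sign /h [RHS]mulrCA mulrA.
  by [].
have h0 z : sector r (theta - delta) (theta + delta) z -> h z != 0.
  move=> /sector_lt /andP[_ zr]; rewrite /h mulf_neq0 ?expf_neq0 ?signr_eq0// g0//.
  by rewrite cabsM cabsX cabsN cabs1 expr1n mul1r; lra.
rewrite (zero_count_factor eh hfs h0) count_map; congr ((_%:R)%:E).
apply: eq_count => u; apply/idP/idP => /set_mem hu; apply/mem_set.
  have := sector_rot (- theta) hu; rewrite expiN hb !addKr.
  by rewrite -[(_ ^+ _)^-1]/((-1) ^- b) -exprVn invrN1 -/(sg (sg u)) sgK.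
by have := sector_rot theta hu; rewrite hb.
Qed.

Lemma expi_int_pi (m : int) : exists b : bool, expi (m%:~R * pi : R) = (-1) ^+ b.
Proof.
have H k : expi (k%:R * pi : R) = (-1) ^+ odd k by rewrite -expiX expi_pi signr_odd.
case: m => k; [exists (odd k)|exists (odd k.+1)]; first exact: H.
by rewrite NegzE mulrNz mulNr expiN H -exprVn invrN1.
Qed.

Lemma sin_eq0_int_pi (theta : R) : sin theta = 0 -> exists m : int, theta = m%:~R * pi.
Proof.
move=> h; have p0 := pi_gt0 R; pose m := Num.floor (theta / pi); exists m.
have /andP[m1 m2] := floor_itv (theta / pi); rewrite -/m in m1 m2.
have u0 : 0 <= theta - m%:~R * pi by rewrite subr_ge0 -ler_pdivlMr.
have u1 : theta - m%:~R * pi < pi.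
  by move: m2; rewrite ltr_pdivrMr// intrD mulrDl mul1r ltrBlDl.
apply/eqP; rewrite -subr_eq0 eq_le u0 andbT leNgt; apply/negP => u2.
have [b hb] := expi_int_pi m.
have : complex.Im (expi (theta - m%:~R * pi)) = 0.
  rewrite expiD expiN hb /expi h; clear hb.
  by case: b; rewrite ?expr1 ?expr0 ?invrN1 ?invr1 /= ?oppr0 ?mulr0 ?mul0r ?addr0.
by apply/eqP; rewrite gt_eqF// sin_gt0_pi// u2 u1.
Qed.

Lemma sin_lip (t u : R) : `|sin t - sin u| <= `|t - u|.
Proof.
have h : expi t - expi u = expi u * (expi (t - u) - 1).
  by rewrite mulrBr -expiD mulr1 subrKC.
have := Im_le_cabs (expi t - expi u); rewrite {2}h cabsM cabs_expi mul1r => h1.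
exact: le_trans h1 (cabs_expi_sub1 _).
Qed.

(** Since [sin] is 1-Lipschitz, [|sin t|] stays above [|sin theta| / 2] throughout the sector. There
    [|Re z| <= eps^-1 * |Im z|], which confines the zeros to a disc independent of [r]. *)
Lemma off_axis_count a n (theta delta : R) : (0 < n)%N -> a n != 0 ->
  0 < delta < `|sin theta| / 2 ->
  exists N, forall r, 0 < r -> exists2 k : nat,
    zero_count (kapteyn_section a n) r (theta - delta) (theta + delta) = (k%:R)%:E &
    (k <= N)%N.
Proof.
move=> n0 an /andP[d0 d1]; pose eps := `|sin theta| / 2.
have e0 : 0 < eps by rewrite /eps; lra.
have c0 : 0 < eps^-1 by rewrite invr_gt0.
have [Y Y1 hY] := kapteyn_zero_bound n0 an c0.
have [|N hN] := @kapteyn_count_bound R a n (eps^-1 * Y + Y) n0 an.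
  by rewrite ltr_pwDr ?mulr_ge0 ?(ltW c0)//; lra.
exists N => r r0; have [s [g eg [hf g0]]] := kapteyn_factor r n0 an.
have h0 z : sector r (theta - delta) (theta + delta) z -> g z != 0.
  by move=> /sector_lt /andP[_ /ltW zr]; exact: g0.
exists (count (mem (sector r (theta - delta) (theta + delta))) s).
  exact: zero_count_factor eg hf h0.
apply: leq_trans (hN s g eg hf).
rewrite -[leqRHS]addn0 -[X in (_ + X)%N](count_pred0 s).
apply: count_le_add => u us /set_mem [rho [t [/andP[rho0 _] /andP[t1 t2] hu]]].
rewrite orbF; have fu : kapteyn_section a n u = 0.
  by rewrite hf; apply/eqP; rewrite mulf_eq0 linfac_eq0 us.
have hs : eps <= `|sin t|.
  have hl := sin_lip theta t; have hdl : `|theta - t| <= delta.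
    by rewrite ler_norml; apply/andP; split; lra.
  have := ler_normD (sin theta - sin t) (sin t); rewrite subrK.
  by move: hl hdl d1; rewrite /eps; clear; lra.
have uE : complex.Re u = rho * cos t /\ complex.Im u = rho * sin t by rewrite hu.
have hI : rho <= eps^-1 * `|complex.Im u|.
  rewrite uE.2 normrM (gtr0_norm rho0) mulrCA ler_peMr ?(ltW rho0)//.
  by rewrite mulrC ler_pdivlMr// mul1r.
have hRI : `|complex.Re u| <= eps^-1 * `|complex.Im u|.
  apply: le_trans hI; rewrite uE.1 normrM (gtr0_norm rho0) ler_piMr ?(ltW rho0)//.
  by rewrite ler_norml cos_geN1 cos_le1.
have hY' := hY u fu hRI.
rewrite /disc; apply: le_trans (cabs_le_ReIm u) _; apply: lerD; last exact: ltW.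
by apply: le_trans hRI _; rewrite ler_pM2l// ltW.
Qed.

Lemma kapteyn0_count a r (alpha beta : R) : a 0%N != 0 ->
  zero_count (kapteyn_section a 0) r alpha beta = 0%E.
Proof.
move=> a0; rewrite (@zero_count_factor R _ (kapteyn_section a 0) [::])//.
- exact: entire_kapteyn.
- by move=> z; rewrite /linfac big_nil mul1r.
- by move=> z _; rewrite kapteyn0.
Qed.

End SectorCounts.

Theorem mainTheorem4 (R : realType) (a : nat -> R[i])
    (ha : infinite_set [set n | a n != 0]) (theta : R) :
  exists2 delta0 : R, 0 < delta0 &
    forall delta : R, 0 < delta < delta0 ->
    forall n' : nat, a n' != 0 ->
      (zero_count (kapteyn_section a n') r (theta - delta) (theta + delta)
         * (r^-1)%:E)%E @[r --> +oo%R] -->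
      (if `[< exists m : int, theta = m%:~R * pi >] then n'%:R / pi
       else 0)%:E.
Proof.
case: asboolP => [[m hm]|hm].
  exists (pi / 2); first by rewrite divr_gt0// pi_gt0.
  move=> delta hd n an; apply: cvg_count_ratio => e e0.
  (* For index 0 the section is the non-zero constant [a 0], and the claimed density is 0 as
     well. *)
  case: n an => [|n] an.
    exists 1 => // r r1; exists 0%N; first exact: kapteyn0_count.
    by rewrite !mul0r subr0 normr0 mulr_ge0 ?(ltW e0)//; lra.
  have [b hb] := expi_int_pi R m.
  by apply: (@axis_count R a n.+1 b theta delta e) => //; rewrite hm.
have s0 : sin theta != 0 by apply/eqP => /sin_eq0_int_pi.
exists (`|sin theta| / 2); first by rewrite divr_gt0// normr_gt0.
move=> delta hd n an; apply: cvg_count_ratio => e e0.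
case: n an => [|n] an.
  exists 1 => // r r1; exists 0%N; first exact: kapteyn0_count.
  by rewrite !mul0r subr0 normr0 mulr_ge0 ?(ltW e0)//; lra.
have [N hN] := off_axis_count (ltn0Sn n) an hd.
have N0 : 0 <= N%:R / e by rewrite divr_ge0// ltW.
exists (N%:R / e + 1); first lra.
move=> r rN; have [|k hk kN] := hN r; first lra.
exists k => //; rewrite mul0r subr0 ger0_norm//.
apply: le_trans (_ : N%:R <= _); first by rewrite ler_nat.
by rewrite mulrC -ler_pdivrMr//; lra.
Qed.
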